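(* Let $\mu\ge 2\pi$, and let $\Omega$ be either the worm domain $\mathcal{W}_\mu$ or the truncated worm domain $\mathcal{W}'_\mu$. Let $A^2(\overline{\Omega})$ denote the closure in $A^2(\Omega)$ of the set of (restrictions to $\Omega$ of) functions that are holomorphic in a neighborhood of $\overline{\Omega}$. Then there is an open set $\widehat{\Omega}\subset\mathbb{C}^2$ with $\widehat\Omega\supseteq\Omega$ and $$\widehat{\Omega}\supseteq\bigcup_{-\mu\le a\le\mu-2\pi}\big\{(z_1,z_2)\in\mathbb{C}^2:\ a<\log|z_2|^2<a+2\pi,\ |z_1-e^{ia}|<1\big\}$$ such that every $f\in A^2(\overline{\Omega})$ is holomorphic on $\widehat{\Omega}$ (i.e. extends to a holomorphic function on $\widehat{\Omega}$). Therefore $A^2(\overline{\Omega})\subsetneqq A^2(\Omega)$.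
   Context: For $\mu>0$, the worm domain is $$\mathcal{W}_\mu=\big\{(z_1,z_2)\in\mathbb{C}^2:\ z_2\ne0,\ \big|\log|z_2|^2\big|\le A,\ \big|z_1-e^{i\log|z_2|^2}\big|^2<1-\varphi\big(\log|z_2|^2\big)\big\},$$ where $A>\mu$ and $\varphi:[-A,A]\to[0,1]$ is a smooth, convex, even function that vanishes identically on $[-\mu,\mu]$, with $\varphi(A)=1$ and $\varphi$ increasing on $[\mu,A]$. The truncated worm domain is $$\mathcal{W}'_\mu=\big\{(z_1,z_2)\in\mathbb{C}^2:\ z_2\neq 0,\ \big|z_1-e^{i\log|z_2|^2}\big|^2<1,\ \big|\log|z_2|^2\big|<\mu\big\}.$$ For a domain $\Omega\subset\mathbb{C}^2$, $A^2(\Omega)$ is the Bergman space of holomorphic functions on $\Omega$ that are square integrable with respect to Lebesgue measure, with the $L^2$ norm. *)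

(* Defs.v *)
From HB Require Import structures.
From mathcomp Require Import all_boot all_order all_algebra.
From mathcomp Require Export complex.
From mathcomp Require Import all_classical all_reals all_analysis.
Import Order.TTheory GRing.Theory Num.Theory.
Import numFieldNormedType.Exports.

Set Implicit Arguments.
Unset Strict Implicit.
Unset Printing Implicit Defensive.

Local Open Scope classical_set_scope.
Local Open Scope ring_scope.

(* C^2.  The regular modules [R[i]^o] are what carries the topology and the
   normed-module structure over the scalar field [R[i]], so that [open],
   [closure] and [differentiable] below are those of C^2 over C (the product
   carries the max norm, which induces the usual topology). *)
Notation C2 R := (R[i]^o * R[i]^o)%type.

(* Complex Frechet differentiability, i.e. with a C-linear differential. *)
Definition holomorphic_on (R : realType) (U : set (C2 R))
    (f : C2 R -> R[i]^o) : Prop :=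
  forall z, U z -> differentiable f z.

(* Lebesgue measure on R^2.  The named copy carries the sigma-finite structure
   that inference does not find on the bare product, where the library's
   instance for products of subprobabilities takes precedence. *)
Definition lebesgue_measure2 (R : realType) :
    set (measurableTypeR R * measurableTypeR R) -> \bar R :=
  (@lebesgue_measure R \x @lebesgue_measure R)%E.

HB.instance Definition _ (R : realType) := Measure.on (@lebesgue_measure2 R).

Lemma lebesgue_measure2_sigma_finite (R : realType) :
  sigma_finite setT (@lebesgue_measure2 R).
Proof.
have /sigma_finiteP[F [TF ndF Foo]] := sigma_finiteT (@lebesgue_measure R).
exists (fun n => F n `*` F n).
  rewrite -setXTT TF predeqE => -[x y]; split.
    move=> [/= [n _ Fnx] [k _ Fky]]; exists (maxn n k) => //; split.
    - by move: x Fnx; exact/subsetPset/ndF/leq_maxl.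
    - by move: y Fky; exact/subsetPset/ndF/leq_maxr.
  by move=> [n _ []/= ? ?]; split; exists n.
move=> k; have [mF Fk] := Foo k; split; first exact: measurableX.
by rewrite /lebesgue_measure2 product_measure1E// lte_mul_pinfty// ge0_fin_numE.
Qed.

HB.instance Definition _ (R : realType) :=
  Measure_isSigmaFinite.Build _ _ _ (@lebesgue_measure2 R)
    (@lebesgue_measure2_sigma_finite R).

(* Lebesgue measure on R^4 = R^2 x R^2, on the product Borel sigma-algebra; it
   is transported to C^2 along [toC2]. *)
Definition lebesgue_measure4 (R : realType) :
    {measure set ((measurableTypeR R * measurableTypeR R) *
                  (measurableTypeR R * measurableTypeR R))%type -> \bar R} :=
  (@lebesgue_measure2 R \x @lebesgue_measure2 R)%E.

Definition toC2 (R : realType) (p : (R * R) * (R * R)) : C2 R :=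
  (Complex p.1.1 p.1.2, Complex p.2.1 p.2.2).

Definition L2norm (R : realType) (Omega : set (C2 R))
    (f : C2 R -> R[i]^o) : \bar R :=
  'N[lebesgue_measure4 R]_(2%:E)
    [EFin \o ((fun p => Normc.normc (f (toC2 p))) \_ (@toC2 R @^-1` Omega))].

(* Elements of A^2(Omega) are represented by total functions on C^2.  When
   Omega is open, membership in the sets below depends only on the values taken
   on Omega. *)
Definition bergman (R : realType) (Omega : set (C2 R)) :
    set (C2 R -> R[i]^o) :=
  [set f | holomorphic_on Omega f /\ (L2norm Omega f < +oo)%E].

Definition holomorphic_near_closure (R : realType) (Omega : set (C2 R)) :
    set (C2 R -> R[i]^o) :=
  [set h | exists U : set (C2 R),
     [/\ open U, closure Omega `<=` U & holomorphic_on U h]].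

Definition bergman_closure (R : realType) (Omega : set (C2 R)) :
    set (C2 R -> R[i]^o) :=
  [set f | bergman Omega f /\
     forall e : R, 0 < e ->
       exists2 h, holomorphic_near_closure Omega h &
                  (L2norm Omega (f \- h)%R < e%:E)%E].

Definition expi (R : realType) (t : R) : R[i] := Complex (cos t) (sin t).

(* Beware that [ln 0 = 0]: hence the explicit [z.2 != 0] in the sets below. *)
Definition logsq (R : realType) (w : R[i]) : R := ln (Normc.normc w ^+ 2).

(* Smoothness on a set that need not be open: restriction of a function
   which is C^infinity on the whole line. *)
Definition smooth_on (R : realType) (D : set R) (phi : R -> R) : Prop :=
  exists g : R -> R, (forall n x, derivable (derive1n n g) x 1) /\
                     {in D, phi =1 g}.

(* "Increasing" is taken in the weak sense, which is the weaker hypothesis. *)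
Definition worm_profile (R : realType) (mu A : R) (phi : R -> R) : Prop :=
  [/\ mu < A,
      (forall t : R, t \in `[- A, A] -> 0 <= phi t <= 1),
      smooth_on `[- A, A] phi,
      convex_function (E := R^o) `[- A, A] phi &
   [/\ (forall t : R, t \in `[- A, A] -> phi (- t) = phi t),
       (forall t : R, t \in `[- mu, mu] -> phi t = 0),
       phi A = 1 &
       {in `[mu, A] &, {homo phi : s t / s <= t}}]].

Definition worm (R : realType) (A : R) (phi : R -> R) : set (C2 R) :=
  [set z | [/\ z.2 != 0, `|logsq z.2| <= A &
     Normc.normc (z.1 - expi (logsq z.2)) ^+ 2 < 1 - phi (logsq z.2)]].

Definition truncated_worm (R : realType) (mu : R) : set (C2 R) :=
  [set z | [/\ z.2 != 0,
     Normc.normc (z.1 - expi (logsq z.2)) ^+ 2 < 1 & `|logsq z.2| < mu]].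

Definition disc_annulus (R : realType) (a : R) : set (C2 R) :=
  [set z | [/\ z.2 != 0, a < logsq z.2 < a + 2 * pi &
     Normc.normc (z.1 - expi a) < 1]].

(* Main.v *)
(* Fix a with -mu < a < mu - 2 pi.  For f on Omega, z_1 in the disc
   |z_1 - e^{ia}| < 1 and a < log|z_2|^2 < a + 2 pi, put

     H_a f(z_1, z_2) = (1 / 2 pi i) (int_{log|w|^2 = a + 2 pi} - int_{log|w|^2 = a})
                         f(z_1, w) / (w - z_2) dw.

   Both circles lie in Omega because e^{i(a + 2 pi)} = e^{ia}, and H_a f is
   holomorphic.  If h is holomorphic near the closure of Omega, it is so near
   the Hartogs figure formed by these two circles times the closed disc and by
   {z_1 = 0} times the closed annulus; hence H_a h = h for z_1 near 0 and, by
   unique continuation along segments issued from 0, H_a h = h on Omega and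
   H_a h = H_b h wherever both are defined.  Convergence in L^2(Omega) implies
   uniform convergence on the circles, so these identities pass to every f in
   the closure of the space of such h, and the H_a f glue to an extension of f.

   The function e^{it/2} sqrt(z_1 e^{-it}), with t = log|z_2|^2, is a bounded
   holomorphic square root of z_1 on Omega.  At z_1 = 1 it takes the value 1
   for small t > 0 and -1 for t slightly below 2 pi.  It is not in the closure:
   the mean of an extension over the circle log|z_2|^2 = t, at z_1 = 1, would not
   depend on t in (0, 2 pi). *)

From HB Require Import structures.
Require Import Defs.
From mathcomp Require Import all_boot all_order all_algebra.
From mathcomp Require Import all_classical all_reals all_analysis.
From mathcomp Require Import measurable_realfun ring lra.
Import Order.TTheory GRing.Theory Num.Theory.
Import numFieldNormedType.Exports.
Import Normc.

Set Implicit Arguments.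
Unset Strict Implicit.
Unset Printing Implicit Defensive.

Local Open Scope classical_set_scope.
Local Open Scope ring_scope.

(** The point 0 lies on the boundary of every slice [|z_1 - e^{it}| < 1], and it is the only point
    common to all the closed slices. No neighbourhood of a common [z_1] times the whole annulus fits
    inside Omega, which is why [H_a] is compared with the function only for [h] holomorphic near the
    closure, the limit being taken afterwards. The restriction [-mu < a < mu - 2 pi] keeps both
    circles in Omega; an end value of [a] is recovered because membership in the annulus is an open
    condition on [a], so that [a] can be moved inwards.

    The one-variable theory rests on contour integrals over rectangles. Circles are reached through
    the exponential: an annulus is the image of a rectangle of height 2 pi whose horizontal edges
    cancel by periodicity. Differentiation under the integral sign is replaced by difference
    quotients that are themselves integrals, so that only continuity in the parameters is needed.
    The passage from L^2 to pointwise bounds uses the Cauchy formula on rectangles whose edges are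
    selected by averaging. *)

(** * Pointwise continuity and the topology of [R[i]] *)

(* Locked, so that the automation does not unfold the topology of [R[i]^o]. *)
HB.lock Definition ctat (T U : topologicalType) (f : T -> U) (p : T) : Prop :=
  f @ p --> f p.

Lemma ctatP (T U : topologicalType) (f : T -> U) (p : T) :
  ctat f p <-> f @ p --> f p.
Proof. by rewrite ctat.unlock. Qed.

Lemma ctat_near (T U : topologicalType) (f : T -> U) (p : T) (P : U -> Prop) :
  ctat f p -> (\forall y \near f p, P y) -> \forall x \near p, P (f x).
Proof. by move=> /ctatP/(_ P). Qed.

Section ComplexTopology.
Variable R : realType.
Local Notation C := (R[i]^o).
Implicit Types (z w : C).

Lemma normC_normc z : `|z| = (normc z)%:C%C.
Proof. by case: z => a b; rewrite normc_def. Qed.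

Lemma normc_ge0 z : 0 <= normc z.
Proof. by case: z => a b; exact: sqrtr_ge0. Qed.

Lemma normc_eq0 z : (normc z == 0) = (z == 0).
Proof.
by apply/eqP/eqP => [/eq0_normc//|->]; exact: normc0.
Qed.

Lemma normc_gt0 z : (0 < normc z) = (z != 0).
Proof. by rewrite lt_def normc_ge0 andbT normc_eq0. Qed.

Lemma normcB z w : normc (z - w) = normc (w - z).
Proof. by rewrite -normcN opprB. Qed.

Lemma ler_normcB z w : `|normc z - normc w| <= normc (z - w).
Proof.
have h (x y : C) : normc x - normc y <= normc (x - y).
  by rewrite lerBlDr (le_trans _ (le_normcD _ _))// subrK.
by rewrite ler_norml h andbT lerNl opprB normcB h.
Qed.

Lemma normc_Re z : `|complex.Re z| <= normc z.
Proof.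
by case: z => a b /=; rewrite -sqrtr_sqr ler_wsqrtr// lerDl sqr_ge0.
Qed.

Lemma normc_Im z : `|complex.Im z| <= normc z.
Proof.
by case: z => a b /=; rewrite -sqrtr_sqr ler_wsqrtr// lerDr sqr_ge0.
Qed.

Lemma ReB z w : complex.Re (z - w) = complex.Re z - complex.Re w.
Proof. by case: z w => ? ? []. Qed.

Lemma ImB z w : complex.Im (z - w) = complex.Im z - complex.Im w.
Proof. by case: z w => ? ? []. Qed.

Lemma normc_ReIm z : normc z <= `|complex.Re z| + `|complex.Im z|.
Proof.
case: z => a b /=.
have h : 0 <= `|a| + `|b| by rewrite addr_ge0.
rewrite -(ger0_norm h) -sqrtr_sqr ler_wsqrtr// sqrrD !real_normK ?num_real//.
by rewrite -addrA lerD2l lerDr mulrn_wge0// mulr_ge0.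
Qed.

Lemma normcX z n : normc (z ^+ n) = normc z ^+ n.
Proof.
by elim: n => [|n ih]; rewrite ?expr0 ?normc1// !exprS normcM ih.
Qed.

Lemma normc_real (x : R) : normc (x%:C)%C = `|x|.
Proof. by rewrite /= expr0n addr0 sqrtr_sqr. Qed.

(** Balls of [R[i]^o] have their radii in [R[i]]; a positive element of [R[i]] is real, so real
    radii suffice. *)
Lemma nbhsCP z (P : C -> Prop) :
  (\forall w \near z, P w) <->
  exists2 r : R, 0 < r & forall w, normc (w - z) < r -> P w.
Proof.
split.
  move/nbhs_ballP => [e /= e0 He].
  have [e1 e2] : complex.Im e = 0 /\ 0 < complex.Re e.
    by move: e0; rewrite ltcE /= => /andP[/eqP].
  exists (complex.Re e) => // w wz; apply: He.
  rewrite -ball_normE /= distrC normC_normc ltcE/= e1 eqxx/=; exact: wz.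
move=> [r r0 h]; apply/nbhs_ballP; exists (r%:C)%C; first by rewrite /= ltcR.
move=> w; rewrite -ball_normE /= distrC normC_normc ltcR; exact: h.
Qed.

Lemma cvgCP (T : Type) (F : set_system T) (f : T -> C) z : Filter F ->
  (f @ F --> z) <->
  (forall e : R, 0 < e -> \forall x \near F, normc (f x - z) < e).
Proof.
move=> FF; split=> [h e e0|h].
  by apply: (h (fun w => normc (w - z) < e)); apply/nbhsCP; exists e.
move=> P /nbhsCP[r r0 rP]; have := h r r0; apply: filterS => x; exact: rP.
Qed.

Lemma cvg_normc (T : Type) (F : set_system T) (f : T -> C) z : Filter F ->
  f @ F --> z -> (normc (f x) @[x --> F]) --> normc z.
Proof.
move=> FF /cvgCP h; apply/cvgrPdist_lt => e e0.
have := h e e0; apply: filterS => x; apply: le_lt_trans.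
by rewrite normcB; exact: ler_normcB.
Qed.

Lemma cvg_Re (T : Type) (F : set_system T) (f : T -> C) z : Filter F ->
  f @ F --> z -> (complex.Re (f x) @[x --> F]) --> complex.Re z.
Proof.
move=> FF /cvgCP h; apply/cvgrPdist_lt => e e0.
have := h e e0; apply: filterS => x; apply: le_lt_trans.
rewrite normcB; apply: le_trans (normc_Re _).
by case: (z) (f x) => ? ? [].
Qed.

Lemma cvg_Im (T : Type) (F : set_system T) (f : T -> C) z : Filter F ->
  f @ F --> z -> (complex.Im (f x) @[x --> F]) --> complex.Im z.
Proof.
move=> FF /cvgCP h; apply/cvgrPdist_lt => e e0.
have := h e e0; apply: filterS => x; apply: le_lt_trans.
rewrite normcB; apply: le_trans (normc_Im _).
by case: (z) (f x) => ? ? [].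
Qed.

Lemma cvg_Complex (T : Type) (F : set_system T) (f g : T -> R) a b : Filter F ->
  f @ F --> a -> g @ F --> b ->
  ((Complex (f x) (g x) : C) @[x --> F]) --> (Complex a b : C).
Proof.
move=> FF /cvgrPdist_lt cf /cvgrPdist_lt cg; apply/cvgCP => e e0.
have e2 : 0 < e / 2 by rewrite divr_gt0.
near=> x; apply: le_lt_trans (normc_ReIm _) _ => /=.
rewrite (splitr e) ltrD// distrC; near: x; [exact: cf|exact: cg].
Unshelve. all: by end_near. Qed.

Lemma cvgC_cst (T : Type) (F : set_system T) (a : C) : Filter F ->
  (fun=> a) @ F --> a.
Proof. by move=> FF; exact: cvg_cst. Qed.

Lemma cvgCD (T : Type) (F : set_system T) (f g : T -> C) (a b : C) :
  Filter F -> f @ F --> a -> g @ F --> b -> (fun x => f x + g x) @ F --> a + b.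
Proof. by move=> FF fa gb; exact: (@cvgD R[i] C T F FF f g a b fa gb). Qed.

Lemma cvgCN (T : Type) (F : set_system T) (f : T -> C) (a : C) :
  Filter F -> f @ F --> a -> (fun x => - f x) @ F --> - a.
Proof. by move=> FF fa; exact: (@cvgN R[i] C T F FF f a fa). Qed.

Lemma cvgCM (T : Type) (F : set_system T) (f g : T -> C) (a b : C) :
  Filter F -> f @ F --> a -> g @ F --> b -> (fun x => f x * g x) @ F --> a * b.
Proof. by move=> FF fa gb; exact: (@cvgM R[i] T F FF f g a b fa gb). Qed.

Lemma cvgCV (T : Type) (F : set_system T) (f : T -> C) (a : C) :
  Filter F -> a != 0 -> f @ F --> a -> (fun x => (f x)^-1) @ F --> a^-1.
Proof. by move=> FF a0 fa; exact: (@cvgV R[i] T F FF f a a0 fa). Qed.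

Section continuity.
Variable T : topologicalType.
Implicit Types (f g : T -> C) (p : T).

Lemma ctCP f p : ctat f p <->
  forall e : R, 0 < e -> \forall x \near p, normc (f x - f p) < e.
Proof. by rewrite ctatP; exact: cvgCP. Qed.

Lemma ct_near f g p : (\forall w \near p, f w = g w) -> ctat f p -> ctat g p.
Proof.
move=> fg /ctatP cf; apply/ctatP; rewrite -(nbhs_singleton fg).
exact: cvg_trans (near_eq_cvg fg) cf.
Qed.

Lemma ct_cst (a : C) p : ctat ((fun=> a) : T -> C) p.
Proof. by apply/ctatP; exact: cvgC_cst. Qed.

Lemma ctD f g p : ctat f p -> ctat g p -> ctat (fun x => f x + g x) p.
Proof.
move=> /ctatP cf /ctatP cg; apply/ctatP.
exact: (@cvgCD T (nbhs p) f g _ _ _ cf cg).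
Qed.

Lemma ctN f p : ctat f p -> ctat (fun x => - f x) p.
Proof.
by move=> /ctatP cf; apply/ctatP; exact: (@cvgCN T (nbhs p) f _ _ cf).
Qed.

Lemma ctB f g p : ctat f p -> ctat g p -> ctat (fun x => f x - g x) p.
Proof. by move=> cf cg; apply: ctD => //; exact: ctN. Qed.

Lemma ctM f g p : ctat f p -> ctat g p -> ctat (fun x => f x * g x) p.
Proof.
move=> /ctatP cf /ctatP cg; apply/ctatP.
exact: (@cvgCM T (nbhs p) f g _ _ _ cf cg).
Qed.

Lemma ctV f p : f p != 0 -> ctat f p -> ctat (fun x => (f x)^-1) p.
Proof.
move=> f0 /ctatP cf; apply/ctatP; exact: (@cvgCV T (nbhs p) f _ _ f0 cf).
Qed.

Lemma ct_neq0 f p : f p != 0 -> ctat f p -> \forall w \near p, f w != 0.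
Proof.
move=> fp0 /ctatP/cvgCP/(_ (normc (f p))).
rewrite normc_gt0 => /(_ fp0); apply: filterS => w.
by apply: contraTneq => ->; rewrite sub0r normcN ltxx.
Qed.

End continuity.

Lemma ct_id (T : topologicalType) (p : T) : ctat (fun x : T => x) p.
Proof. by apply/ctatP; exact: cvg_id. Qed.

Lemma ct_comp (T U V : topologicalType) (g : T -> U) (f : U -> V) p :
  ctat g p -> ctat f (g p) -> ctat (fun x => f (g x)) p.
Proof.
move=> /ctatP cg /ctatP cf; apply/ctatP.
exact: (@continuous_comp _ _ _ g f).
Qed.

Lemma ct_fst (T U : topologicalType) (p : T * U) : ctat fst p.
Proof. by apply/ctatP; exact: cvg_fst. Qed.

Lemma ct_snd (T U : topologicalType) (p : T * U) : ctat snd p.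
Proof. by apply/ctatP; exact: cvg_snd. Qed.

Lemma ct_pair (T U V : topologicalType) (f : T -> U) (g : T -> V) p :
  ctat f p -> ctat g p -> ctat (fun x => (f x, g x)) p.
Proof.
by move=> /ctatP cf /ctatP cg; apply/ctatP; exact: cvg_pair.
Qed.

Lemma ct_Re (p : C) : ctat (@complex.Re R : C -> R) p.
Proof.
have h : (fun x : C => x) @ nbhs p --> p by exact: cvg_id.
by apply/ctatP; exact: (cvg_Re _ h).
Qed.

Lemma ct_Im (p : C) : ctat (@complex.Im R : C -> R) p.
Proof.
have h : (fun x : C => x) @ nbhs p --> p by exact: cvg_id.
by apply/ctatP; exact: (cvg_Im _ h).
Qed.

Lemma ct_normc (p : C) : ctat (@normc R : C -> R) p.
Proof.
have h : (fun x : C => x) @ nbhs p --> p by exact: cvg_id.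
by apply/ctatP; exact: (cvg_normc _ h).
Qed.

Lemma ct_Complex (T : topologicalType) (f g : T -> R) p :
  ctat f p -> ctat g p -> ctat (fun x => Complex (f x) (g x) : C) p.
Proof.
by move=> /ctatP cf /ctatP cg; apply/ctatP; exact: cvg_Complex.
Qed.

End ComplexTopology.

(** * Complex differentiability in one variable *)

Lemma differentiable_linear_approx (K : numFieldType) (V W : normedModType K)
  (f : V -> W) (df : {linear V -> W}) (x : V) : continuous df ->
  (forall e, 0 < e ->
     \forall v \near 0, `|f (v + x) - f x - df v| <= e * `|v|) ->
  differentiable f x.
Proof.
move=> cdf h.
have fL : f \o shift x = cst (f x) + df +o_ 0 id.
  apply/eqaddoP => e e0; have := h e e0; apply: filterS => v /=.
  by rewrite opprD addrA.
by apply/diff_locallyP; rewrite (diff_unique cdf fL); split.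
Qed.

Section CDiff.
Variable R : realType.
Local Notation C := (R[i]^o).
Implicit Types (z w p : C) (F G q : C -> C).

(** Caratheodory's factorization, with [q p] as the derivative: sums, products, inverses and
    compositions reduce to algebra on continuous factors. *)
Definition cdiff F p := exists2 q : C -> C,
  ctat q p & forall w, F w - F p = (w - p) * q w.

Lemma cdiff_near F G p :
  (\forall w \near p, F w = G w) -> cdiff F p -> cdiff G p.
Proof.
move=> FG [q cq Fq].
have FGp : F p = G p by exact: nbhs_singleton FG.
(* The factorization is required at every [w], also where [F] and [G] differ, so [q] is replaced by
   the difference quotient of [G]. *)
exists (fun w => if w == p then q p else (G w - G p) / (w - p)); last first.
  move=> w; case: eqP => [->|/eqP wp]; first by rewrite !subrr mul0r.
  by rewrite mulrC divfK// subr_eq0.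
apply: ct_near cq; near=> w; case: eqP => [->//|/eqP wp].
have <- : F w = G w by near: w.
by rewrite -FGp Fq mulrC mulKf// subr_eq0.
Unshelve. all: by end_near. Qed.

Lemma cdiff_continuous F p : cdiff F p -> ctat F p.
Proof.
move=> [q cq Fq].
rewrite (_ : F = fun w => F p + (w - p) * q w).
  apply: ctD; first exact: ct_cst.
  apply: ctM; last exact: cq.
  by apply: ctB; [exact: ct_id|exact: ct_cst].
by apply/funext => w; rewrite -Fq addrC subrK.
Qed.

Lemma cdiff_cst a p : cdiff (fun=> a) p.
Proof.
by exists (fun=> 0) => [|w]; [exact: ct_cst|rewrite subrr mulr0].
Qed.

Lemma cdiff_id p : cdiff id p.
Proof.
by exists (fun=> 1) => [|w]; [exact: ct_cst|rewrite mulr1].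
Qed.

Lemma cdiffD F G p : cdiff F p -> cdiff G p -> cdiff (fun w => F w + G w) p.
Proof.
move=> [q cq Fq] [r cr Gr]; exists (fun w => q w + r w); first exact: ctD.
by move=> w; rewrite mulrDr -Fq -Gr; ring.
Qed.

Lemma cdiffN F p : cdiff F p -> cdiff (fun w => - F w) p.
Proof.
move=> [q cq Fq]; exists (fun w => - q w); first exact: ctN.
by move=> w; rewrite mulrN -Fq; ring.
Qed.

Lemma cdiffB F G p : cdiff F p -> cdiff G p -> cdiff (fun w => F w - G w) p.
Proof. by move=> cF cG; exact: cdiffD cF (cdiffN cG). Qed.

Lemma cdiffM F G p : cdiff F p -> cdiff G p -> cdiff (fun w => F w * G w) p.
Proof.
move=> cdF [r cr Gr]; have cF := cdiff_continuous cdF.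
case: cdF => q cq Fq.
exists (fun w => q w * G p + F w * r w).
  by apply: ctD; apply: ctM => //; exact: ct_cst.
by move=> w; rewrite mulrDr mulrA -Fq mulrCA -Gr; ring.
Qed.

Lemma cdiffX F n p : cdiff F p -> cdiff (fun w => F w ^+ n) p.
Proof.
move=> cF; elim: n => [|n ih]; first exact: cdiff_cst.
rewrite (_ : (fun _ => _) = fun w => F w * F w ^+ n); first exact: cdiffM.
by apply/funext => w; rewrite exprS.
Qed.

Lemma cdiffV F p : F p != 0 -> cdiff F p -> cdiff (fun w => (F w)^-1) p.
Proof.
move=> Fp0 cdF; have cF := cdiff_continuous cdF.
have Fn0 := ct_neq0 Fp0 cF.
case: cdF => q cq Fq.
(* At a zero of [F] the inverse has the default value 0 and the factor [- (F w * F p)^-1] is lost.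
   Such points stay away from [p], so the function is first altered there into one that factors
   through [q]. *)
apply: (@cdiff_near (fun w => if F w == 0 then (F p)^-1 + (F w - F p)
   else (F w)^-1)).
  by apply: filterS Fn0 => w /negbTE ->.
exists (fun w => q w * (if F w == 0 then 1 else - ((F w)^-1 * (F p)^-1))).
  apply: ctM cq _.
  apply: (@ct_near _ _ (fun w => - ((F w)^-1 * (F p)^-1))).
    by apply: filterS Fn0 => w /negbTE ->.
  by apply: ctN; apply: ctM; [exact: ctV|exact: ct_cst].
move=> w; rewrite (negbTE Fp0) mulrA -Fq.
case: eqP => [->|/eqP Fw0]; first by ring.
by field; rewrite Fw0 Fp0.
Qed.

Lemma cdiff_comp F G p : cdiff G p -> cdiff F (G p) -> cdiff (F \o G) p.
Proof.
move=> cdG [q cq Fq]; have cG := cdiff_continuous cdG.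
case: cdG => r cr Gr; exists (fun w => r w * q (G w)).
  by apply: ctM cr _; exact: ct_comp.
by move=> w /=; rewrite mulrA -Gr Fq.
Qed.

Definition lin2 (a b : C) (v : C2 R) : C := v.1 * a + v.2 * b.

Lemma lin2_is_linear a b : linear (lin2 a b).
Proof.
move=> k u v; rewrite /lin2 /= scalerDr /GRing.scale/=; ring.
Qed.

HB.instance Definition _ a b :=
  GRing.isLinear.Build R[i] (C2 R) C _ (lin2 a b) (lin2_is_linear a b).

Lemma lin2_continuous a b : continuous (lin2 a b).
Proof.
move=> v; apply/ctatP; apply: ctD; apply: ctM; first exact: ct_fst.
- exact: ct_cst.
- exact: ct_snd.
- exact: ct_cst.
Qed.

(* Caratheodory's form of differentiability. *)
Lemma differentiable_car (f q1 q2 : C2 R -> C) (z : C2 R) :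
  ctat q1 z -> ctat q2 z ->
  (\forall w \near z, f w - f z = (w.1 - z.1) * q1 w + (w.2 - z.2) * q2 w) ->
  differentiable f z.
Proof.
move=> cq1 cq2 fq.
apply: (@differentiable_linear_approx _ _ _ f (lin2 (q1 z) (q2 z)) z).
  exact: lin2_continuous.
move=> e e0.
have e20 : 0 < e / 2 by rewrite divr_gt0.
have /ctatP/cvgrPdist_le/(_ _ e20) h1 := cq1.
have /ctatP/cvgrPdist_le/(_ _ e20) h2 := cq2.
have : \forall w \near z,
  `|f w - f z - lin2 (q1 z) (q2 z) (w - z)| <= e * `|w - z|.
  near=> w.
  have -> : f w - f z = (w.1 - z.1) * q1 w + (w.2 - z.2) * q2 w by near: w.
  rewrite /lin2 /=.
  set u := w.1 - z.1; set v := w.2 - z.2.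
  rewrite (_ : _ - _ = u * (q1 w - q1 z) + v * (q2 w - q2 z)); last by ring.
  rewrite (le_trans (ler_normD _ _))// [e in _ <= e * _]splitr [leRHS]mulrDl.
  have cm : `|u| >=< `|v| by apply: real_comparable; exact: normr_real.
  have [nu nv] : `|u| <= `|w - z| /\ `|v| <= `|w - z|.
    by rewrite prod_normE /= !comparable_le_max ?lexx ?orbT.
  rewrite !normrM; apply: lerD; rewrite mulrC; apply: ler_pM => //.
  - by rewrite distrC; near: w.
  - by rewrite distrC; near: w.
rewrite (near_shift 0 z) /=.
by apply: filterS => v; rewrite /= subr0 addrK.
Unshelve. all: by end_near. Qed.

Lemma derivable_cdiff (f : C2 R -> C) (z v : C2 R) (F : C -> C) p :
  (forall h, F h = f ((h - p) *: v + z)) -> derivable f z v -> cdiff F p.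
Proof.
move=> Ff /cvg_ex[/= l fl].
exists (fun w => if w == p then l else (F w - F p) / (w - p)); last first.
  move=> w; case: eqP => [->|/eqP wp]; first by rewrite !subrr mul0r.
  by rewrite mulrC divfK// subr_eq0.
apply/ctCP => e e0; rewrite eqxx.
have /cvgCP/(_ e e0) := fl; rewrite near_withinE.
move=> /nbhsCP[r r0 hr]; apply/nbhsCP; exists r => // w wp.
case: eqP => [_|/eqP wp0]; first by rewrite subrr normc0.
have := hr (w - p); rewrite subr0 => /(_ wp); rewrite subr_eq0 => /(_ wp0).
by rewrite !Ff subrr scale0r add0r /= /GRing.scale/= [_^-1 * _]mulrC.
Qed.

Lemma differentiable_slice1 (f : C2 R -> C) (z : C2 R) : differentiable f z ->
  cdiff (fun w => f (w, z.2)) z.1.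
Proof.
move=> df; apply: (derivable_cdiff (f := f) (z := z) (v := (1, 0))).
  move=> h; congr f; case: (z) => a b /=.
  by congr pair; rewrite /= /GRing.scale/= ?mulr1 ?subrK// mulr0 add0r.
exact: diff_derivable.
Qed.

Lemma differentiable_slice2 (f : C2 R -> C) (z : C2 R) : differentiable f z ->
  cdiff (fun w => f (z.1, w)) z.2.
Proof.
move=> df; apply: (derivable_cdiff (f := f) (z := z) (v := (0, 1))).
  move=> h; congr f; case: (z) => a b /=.
  by congr pair; rewrite /= /GRing.scale/= ?mulr1 ?subrK// mulr0 add0r.
exact: diff_derivable.
Qed.

Lemma differentiable_ctat (f : C2 R -> C) (z : C2 R) : differentiable f z -> ctat f z.
Proof. by move=> df; apply/ctatP; exact: differentiable_continuous. Qed.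

End CDiff.

(** * Integrals of continuous functions on segments *)

(** Continuity at all points near [p], unlike continuity at [p] alone, is an open condition; over a
    compact segment it therefore persists for nearby parameters. *)
Definition lcont (T U : topologicalType) (f : T -> U) (p : T) :=
  \forall q \near p, ctat f q.

Section LCont.
Variable R : realType.
Local Notation C := (R[i]^o).

Lemma lcontW (T U : topologicalType) (f : T -> U) p : lcont f p -> ctat f p.
Proof. exact: nbhs_singleton. Qed.

Lemma lcont_ct (T U : topologicalType) (f : T -> U) p :
  (forall q, ctat f q) -> lcont f p.
Proof. by move=> h; apply: filterE. Qed.

Lemma lcont_cst (T : topologicalType) (a : C) (p : T) : lcont (fun=> a) p.
Proof. by apply: lcont_ct => q; exact: ct_cst. Qed.

Lemma lcontD (T : topologicalType) (f g : T -> C) p :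
  lcont f p -> lcont g p -> lcont (fun x => f x + g x) p.
Proof. by apply: filterS2 => q; exact: ctD. Qed.

Lemma lcontB (T : topologicalType) (f g : T -> C) p :
  lcont f p -> lcont g p -> lcont (fun x => f x - g x) p.
Proof. by apply: filterS2 => q; exact: ctB. Qed.

Lemma lcontM (T : topologicalType) (f g : T -> C) p :
  lcont f p -> lcont g p -> lcont (fun x => f x * g x) p.
Proof. by apply: filterS2 => q; exact: ctM. Qed.

Lemma lcontV (T : topologicalType) (f : T -> C) p : f p != 0 ->
  lcont f p -> lcont (fun x => (f x)^-1) p.
Proof.
move=> f0 lf; have := ct_neq0 f0 (lcontW lf).
by apply: filterS2 lf => q cf fq; exact: ctV.
Qed.

Lemma lcont_comp (T U V : topologicalType) (g : T -> U) (f : U -> V) p :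
  lcont g p -> lcont f (g p) -> lcont (fun x => f (g x)) p.
Proof.
move=> lg lf; have /ctatP/(_ _ lf) := lcontW lg.
by apply: filterS2 lg => q cg cf; exact: ct_comp.
Qed.

(** The tube lemma, from the compactness of [[a, b]]. *)
Lemma tube (T : topologicalType) (a b : R) (z : T) (P : T * R -> Prop) :
  (forall s, a <= s <= b -> \forall p \near (z, s), P p) ->
  \forall w \near z, forall s, a <= s <= b -> P (w, s).
Proof.
move=> h.
have /compact_near_coveringP := @segment_compact R a b.
move=> /(_ T (nbhs z) (fun w s => P (w, s)) _) H.
have : \forall w \near z, `[a, b]%classic `<=` (fun s => P (w, s)).
  apply: H => s /=; rewrite in_itv /= => /h [[A B] /= [zA sB] AB].
  exists (B, A) => //= -[s' w'] [/= Bs Aw]; exact: (AB (w', s')).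
by apply: filterS => w hw s sab; apply: hw; rewrite /= in_itv.
Qed.

End LCont.

Section RInt.
Variable R : realType.
Implicit Types (a b c : R) (f g : R -> R).

Definition rint a b f := \int[@lebesgue_measure R]_(x in `[a, b]) f x.

Definition rcont a b f := forall x, a <= x <= b -> ctat f x.

Lemma rcont_integrable a b f : rcont a b f ->
  (@lebesgue_measure R).-integrable `[a, b] (EFin \o f).
Proof.
move=> cf; apply: continuous_compact_integrable.
  exact: segment_compact.
apply: continuous_in_subspaceT => x; rewrite inE /= in_itv /= => xab.
by apply/ctatP; exact: cf.
Qed.

Lemma rcontW a b c d f : a <= c -> d <= b -> rcont a b f -> rcont c d f.
Proof.
move=> ac db cf x /andP[cx xd]; apply: cf.
by rewrite (le_trans ac cx) (le_trans xd db).
Qed.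

Lemma rint_ext a b f g : (forall x, a <= x <= b -> f x = g x) ->
  rint a b f = rint a b g.
Proof.
by move=> fg; apply: eq_Rintegral => x; rewrite inE /= in_itv /=; exact: fg.
Qed.

Lemma rintD a b f g : rcont a b f -> rcont a b g ->
  rint a b (fun x => f x + g x) = rint a b f + rint a b g.
Proof. by move=> cf cg; apply: RintegralD => //; exact: rcont_integrable. Qed.

Lemma rintB a b f g : rcont a b f -> rcont a b g ->
  rint a b (fun x => f x - g x) = rint a b f - rint a b g.
Proof. by move=> cf cg; apply: RintegralB => //; exact: rcont_integrable. Qed.

Lemma rintZ a b f c : rcont a b f ->
  rint a b (fun x => c * f x) = c * rint a b f.
Proof. by move=> cf; apply: RintegralZl => //; exact: rcont_integrable. Qed.

Lemma rint_le a b f g : rcont a b f -> rcont a b g ->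
  (forall x, a <= x <= b -> f x <= g x) -> rint a b f <= rint a b g.
Proof.
move=> cf cg fg; apply: le_Rintegral => //; exact: rcont_integrable.
Qed.

Lemma rint_cst a b c : a <= b -> rint a b (fun=> c) = c * (b - a).
Proof.
rewrite le_eqVlt => /predU1P[<-|ab].
  by rewrite /rint set_itv1 Rintegral_set1 subrr mulr0.
rewrite /rint Rintegral_cst//.
have := @lebesgue_measure_itv R `[a, b]; rewrite /= lte_fin ab => h.
by congr (_ * _); rewrite -EFinB in h; rewrite h.
Qed.

Lemma rint_norm a b f : rcont a b f ->
  `|rint a b f| <= rint a b (fun x => `|f x|).
Proof. by move=> cf; apply: le_normr_Rintegral => //; exact: rcont_integrable. Qed.

Lemma rint_split a b c f : a <= b <= c -> rcont a c f ->
  rint a c f = rint a b f + rint b c f.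
Proof.
move=> /andP[ab bc] cf.
have := @Rintegral_itvB _ f (BLeft a) (BRight c) b (rcont_integrable cf).
rewrite !bnd_simp => /(_ ab bc) /eqP; rewrite subr_eq addrC => /eqP h.
rewrite [LHS]h.
congr (_ + _); apply: Rintegral_itv_obnd_cbnd.
have cf' : rcont b c f by apply: rcontW cf.
apply: integrableS (rcont_integrable cf') => //.
by apply: subset_itvr; rewrite bnd_simp.
Qed.

Lemma rcont_cst a b c : rcont a b (fun=> c).
Proof. by move=> x _; apply/ctatP; exact: cvg_cst. Qed.

Lemma rint_FTC a b f F : a < b -> rcont a b f ->
  (forall x, a <= x <= b -> is_derive x 1 F (f x)) ->
  rint a b f = F b - F a.
Proof.
move=> ab cf dF.
have dF' x : a <= x <= b -> {for x, continuous F}.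
  move=> /dF [dFx _]; exact/differentiable_continuous/derivable1_diffP.
rewrite /rint /Rintegral (@continuous_FTC2 _ f F a b)//.
- apply: continuous_in_subspaceT => x; rewrite inE /= in_itv /= => xab.
  by apply/ctatP; exact: cf.
- split.
  + move=> x; rewrite in_itv /= => /andP[ax xb].
    by have [] := dF x; rewrite ?(ltW ax) ?(ltW xb).
  + by apply: cvg_at_right_filter; apply: dF'; rewrite lexx ltW.
  + by apply: cvg_at_left_filter; apply: dF'; rewrite lexx ltW.
- move=> x; rewrite in_itv /= => /andP[ax xb].
  by rewrite derive1E; have [] := dF x; rewrite ?(ltW ax) ?(ltW xb).
Qed.

End RInt.

Section CInt.
Variable R : realType.
Local Notation C := (R[i]^o).
Implicit Types (a b c : R) (f g : R -> C).

Definition ccont a b f := forall x, a <= x <= b -> ctat f x.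

Definition cint a b f : C :=
  Complex (rint a b (fun x => complex.Re (f x)))
          (rint a b (fun x => complex.Im (f x))).

Lemma ccont_Re a b f : ccont a b f -> rcont a b (fun x => complex.Re (f x)).
Proof.
by move=> cf x /cf cfx; exact: (ct_comp cfx (ct_Re _)).
Qed.

Lemma ccont_Im a b f : ccont a b f -> rcont a b (fun x => complex.Im (f x)).
Proof.
by move=> cf x /cf cfx; exact: (ct_comp cfx (ct_Im _)).
Qed.

Lemma ccont_normc a b f : ccont a b f -> rcont a b (fun x => normc (f x)).
Proof.
by move=> cf x /cf cfx; exact: (ct_comp cfx (ct_normc _)).
Qed.

Lemma ccontB a b f g : ccont a b f -> ccont a b g ->
  ccont a b (fun x => f x - g x).
Proof. by move=> cf cg x xab; apply: ctB; [exact: cf|exact: cg]. Qed.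

Lemma ccontM a b f g : ccont a b f -> ccont a b g ->
  ccont a b (fun x => f x * g x).
Proof. by move=> cf cg x xab; apply: ctM; [exact: cf|exact: cg]. Qed.

Lemma ccont_cst a b (k : C) : ccont a b (fun=> k).
Proof. by move=> x _; exact: ct_cst. Qed.

Lemma cint_ext a b f g : (forall x, a <= x <= b -> f x = g x) ->
  cint a b f = cint a b g.
Proof.
by move=> fg; congr Complex; apply: rint_ext => x /fg ->.
Qed.

Lemma cintD a b f g : ccont a b f -> ccont a b g ->
  cint a b (fun x => f x + g x) = cint a b f + cint a b g.
Proof.
move=> cf cg; rewrite /cint.
rewrite (@rint_ext _ _ _ _ (fun x => complex.Re (f x) + complex.Re (g x))).
  rewrite (@rint_ext _ _ _ (fun x => complex.Im (f x + g x))
     (fun x => complex.Im (f x) + complex.Im (g x))).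
    by rewrite !rintD//; do ?[exact: ccont_Re | exact: ccont_Im].
  by move=> x _; case: (f x) (g x) => ? ? [].
by move=> x _; case: (f x) (g x) => ? ? [].
Qed.

Lemma cintB a b f g : ccont a b f -> ccont a b g ->
  cint a b (fun x => f x - g x) = cint a b f - cint a b g.
Proof.
move=> cf cg; rewrite /cint.
rewrite (@rint_ext _ _ _ _ (fun x => complex.Re (f x) - complex.Re (g x))).
  rewrite (@rint_ext _ _ _ (fun x => complex.Im (f x - g x))
     (fun x => complex.Im (f x) - complex.Im (g x))).
    by rewrite !rintB//; do ?[exact: ccont_Re | exact: ccont_Im].
  by move=> x _; case: (f x) (g x) => ? ? [].
by move=> x _; case: (f x) (g x) => ? ? [].
Qed.

Lemma cintZ a b f (k : C) : ccont a b f ->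
  cint a b (fun x => k * f x) = k * cint a b f.
Proof.
case: k => u v cf; rewrite /cint.
have cR := ccont_Re cf; have cI := ccont_Im cf.
have cM w h : rcont a b h -> rcont a b (fun x => w * h x).
  by move=> ch x /ch /ctatP chx; apply/ctatP; apply: cvgM => //; exact: cvg_cst.
rewrite (@rint_ext _ _ _ _
  (fun x => u * complex.Re (f x) - v * complex.Im (f x))).
  rewrite (@rint_ext _ _ _ (fun x => complex.Im (_ * f x))
     (fun x => u * complex.Im (f x) + v * complex.Re (f x))).
    by rewrite rintB ?rintD ?rintZ//; exact: cM.
  by move=> x _; case: (f x).
by move=> x _; case: (f x).
Qed.

Lemma cint_split a b c f : a <= b <= c -> ccont a c f ->
  cint a c f = cint a b f + cint b c f.
Proof.
move=> abc cf; rewrite /cint (rint_split abc (ccont_Re cf)).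
by rewrite (rint_split abc (ccont_Im cf)).
Qed.

Lemma cint_cst a b (k : C) : a <= b -> cint a b (fun=> k) = k * (b - a)%:C%C.
Proof.
move=> ab; rewrite /cint !rint_cst//; case: k => u v /=.
by apply/eqP; rewrite eq_complex /=; apply/andP; split; apply/eqP; ring.
Qed.

(** The factor 2 is the price of bounding real and imaginary parts separately; constants in the
    later estimates carry it along. *)
Lemma cint_norm a b f : ccont a b f ->
  normc (cint a b f) <= 2 * rint a b (fun x => normc (f x)).
Proof.
move=> cf; apply: le_trans (normc_ReIm _) _ => /=.
have cR := ccont_Re cf; have cI := ccont_Im cf; have cN := ccont_normc cf.
have cA h : rcont a b h -> rcont a b (fun x => `|h x|).
  by move=> ch x /ch /ctatP chx; apply/ctatP; apply: cvg_norm.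
rewrite mulrDl !mul1r; apply: lerD.
  apply: le_trans (rint_norm cR) _; apply: rint_le => //; first exact: cA.
  by move=> x _; exact: normc_Re.
apply: le_trans (rint_norm cI) _; apply: rint_le => //; first exact: cA.
by move=> x _; exact: normc_Im.
Qed.

Lemma cint_bound a b f (M : R) : a <= b -> ccont a b f ->
  (forall x, a <= x <= b -> normc (f x) <= M) ->
  normc (cint a b f) <= 2 * M * (b - a).
Proof.
move=> ab cf fM; apply: le_trans (cint_norm cf) _.
rewrite -mulrA ler_pM2l// -rint_cst//; apply: rint_le => //.
  exact: ccont_normc.
exact: rcont_cst.
Qed.

(** The tube lemma makes the continuity of [psi] in its first argument uniform along the segment of
    integration. *)
Lemma lcont_cint (T : topologicalType) a b (psi : T * R -> C) (z : T) :
  a <= b -> (forall s, a <= s <= b -> lcont psi (z, s)) ->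
  lcont (fun w => cint a b (fun s => psi (w, s))) z.
Proof.
move=> ab h.
have : \forall w \near z, forall s, a <= s <= b -> lcont psi (w, s).
  by apply: (tube (P := lcont psi)) => s /h; exact: nbhs_interior.
apply: filterS => w hw.
have cs s : a <= s <= b -> ctat psi (w, s) by move=> /hw; exact: lcontW.
have cslice w' s : ctat psi (w', s) -> ctat (fun s => psi (w', s)) s.
  move=> c; apply: ct_comp c; apply: ct_pair; last exact: ct_id.
  by apply/ctatP; exact: cvg_cst.
apply/ctCP => e e0.
(* The bound [2 * e' * (b - a)] from [cint_bound] is then strictly below [e]; the summand 1 covers
   [a = b]. *)
pose e' := e / (4 * (b - a + 1)).
have ba1 : 0 < b - a + 1 by lra.
have e'0 : 0 < e' by rewrite divr_gt0// mulr_gt0.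
have : \forall w' \near w, forall s, a <= s <= b ->
   ctat psi (w', s) /\ normc (psi (w', s) - psi (w, s)) < e'.
  apply: (tube (P := fun p => ctat psi p /\ normc (psi p - psi (w, p.2)) < e')).
  move=> s sab.
  have e'2 : 0 < e' / 2 by rewrite divr_gt0.
  have h1 := (ctCP _ _).1 (cs s sab) _ e'2.
  have h2 : \forall p \near (w, s), normc (psi (w, p.2) - psi (w, s)) < e' / 2.
    have cc : ctat (fun p : T * R => psi (w, p.2)) (w, s).
      apply: (ct_comp (g := snd) (f := fun s => psi (w, s))).
        exact: ct_snd.
      by apply: cslice; exact: cs.
    exact: ((ctCP _ _).1 cc _ e'2).
  near=> p; split; first by near: p; exact: hw.
  rewrite (_ : _ - _ = (psi p - psi (w, s)) - (psi (w, p.2) - psi (w, s))); last by ring.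
  apply: le_lt_trans (le_normcD _ _) _; rewrite normcN (splitr e').
  by apply: ltrD; near: p.
apply: filterS => w' hw'.
rewrite -cintB; first last.
- by move=> s /cs; exact: cslice.
- by move=> s /hw' [+ _]; exact: cslice.
have : normc (cint a b (fun s => psi (w', s) - psi (w, s))) <= 2 * e' * (b - a).
  apply: cint_bound => //; last by move=> s /hw' [_ /ltW].
  apply: ccontB; first by move=> s /hw' [+ _]; exact: cslice.
  by move=> s /cs; exact: cslice.
move=> /le_lt_trans; apply.
have -> : e = 4 * e' * (b - a + 1) by rewrite /e'; field; rewrite gt_eqF.
nra.
Unshelve. all: by end_near. Qed.

End CInt.

(** * Contour integrals on rectangles *)

Section Rect.
Variable R : realType.
Local Notation C := (R[i]^o).
Implicit Types (a b c d : R) (f g : C -> C) (z p w : C).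
Local Notation ii := (Complex 0 1 : C).

Definition inrect a b c d z :=
  (a <= complex.Re z <= b) && (c <= complex.Im z <= d).

(** Counterclockwise: bottom minus top, then [ii] times right minus left, since [dw = ii dy] on
    vertical edges. *)
Definition contour a b c d f : C :=
  cint a b (fun x => f (Complex x c)) - cint a b (fun x => f (Complex x d)) +
  ii * (cint c d (fun y => f (Complex b y)) - cint c d (fun y => f (Complex a y))).

Definition onrect a b c d z := inrect a b c d z &&
  [|| complex.Re z == a, complex.Re z == b, complex.Im z == c | complex.Im z == d].

Definition rectcont a b c d f := forall z, onrect a b c d z -> ctat f z.

Lemma ct_hline (y x : R) : ctat (fun x : R => Complex x y : C) x.
Proof.
apply: ct_Complex; first exact: ct_id.
by apply/ctatP; exact: cvg_cst.
Qed.

Lemma ct_vline (x y : R) : ctat (fun y : R => Complex x y : C) y.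
Proof.
apply: ct_Complex; last exact: ct_id.
by apply/ctatP; exact: cvg_cst.
Qed.

Lemma onrect_h a b c d x y : a <= x <= b -> c <= d -> (y == c) || (y == d) ->
  onrect a b c d (Complex x y).
Proof.
move=> axb cd ycd; rewrite /onrect /inrect /= axb /=; case/orP: ycd => /eqP ->.
  by rewrite lexx cd eqxx !orbT.
by rewrite lexx cd eqxx !orbT.
Qed.

Lemma onrect_v a b c d x y : c <= y <= d -> a <= b -> (x == a) || (x == b) ->
  onrect a b c d (Complex x y).
Proof.
move=> cyd ab xab; rewrite /onrect /inrect /= cyd andbT; case/orP: xab => /eqP ->.
  by rewrite lexx ab eqxx.
by rewrite lexx ab eqxx !orbT.
Qed.

Lemma ccont_h a b c d f y : rectcont a b c d f -> c <= d -> (y == c) || (y == d) ->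
  ccont a b (fun x => f (Complex x y)).
Proof.
move=> cf cd ycd x axb; apply: (ct_comp (ct_hline y x)).
by apply: cf; exact: onrect_h.
Qed.

Lemma ccont_v a b c d f x : rectcont a b c d f -> a <= b -> (x == a) || (x == b) ->
  ccont c d (fun y => f (Complex x y)).
Proof.
move=> cf ab xab y cyd; apply: (ct_comp (ct_vline x y)).
by apply: cf; exact: onrect_v.
Qed.

Lemma rectcontW a b c d f : (forall z, inrect a b c d z -> ctat f z) ->
  rectcont a b c d f.
Proof. by move=> h z /andP[/h]. Qed.

Lemma contour_ext a b c d f g : a <= b -> c <= d ->
  (forall z, onrect a b c d z -> f z = g z) ->
  contour a b c d f = contour a b c d g.
Proof.
move=> ab cd fg; rewrite /contour; congr (_ - _ + _ * (_ - _));
  apply: cint_ext => t tab; apply: fg;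
  by [apply: onrect_h => //; rewrite eqxx ?orbT
     |apply: onrect_v => //; rewrite eqxx ?orbT].
Qed.

Lemma contour_splitx a b c d f m : a <= m <= b -> c <= d ->
  rectcont a b c d f ->
  contour a b c d f = contour a m c d f + contour m b c d f.
Proof.
move=> amb cd cf; rewrite /contour.
rewrite (cint_split amb (ccont_h (y := c) cf cd _)) ?eqxx//.
rewrite (cint_split amb (ccont_h (y := d) cf cd _)) ?eqxx ?orbT//.
by ring.
Qed.

Lemma contour_splity a b c d f m : a <= b -> c <= m <= d ->
  rectcont a b c d f ->
  contour a b c d f = contour a b c m f + contour a b m d f.
Proof.
move=> ab cmd cf; rewrite /contour.
rewrite (cint_split cmd (ccont_v (x := a) cf ab _)) ?eqxx//.
rewrite (cint_split cmd (ccont_v (x := b) cf ab _)) ?eqxx ?orbT//.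
by ring.
Qed.

Lemma normc_ii : normc ii = 1.
Proof. by rewrite /= expr0n add0r expr1n sqrtr1. Qed.

Lemma contour_bound a b c d f (M : R) : a <= b -> c <= d ->
  rectcont a b c d f ->
  (forall z, onrect a b c d z -> normc (f z) <= M) ->
  normc (contour a b c d f) <= 4 * M * ((b - a) + (d - c)).
Proof.
move=> ab cd cf fM.
have h y : (y == c) || (y == d) ->
    normc (cint a b (fun x => f (Complex x y))) <= 2 * M * (b - a).
  move=> ycd; apply: cint_bound => //; first exact: (ccont_h cf).
  by move=> x axb; apply: fM; exact: onrect_h.
have v x : (x == a) || (x == b) ->
    normc (cint c d (fun y => f (Complex x y))) <= 2 * M * (d - c).
  move=> xab; apply: cint_bound => //; first exact: (ccont_v cf).
  by move=> y cyd; apply: fM; exact: onrect_v.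
have hc := h c; have hd := h d; have va := v a; have vb := v b.
rewrite eqxx in hc; rewrite eqxx orbT in hd.
rewrite eqxx in va; rewrite eqxx orbT in vb.
have {}hc := hc erefl; have {}hd := hd erefl.
have {}va := va erefl; have {}vb := vb erefl.
apply: le_trans (le_normcD _ _) _; rewrite normcM normc_ii mul1r.
have := le_normcD (cint a b (fun x => f (Complex x c)))
  (- cint a b (fun x => f (Complex x d))).
have := le_normcD (cint c d (fun x => f (Complex b x)))
  (- cint c d (fun x => f (Complex a x))).
rewrite !normcN; lra.
Qed.

Lemma contourB a b c d f g : a <= b -> c <= d ->
  rectcont a b c d f -> rectcont a b c d g ->
  contour a b c d (fun z => f z - g z) = contour a b c d f - contour a b c d g.
Proof.
move=> ab cd cf cg; rewrite /contour.
rewrite !cintB; do ?[by apply: (ccont_h cf); rewrite ?eqxx ?orbT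
  | by apply: (ccont_h cg); rewrite ?eqxx ?orbT
  | by apply: (ccont_v cf); rewrite ?eqxx ?orbT
  | by apply: (ccont_v cg); rewrite ?eqxx ?orbT].
by ring.
Qed.

Lemma contourZ a b c d f (k : C) : a <= b -> c <= d ->
  rectcont a b c d f ->
  contour a b c d (fun z => k * f z) = k * contour a b c d f.
Proof.
move=> ab cd cf; rewrite /contour.
rewrite !cintZ; do ?[by apply: (ccont_h cf); rewrite ?eqxx ?orbT
  | by apply: (ccont_v cf); rewrite ?eqxx ?orbT].
by ring.
Qed.

(** On opposite edges the values of an affine function differ by a constant; the two pairs of edges
    contribute opposite amounts. *)
Lemma contour_affine a b c d (k l : C) : a <= b -> c <= d ->
  contour a b c d (fun z => k + l * z) = 0.
Proof.
move=> ab cd.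
have ca (g : R -> C) u v : (forall x, ctat g x) ->
    ccont u v (fun x => k + l * g x).
  move=> cg x _; apply: ctD; first exact: ct_cst.
  by apply: ctM; [exact: ct_cst|exact: cg].
rewrite /contour -!cintB; try by apply: ca => x; do ?[exact: ct_hline|exact: ct_vline].
rewrite (@cint_ext _ _ _ _ (fun=> l * (ii * (c - d)%:C%C))); last first.
  move=> x _; rewrite opprD addrACA subrr add0r -mulrBr; congr (_ * _).
  by apply/eqP; rewrite eq_complex /=; apply/andP; split; apply/eqP; ring.
rewrite (@cint_ext _ _ _ (fun y => k + l * _ - _) (fun=> l * (b - a)%:C%C)); last first.
  move=> x _; rewrite opprD addrACA subrr add0r -mulrBr; congr (_ * _).
  by apply/eqP; rewrite eq_complex /=; apply/andP; split; apply/eqP; ring.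
rewrite !cint_cst// (_ : (d - c)%:C%C = - (c - d)%:C%C :> C); last first.
  by rewrite -rmorphN opprB.
by ring.
Qed.

(** The point is the supremum of the left ends, as each left end lies below each right end. *)
Lemma nested_segments (x l : nat -> R) :
  (forall n, x n <= x n.+1) -> (forall n, x n.+1 + l n.+1 <= x n + l n) ->
  (forall n, 0 <= l n) -> exists s, forall n, x n <= s <= x n + l n.
Proof.
move=> xi yd l0.
have xm n m : x n <= x (n + m)%N.
  by elim: m => [|m ih]; rewrite ?addn0// addnS (le_trans ih).
have ym n m : x (n + m)%N + l (n + m)%N <= x n + l n.
  by elim: m => [|m ih]; rewrite ?addn0// addnS (le_trans _ ih).
have xy n m : x n <= x m + l m.
  case: (leqP n m) => nm.
    by rewrite -(subnKC nm) (le_trans (xm n (m - n)%N))// lerDl.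
  by rewrite -(subnKC (ltnW nm)) (le_trans _ (ym m (n - m)%N))// lerDl.
have ub m : ubound (range x) (x m + l m) by move=> _ [n _ <-].
have hs : has_sup (range x).
  by split; [exists (x 0%N), 0%N|exists (x 0%N + l 0%N)].
exists (sup (range x)) => n; apply/andP; split.
  by apply: ub_le_sup; [case: hs|exists n].
by apply: ge_sup => //; case: hs.
Qed.

Lemma pigeon4 (t A x1 x2 x3 x4 : R) : 4 * t <= A -> A <= x1 + x2 + (x3 + x4) ->
  [\/ t <= x1, t <= x2, t <= x3 | t <= x4].
Proof.
move=> h1 h2; have [k1|k1] := leP t x1; first by constructor 1.
have [k2|k2] := leP t x2; first by constructor 2.
have [k3|k3] := leP t x3; first by constructor 3.
have [k4|k4] := leP t x4; first by constructor 4.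
lra.
Qed.

Lemma half_segment (a b x l m : R) : l = m + m -> 0 <= m -> a <= x -> x + l <= b ->
  [/\ a <= x, x + m <= b, x <= x, x + m <= x + l &
  [/\ a <= x + m, x + m + m <= b, x <= x + m & x + m + m <= x + l]].
Proof. by move=> -> m0 ax xb; (repeat match goal with |- and5 _ _ _ _ _ => split | |- and4 _ _ _ _ => split end); lra. Qed.

(** Repeated quartering: some quarter keeps at least a fourth of the modulus of the integral. At the
    common point [p] of the nested rectangles, [f] is affine up to [e * normc (z - p)] and the
    affine part integrates to 0, so the [n]-th integral is too small. *)
Lemma Goursat a b c d f : a <= b -> c <= d ->
  (forall z, inrect a b c d z -> cdiff f z) -> contour a b c d f = 0.
Proof.
move=> ab cd df; apply/eqP; rewrite -normc_eq0; apply/negPn/negP => N0.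
set eta := normc (contour a b c d f) in N0.
have eta0 : 0 < eta by rewrite lt_def N0 normc_ge0.
have cf z : inrect a b c d z -> ctat f z by move=> /df; exact: cdiff_continuous.
pose lw n := (b - a) / 2 ^+ n; pose lh n := (d - c) / 2 ^+ n.
have lwS n : lw n = lw n.+1 + lw n.+1.
  by rewrite /lw exprS; field; rewrite expf_neq0.
have lhS n : lh n = lh n.+1 + lh n.+1.
  by rewrite /lh exprS; field; rewrite expf_neq0.
have lw0 n : 0 <= lw n by rewrite divr_ge0 ?subr_ge0// exprn_ge0.
have lh0 n : 0 <= lh n by rewrite divr_ge0 ?subr_ge0// exprn_ge0.
pose ok n (u : R * R) := [/\ a <= u.1, u.1 + lw n <= b, c <= u.2, u.2 + lh n <= d &
  eta / 4 ^+ n <= normc (contour u.1 (u.1 + lw n) u.2 (u.2 + lh n) f)].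
pose sub n (u v : R * R) := [/\ u.1 <= v.1, v.1 + lw n.+1 <= u.1 + lw n,
  u.2 <= v.2 & v.2 + lh n.+1 <= u.2 + lh n].
(* The implication sits under the existential so that [choice] yields a total successor function on
   indexed corners. *)
have step n u : exists v, ok n u -> ok n.+1 v /\ sub n u v.
  case: (pselect (ok n u)) => [oku|]; last by exists u.
  case: u oku => x y [/= ax xb cy yd H].
  have lwn := lwS n; have lhn := lhS n.
  have lwn0 := lw0 n.+1; have lhn0 := lh0 n.+1.
  set w := lw n.+1 in lwn lwn0 *; set h := lh n.+1 in lhn lhn0 *.
  have [X1 X2 X3 X4 [X5 X6 X7 X8]] := half_segment lwn lwn0 ax xb.
  have [Y1 Y2 Y3 Y4 [Y5 Y6 Y7 Y8]] := half_segment lhn lhn0 cy yd.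
  have cR x1 x2 y1 y2 : a <= x1 -> x2 <= b -> c <= y1 -> y2 <= d ->
      rectcont x1 x2 y1 y2 f.
    move=> h1 h2 h3 h4; apply: rectcontW => z /andP[/andP[k1 k2] /andP[k3 k4]].
    apply: cf.
    by rewrite /inrect (le_trans h1 k1) (le_trans k2 h2) (le_trans h3 k3) (le_trans k4 h4).
  have E : contour x (x + lw n) y (y + lh n) f =
     contour x (x + w) y (y + h) f + contour x (x + w) (y + h) (y + h + h) f +
     (contour (x + w) (x + w + w) y (y + h) f +
      contour (x + w) (x + w + w) (y + h) (y + h + h) f).
    have xw : x <= x + w <= x + w + w by rewrite X7 lerDl.
    have yh : y <= y + h <= y + h + h by rewrite Y7 lerDl.
    have [xw1 xw2] := andP xw; have [yh1 yh2] := andP yh.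
    rewrite lwn lhn !addrA (contour_splitx xw); first last.
    - exact: cR.
    - exact: le_trans yh1 yh2.
    by rewrite (contour_splity xw1 yh) ?(contour_splity xw2 yh) ?addrA//; exact: cR.
  have H4 : 4 * (eta / 4 ^+ n.+1) <= normc (contour x (x + lw n) y (y + lh n) f).
    by apply: le_trans H; rewrite exprS invfM mulrCA mulVKf.
  move: H4 => /pigeon4; rewrite E => /(_ _ _ _ _ (le_trans (le_normcD _ _)
    (lerD (le_normcD _ _) (le_normcD _ _)))) [] k.
  - by exists (x, y).
  - by exists (x, y + h).
  - by exists (x + w, y).
  - by exists (x + w, y + h).
have [s sP] := choice (fun nu : nat * (R * R) => step nu.1 nu.2).
pose u := fix u n := if n is n'.+1 then s (n', u n') else (a, c).
have uok n : ok n (u n).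
  elim: n => [|n ih]; last by have [] := sP (n, u n) ih.
  have aw : a + lw 0 = b by rewrite /lw expr0 divr1 addrC subrK.
  have ch : c + lh 0 = d by rewrite /lh expr0 divr1 addrC subrK.
  by rewrite /ok aw ch expr0 divr1; split; exact: lexx.
have usub n : sub n (u n) (u n.+1) by have [] := sP (n, u n) (uok n).
have [xs hx] := @nested_segments (fun n => (u n).1) lw
  (fun n => let: And4 h _ _ _ := usub n in h)
  (fun n => let: And4 _ h _ _ := usub n in h) lw0.
have [ys hy] := @nested_segments (fun n => (u n).2) lh
  (fun n => let: And4 _ _ h _ := usub n in h)
  (fun n => let: And4 _ _ _ h := usub n in h) lh0.
pose p : C := Complex xs ys.
have pR : inrect a b c d p.
  have /= := hx 0%N; have /= := hy 0%N.
  by rewrite /inrect /= /lw /lh !expr0 !divr1 ![_ + (_ - _)]addrC !subrK => -> ->.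
have [q cq fq] := df p pR.
pose L := (b - a) + (d - c).
have L0 : 0 <= L by rewrite /L; lra.
(* The [n]-th integral is at most [4 * e * (L / 2 ^+ n) ^+ 2], which this choice makes smaller than
   [eta / 4 ^+ n], even if [L = 0]. *)
pose e := eta / (8 * (L + 1) ^+ 2).
have e0 : 0 < e by rewrite divr_gt0// mulr_gt0// exprn_gt0// ltr_wpDl.
have /ctCP/(_ e e0)/nbhsCP[r r0 hr] := cq.
have [n hn] : exists n, L / 2 ^+ n < r.
  have [n _ /(_ n (leqnn n))] : \forall n \near \oo, L / 2 ^+ n < r.
    have : (fun n : nat => L * (2^-1) ^+ n) @ \oo --> L * 0.
      apply: cvgM; first exact: cvg_cst.
      by apply: cvg_expr; rewrite ger0_norm ?invr_ge0// invf_lt1// ltr1n.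
    rewrite mulr0 => /cvgrPdist_lt/(_ r r0); apply: filterS => n.
    rewrite sub0r normrN ger0_norm ?exprVn//.
    by rewrite mulr_ge0// invr_ge0 exprn_ge0.
  by exists n.
have [H1 H2 H3 H4 H5] := uok n.
set x := (u n).1 in H1 H2 H5; set y := (u n).2 in H3 H4 H5.
have lwn0 := lw0 n; have lhn0 := lh0 n.
have LE : lw n + lh n = L / 2 ^+ n by rewrite /lw /lh -mulrDl.
have diam z : inrect x (x + lw n) y (y + lh n) z -> normc (z - p) <= L / 2 ^+ n.
  move=> /andP[/andP[z1 z2] /andP[z3 z4]].
  have /andP[] := hx n; have /andP[] := hy n; rewrite -/x -/y => p3 p4 p1 p2.
  apply: le_trans (normc_ReIm _) _; rewrite -LE; apply: lerD.
    by rewrite (_ : complex.Re _ = complex.Re z - xs); [rewrite ler_norml; lra|case: (z)].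
  by rewrite (_ : complex.Im _ = complex.Im z - ys); [rewrite ler_norml; lra|case: (z)].
have xw : x <= x + lw n by rewrite lerDl.
have yh : y <= y + lh n by rewrite lerDl.
have Rsub z : inrect x (x + lw n) y (y + lh n) z -> inrect a b c d z.
  move=> /andP[/andP[z1 z2] /andP[z3 z4]]; rewrite /inrect.
  by rewrite (le_trans H1) ?(le_trans z2) ?(le_trans H3) ?(le_trans z4).
have caff : rectcont x (x + lw n) y (y + lh n) (fun z => (f p - q p * p) + q p * z).
  by move=> z _; apply: ctD; [exact: ct_cst|apply: ctM; [exact: ct_cst|exact: ct_id]].
have cfn : rectcont x (x + lw n) y (y + lh n) f.
  by apply: rectcontW => z /Rsub /cf.
have := contourB xw yh cfn caff; rewrite contour_affine// subr0 => E.
have : normc (contour x (x + lw n) y (y + lh n) f) <=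
    4 * (e * (L / 2 ^+ n)) * (L / 2 ^+ n).
  rewrite -E; apply: le_trans (contour_bound (M := e * (L / 2 ^+ n)) xw yh _ _) _.
  - by move=> z zR; apply: ctB; [exact: cfn|exact: caff].
  - move=> z /andP[/diam zp _]; have zr := le_lt_trans zp hn.
    rewrite (_ : _ - _ = (q z - q p) * (z - p)); last first.
      by move/eqP: (fq z); rewrite subr_eq => /eqP ->; ring.
    by rewrite normcM; apply: ler_pM => //; rewrite ?normc_ge0//; exact/ltW/hr.
  - by rewrite -LE !(addrC _ (- _)) !addKr.
move=> /(le_trans H5); apply/negP; rewrite -ltNge.
have T0 : 0 < (4 : R) ^+ n by rewrite exprn_gt0.
rewrite ltr_pdivlMr// (_ : _ * _ * _ * _ = eta * (L ^+ 2 / (2 * (L + 1) ^+ 2))); last first.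
  rewrite /e (_ : (4 : R) ^+ n = 2 ^+ n * 2 ^+ n); last by rewrite -exprMn -natrM.
  by field; rewrite expf_neq0// gt_eqF// ltr_wpDl.
rewrite gtr_pMr// ltr_pdivrMr; last by rewrite mulr_gt0// exprn_gt0// ltr_wpDl.
nra.
Qed.

End Rect.

(** * Residues and the Cauchy formula on rectangles *)

Section Residue.
Variable R : realType.
Local Notation C := (R[i]^o).
Implicit Types (a b c d : R) (f g k : C -> C) (z p w : C).
Local Notation ii := (Complex 0 1 : C).
Local Notation twopii := (Complex 0 (2 * pi) : C).

(** An antiderivative is [2 * atan ((x - u) / s)], with values [pi / 2] and [- pi / 2] at the ends.
    It is what a pair of opposite edges of a square contributes in [contour_inv]. *)
Lemma rint_poisson (u s : R) : 0 < s ->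
  rint (u - s) (u + s) (fun x => 2 * s / ((x - u) ^+ 2 + s ^+ 2)) = pi.
Proof.
move=> s0.
have pos (x : R) : 0 < (x - u) ^+ 2 + s ^+ 2.
  by rewrite ltr_wpDl ?sqr_ge0// exprn_gt0.
have us : u - s < u + s by lra.
pose F x := 2 * atan ((x - u) * s^-1).
transitivity (F (u + s) - F (u - s)); last first.
  rewrite /F [u + s - u]addrC addKr [u - s - u]addrAC subrr add0r mulNr divff ?gt_eqF//.
  by rewrite atanN atan1; field.
apply: rint_FTC => //.
- move=> x _; apply/ctatP; apply: cvgM; first exact: cvg_cst.
  apply: cvgV; first by rewrite gt_eqF.
  apply: cvgD; last exact: cvg_cst.
  by apply: cvgM; apply: cvgB; [exact: cvg_id|exact: cvg_cst|exact: cvg_id|exact: cvg_cst].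
- move=> x _.
  have h1 : is_derive x 1 (fun x => (x - u) * s^-1) (s^-1).
    rewrite (_ : (fun x => _) = s^-1 \*: ((id : R -> R) - cst u)); last first.
      by apply/funext => y; rewrite /GRing.scale/= mulrC.
    apply: is_derive_eq.
    by rewrite subr0 /GRing.scale /= mulr1.
  have h2 : is_derive x 1 (fun x => atan ((x - u) * s^-1))
     (s^-1 * (1 + ((x - u) * s^-1) ^+ 2)^-1).
    apply: is_derive_eq.
    by rewrite mulrC.
  rewrite (_ : F = 2 \*: (fun x => atan ((x - u) * s^-1))); last first.
    by apply/funext => y.
  apply: is_derive_eq.
  rewrite /GRing.scale /=; field; rewrite ?gt_eqF//=.
Qed.

Lemma onrect_dist p (s : R) w : 0 < s ->
  onrect (complex.Re p - s) (complex.Re p + s) (complex.Im p - s) (complex.Im p + s) w ->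
  s <= normc (w - p).
Proof.
case: p w => p1 p2 [w1 w2] s0 /andP[_ /=].
have hR := normc_Re (Complex w1 w2 - Complex p1 p2 : C).
have hI := normc_Im (Complex w1 w2 - Complex p1 p2 : C).
rewrite /= in hR hI.
have ns : `|s| = s by rewrite ger0_norm// ltW.
case/or4P => /eqP e.
- apply: le_trans hR; rewrite e (_ : p1 - s - p1 = - s); last by ring.
  by rewrite normrN ns.
- by apply: le_trans hR; rewrite e (_ : p1 + s - p1 = s) ?ns//; ring.
- apply: le_trans hI; rewrite e (_ : p2 - s - p2 = - s); last by ring.
  by rewrite normrN ns.
- by apply: le_trans hI; rewrite e (_ : p2 + s - p2 = s) ?ns//; ring.
Qed.

Lemma ct_subV p w : w != p -> ctat (fun z => (z - p)^-1) w.
Proof.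
move=> wp; apply: ctV; first by rewrite subr_eq0.
by apply: ctB; [exact: ct_id|exact: ct_cst].
Qed.

Lemma cdiff_subV p w : w != p -> cdiff (fun z => (z - p)^-1) w.
Proof.
move=> wp; apply: cdiffV; first by rewrite subr_eq0.
by apply: cdiffB; [exact: cdiff_id|exact: cdiff_cst].
Qed.

(** On a square centred at [p] the integrands of opposite edges combine: one part cancels and the
    other is the kernel of [rint_poisson], so that each pair contributes [pi] in modulus. *)
Lemma contour_inv p (s : R) : 0 < s ->
  contour (complex.Re p - s) (complex.Re p + s) (complex.Im p - s) (complex.Im p + s)
    (fun w => (w - p)^-1) = twopii.
Proof.
case: p => p1 p2 s0 /=.
have cR : rectcont (p1 - s) (p1 + s) (p2 - s) (p2 + s) (fun w => (w - (Complex p1 p2))^-1).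
  move=> w /(onrect_dist (p := Complex p1 p2) s0) h; apply: ct_subV.
  by rewrite -subr_eq0 -normc_gt0; exact: lt_le_trans h.
have h1 : p1 - s <= p1 + s by lra.
have h2 : p2 - s <= p2 + s by lra.
have z0 : rint (p1 - s) (p1 + s) (fun=> 0) = 0 by rewrite rint_cst// mul0r.
have z0' : rint (p2 - s) (p2 + s) (fun=> 0) = 0 by rewrite rint_cst// mul0r.
rewrite /contour -!cintB; first last.
- by apply: (ccont_h cR); rewrite ?eqxx ?orbT.
- by apply: (ccont_h cR); rewrite ?eqxx ?orbT.
- by apply: (ccont_v cR); rewrite ?eqxx ?orbT.
- by apply: (ccont_v cR); rewrite ?eqxx ?orbT.
have -> : cint (p1 - s) (p1 + s) (fun x => (Complex x (p2 - s) - Complex p1 p2)^-1 -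
    (Complex x (p2 + s) - Complex p1 p2)^-1) = Complex 0 pi.
  rewrite (@cint_ext _ _ _ _
    (fun x => Complex 0 (2 * s / ((x - p1) ^+ 2 + s ^+ 2)))).
    by rewrite /cint /= z0 rint_poisson.
  move=> x _; apply/eqP; rewrite eq_complex /=.
  have p0 : (x - p1) ^+ 2 + s ^+ 2 != 0.
    by rewrite gt_eqF// ltr_wpDl ?sqr_ge0// exprn_gt0.
  rewrite (_ : p2 - s - p2 = - s); last by ring.
  rewrite (_ : p2 + s - p2 = s); last by ring.
  by rewrite sqrrN; apply/andP; split; apply/eqP; field.
have -> : cint (p2 - s) (p2 + s) (fun y => (Complex (p1 + s) y - Complex p1 p2)^-1 -
    (Complex (p1 - s) y - Complex p1 p2)^-1) = Complex pi 0.
  rewrite (@cint_ext _ _ _ _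
    (fun x => Complex (2 * s / ((x - p2) ^+ 2 + s ^+ 2)) 0)).
    by rewrite /cint /= z0' rint_poisson.
  move=> x _; apply/eqP; rewrite eq_complex /=.
  have p0 : (x - p2) ^+ 2 + s ^+ 2 != 0.
    by rewrite gt_eqF// ltr_wpDl ?sqr_ge0// exprn_gt0.
  rewrite (_ : p1 - s - p1 = - s); last by ring.
  rewrite (_ : p1 + s - p1 = s); last by ring.
  rewrite sqrrN [s ^+ 2 + _]addrC; apply/andP; split; apply/eqP; field => //.
by apply/eqP; rewrite eq_complex /=; apply/andP; split; apply/eqP; ring.
Qed.

(** The vertical lines through the inner edges, then the horizontal ones in the middle strip, cut
    off four outer rectangles on which [Goursat] applies. *)
Lemma contour_shrink a b c d a' b' c' d' k :
  a <= a' -> a' <= b' -> b' <= b -> c <= c' -> c' <= d' -> d' <= d ->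
  (forall z, inrect a b c d z ->
     ~~ ((a' < complex.Re z < b') && (c' < complex.Im z < d')) -> cdiff k z) ->
  contour a b c d k = contour a' b' c' d' k.
Proof.
move=> aa ab bb cc cd dd dk.
have key x1 x2 y1 y2 : a <= x1 -> x2 <= b -> c <= y1 -> y2 <= d ->
    [|| x2 <= a', b' <= x1, y2 <= c' | d' <= y1] ->
    forall z, inrect x1 x2 y1 y2 z -> cdiff k z.
  move=> h1 h2 h3 h4 h5 z /andP[/andP[z1 z2] /andP[z3 z4]]; apply: dk.
    by rewrite /inrect (le_trans h1 z1) (le_trans z2 h2) (le_trans h3 z3) (le_trans z4 h4).
  apply/negP => /andP[/andP[k1 k2] /andP[k3 k4]].
  case/or4P: h5 => h; lra.
have rc x1 x2 y1 y2 : a <= x1 -> x2 <= b -> c <= y1 -> y2 <= d ->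
    (x1 <= a') || (b' <= x1) -> (x2 <= a') || (b' <= x2) ->
    (y1 <= c') || (d' <= y1) -> (y2 <= c') || (d' <= y2) ->
    rectcont x1 x2 y1 y2 k.
  move=> h1 h2 h3 h4 hx1 hx2 hy1 hy2 z /andP[/andP[/andP[z1 z2] /andP[z3 z4]] zE].
  apply: cdiff_continuous; apply: dk.
    by rewrite /inrect (le_trans h1 z1) (le_trans z2 h2) (le_trans h3 z3) (le_trans z4 h4).
  apply/negP => /andP[/andP[k1 k2] /andP[k3 k4]].
  by case/or4P: zE => /eqP e; rewrite -e in hx1 hx2 hy1 hy2;
    move: hx1 hx2 hy1 hy2; rewrite ![_ <= _]leNgt ?k1 ?k2 ?k3 ?k4.
have ab0 := le_trans aa (le_trans ab bb).
have cd0 := le_trans cc (le_trans cd dd).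
have a'b := le_trans ab bb; have c'd := le_trans cd dd.
have ad' := le_trans aa ab; have cd' := le_trans cc cd.
rewrite (@contour_splitx _ _ _ _ _ _ a')//; last 2 first.
- by rewrite aa a'b.
- by apply: rc; rewrite ?lexx ?aa ?bb ?cc ?dd ?orbT.
rewrite (@contour_splitx _ a' _ _ _ _ b')//; last 2 first.
- by rewrite ab bb.
- by apply: rc; rewrite ?lexx ?aa ?bb ?cc ?dd ?orbT.
rewrite (@contour_splity _ a' b' _ _ _ c')//; last 2 first.
- by rewrite cc c'd.
- by apply: rc; rewrite ?lexx ?aa ?bb ?cc ?dd ?orbT.
rewrite (@contour_splity _ a' b' c' _ _ d')//; last 2 first.
- by rewrite cd dd.
- by apply: rc; rewrite ?lexx ?aa ?bb ?cc ?dd ?orbT.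
rewrite (@Goursat _ a a')//; last by apply: key; rewrite ?lexx ?orbT.
rewrite (@Goursat _ b' b)//; last by apply: key; rewrite ?lexx ?orbT.
rewrite (@Goursat _ a' b' c c')//; last by apply: key; rewrite ?lexx ?orbT.
rewrite (@Goursat _ a' b' d' d)//; last by apply: key; rewrite ?lexx ?orbT.
by rewrite !addr0 !add0r.
Qed.

(** On a small square of half-side [m] the difference [k z - g p / (z - p)] is [o(1 / m)] and the
    perimeter is [8 * m]. Only continuity of [g] at [p] is assumed, because in [annulus_formula] [g]
    contains a Caratheodory quotient of [cexp], known to be continuous at [p] only. *)
Lemma residue a b c d p k g :
  a < complex.Re p < b -> c < complex.Im p < d ->
  (forall z, inrect a b c d z -> z != p -> cdiff k z) ->
  ctat g p ->
  (forall z, inrect a b c d z -> z != p -> k z = g z / (z - p)) ->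
  contour a b c d k = g p * twopii.
Proof.
set p1 := complex.Re p; set p2 := complex.Im p.
move=> /andP[ap pb] /andP[cp pd] dk cg kg.
apply/eqP; rewrite -subr_eq0 -normc_eq0 eq_le normc_ge0 andbT.
apply/ler_addgt0Pl => e e0; rewrite addr0.
(* [contour_bound] will give [4 * (e / 16 / m) * (2 * m + 2 * m) = e]. *)
have e16 : 0 < e / 16 by rewrite divr_gt0.
have /ctCP/(_ _ e16)/nbhsCP[r r0 hr] := cg.
(* The square of half-side [m] about [p] stays in the rectangle, and within [2 * m < r] of [p]. *)
pose m := Num.min (Num.min (p1 - a) (b - p1)) (Num.min (Num.min (p2 - c) (d - p2)) (r / 4)).
have m0 : 0 < m by rewrite !lt_min !subr_gt0 ap pb cp pd divr_gt0.
have [ma [mb [mc [md mr]]]] : m <= p1 - a /\ m <= b - p1 /\ m <= p2 - c /\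
    m <= d - p2 /\ m <= r / 4.
  by rewrite /m !ge_min !lexx !orbT.
have [q1 q2 q3 q4] : [/\ a <= p1 - m, p1 + m <= b, c <= p2 - m & p2 + m <= d].
  by split; lra.
have [q5 q6] : p1 - m <= p1 + m /\ p2 - m <= p2 + m by split; lra.
have sub z : inrect (p1 - m) (p1 + m) (p2 - m) (p2 + m) z -> inrect a b c d z.
  move=> /andP[/andP[z1 z2] /andP[z3 z4]]; rewrite /inrect.
  by rewrite (le_trans q1 z1) (le_trans z2 q2) (le_trans q3 z3) (le_trans z4 q4).
have neq z : onrect (p1 - m) (p1 + m) (p2 - m) (p2 + m) z -> z != p.
  move=> /(onrect_dist m0) h; rewrite -subr_eq0 -normc_gt0.
  exact: lt_le_trans h.
have ck : rectcont (p1 - m) (p1 + m) (p2 - m) (p2 + m) k.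
  move=> z zS; apply: cdiff_continuous; apply: dk; last exact: neq.
  by apply: sub; case/andP: zS.
have ci : rectcont (p1 - m) (p1 + m) (p2 - m) (p2 + m) (fun z => (z - p)^-1).
  by move=> z zS; apply: ct_subV; exact: neq.
have cgi : rectcont (p1 - m) (p1 + m) (p2 - m) (p2 + m) (fun z => g p * (z - p)^-1).
  by move=> z zS; apply: ctM; [exact: ct_cst|exact: ci].
rewrite (@contour_shrink _ _ _ _ (p1 - m) (p1 + m) (p2 - m) (p2 + m))//; last first.
  move=> z zR nz; apply: dk => //; apply: contra nz => /eqP ->.
  by rewrite -/p1 -/p2 !ltrBlDr !ltrDl m0.
rewrite -(contour_inv p m0) -contourZ// -contourB//.
apply: le_trans (contour_bound (M := e / 16 / m) _ _ _ _) _ => //.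
- by move=> z zS; apply: ctB; [exact: ck|exact: cgi].
- move=> z zS; have [zi _] := andP zS.
  rewrite kg ?neq//; last exact: sub.
  rewrite -mulrBl normcM normcV; apply: ler_pM; rewrite ?normc_ge0 ?invr_ge0 ?normc_ge0//.
    apply/ltW/hr; apply: le_lt_trans (normc_ReIm _) _.
    move: zi; rewrite /inrect => /andP[z1 z2].
    have -> : complex.Re (z - p) = complex.Re z - p1 by rewrite /p1; case: (z) (p) => ? ? [].
    have -> : complex.Im (z - p) = complex.Im z - p2 by rewrite /p2; case: (z) (p) => ? ? [].
    have k1 : `|complex.Re z - p1| <= m by rewrite ler_norml; lra.
    have k2 : `|complex.Im z - p2| <= m by rewrite ler_norml; lra.
    lra.
  rewrite lef_pV2 ?posrE//; first exact: (onrect_dist m0).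
  by rewrite normc_gt0 subr_eq0 neq.
- rewrite le_eqVlt; apply/orP; left; apply/eqP; field; exact: lt0r_neq0.
Qed.

Lemma Cauchy_formula a b c d p f :
  a < complex.Re p < b -> c < complex.Im p < d ->
  (forall z, inrect a b c d z -> cdiff f z) ->
  contour a b c d (fun z => f z / (z - p)) = f p * twopii.
Proof.
move=> hp1 hp2 df; apply: (residue hp1 hp2) => // [z zR zp|].
  by apply: cdiffM; [exact: df|exact: cdiff_subV].
apply: cdiff_continuous; apply: df.
by move: hp1 hp2; rewrite /inrect => /andP[/ltW-> /ltW->] /andP[/ltW-> /ltW->].
Qed.

End Residue.

(** * Unique continuation *)

Section Identity.
Variable R : realType.
Local Notation C := (R[i]^o).
Implicit Types (a b c d : R) (z p w q : C).
Local Notation ii := (Complex 0 1 : C).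
Local Notation twopii := (Complex 0 (2 * pi) : C).

Lemma rcont_bounded a b (f : R -> R) : rcont a b f ->
  exists M, forall x, a <= x <= b -> f x <= M.
Proof.
move=> cf; have [ab|ba] := leP a b; last first.
  by exists 0 => x /andP[ax xb]; have := le_lt_trans (le_trans ax xb) ba; rewrite ltxx.
have [|c _ hc] := @EVT_max R f a b ab.
  apply: continuous_in_subspaceT => x; rewrite inE /= in_itv /= => xab.
  by apply/ctatP; exact: cf.
by exists (f c) => x xab; apply: hc; rewrite in_itv.
Qed.

Lemma ccont_bounded a b (f : R -> C) : ccont a b f ->
  exists2 M, 0 < M & forall x, a <= x <= b -> normc (f x) <= M.
Proof.
move=> /ccont_normc/rcont_bounded[M hM]; exists (`|M| + 1).
  by rewrite ltr_wpDl.
by move=> x /hM h; rewrite (le_trans h)// (le_trans (ler_norm _))// lerDl.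
Qed.

Lemma rect_bounded a b c d (f : C -> C) : a <= b -> c <= d -> rectcont a b c d f ->
  exists2 M, 0 < M & forall z, onrect a b c d z -> normc (f z) <= M.
Proof.
move=> ab cd cf.
have [|M1 M10 h1] := ccont_bounded (@ccont_v _ _ _ _ _ _ a cf ab _).
  by rewrite eqxx.
have [|M2 M20 h2] := ccont_bounded (@ccont_v _ _ _ _ _ _ b cf ab _).
  by rewrite eqxx orbT.
have [|M3 M30 h3] := ccont_bounded (@ccont_h _ _ _ _ _ _ c cf cd _).
  by rewrite eqxx.
have [|M4 M40 h4] := ccont_bounded (@ccont_h _ _ _ _ _ _ d cf cd _).
  by rewrite eqxx orbT.
exists (M1 + M2 + M3 + M4); first by rewrite !addr_gt0.
move=> [x y] /andP[/andP[/= hx hy] /or4P[] /eqP e]; rewrite e.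
- by apply: le_trans (h1 _ hy) _; lra.
- by apply: le_trans (h2 _ hy) _; lra.
- by apply: le_trans (h3 _ hx) _; lra.
- by apply: le_trans (h4 _ hx) _; lra.
Qed.

Definition square q (d : R) :=
  inrect (complex.Re q - d) (complex.Re q + d) (complex.Im q - d) (complex.Im q + d).

Lemma square_dist q d z : square q d z -> normc (z - q) <= 2 * d.
Proof.
move=> /andP[h1 h2].
apply: le_trans (normc_ReIm _) _; rewrite ReB ImB mulrDl !mul1r.
by apply: lerD; rewrite ler_norml; lra.
Qed.

Lemma dist_square q d z : normc (z - q) < d ->
  (complex.Re q - d < complex.Re z < complex.Re q + d) &&
  (complex.Im q - d < complex.Im z < complex.Im q + d).
Proof.
move=> h; have := le_lt_trans (normc_Re _) h; have := le_lt_trans (normc_Im _) h.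
rewrite ReB ImB !ltr_norml => /andP[h1 h2] /andP[h3 h4].
by apply/andP; split; apply/andP; split; lra.
Qed.

(* [F / (z - q)^n] is still holomorphic, so the Cauchy formula bounds
   [|F w|] by a multiple of [(|w - q| / d)^n] for all [n]. *)
Lemma local_identity (F : C -> C) q d : 0 < d ->
  (forall z, square q d z -> cdiff F z) -> (\forall z \near q, F z = 0) ->
  forall w, normc (w - q) < d / 2 -> F w = 0.
Proof.
move=> d0 dF Fq w wq.
have [->|wnq] := eqVneq w q; first exact: nbhs_singleton Fq.
have nwq : 0 < normc (w - q) by rewrite normc_gt0 subr_eq0.
have [h1 h2] : complex.Re q - d <= complex.Re q + d /\ complex.Im q - d <= complex.Im q + d.
  by split; lra.
have cF : rectcont (complex.Re q - d) (complex.Re q + d)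
    (complex.Im q - d) (complex.Im q + d) F.
  by apply: rectcontW => z /dF; exact: cdiff_continuous.
have [M M0 FM] := rect_bounded h1 h2 cF.
have wd : normc (w - q) < d by lra.
have [w1 w2] := andP (dist_square wd).
(* Near [q] the product is identically 0, whatever the default value of the inverse at [q]. *)
have dG n z : square q d z -> cdiff (fun z => F z * ((z - q) ^+ n)^-1) z.
  move=> zS; have [->|zq] := eqVneq z q.
    apply: (cdiff_near _ (cdiff_cst 0 _)).
    by apply: filterS Fq => x ->; rewrite mul0r.
  apply: cdiffM; first exact: dF.
  apply: cdiffV; first by rewrite expf_neq0// subr_eq0.
  by apply: cdiffX; apply: cdiffB; [exact: cdiff_id|exact: cdiff_cst].
have npi : normc twopii = 2 * pi.
  rewrite /= expr0n add0r sqrtr_sqr ger0_norm// mulr_ge0//; exact: pi_ge0.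
(* On the contour [normc (z - q) >= d] and [normc (z - w) >= d / 2]; with the sides [2 * d] this
   gives [4 * (M / d ^+ n / (d / 2)) * (4 * d) = 32 * M / d ^+ n]. *)
have bnd n : normc (F w) * (2 * pi) <= 32 * M / 2 ^+ n.
  have := Cauchy_formula w1 w2 (dG n).
  move=> /(congr1 (@normc R)); rewrite !normcM npi normcV normcX => E.
  have le1 : normc (F w) / normc (w - q) ^+ n * (2 * pi) <= 32 * M / d ^+ n.
    rewrite -E; apply: le_trans (contour_bound (M := M / d ^+ n / (d / 2)) h1 h2 _ _) _.
    - move=> z zS; have zd := onrect_dist d0 zS.
      apply: ctM.
        by apply: cdiff_continuous; apply: dG; case/andP: zS.
      apply: ct_subV; apply: contraTN wd => /eqP <-; rewrite -leNgt; exact: zd.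
    - move=> z zS; have zd := onrect_dist d0 zS; rewrite !normcM !normcV normcX.
      have zw : d / 2 <= normc (z - w).
        have := le_normcD (z - w) (w - q); rewrite addrA subrK; lra.
      have d20 : 0 < d / 2 by rewrite divr_gt0.
      apply: ler_pM; rewrite ?mulr_ge0 ?invr_ge0 ?exprn_ge0 ?normc_ge0//.
        apply: ler_pM; rewrite ?mulr_ge0 ?invr_ge0 ?exprn_ge0 ?normc_ge0//.
          exact: FM.
        rewrite lef_pV2 ?posrE ?exprn_gt0//; last exact: lt_le_trans zd.
        by rewrite lerXn2r ?nnegrE ?normc_ge0// ltW.
      by rewrite lef_pV2 ?posrE//; exact: lt_le_trans zw.
    - rewrite le_eqVlt; apply/orP; left; apply/eqP; field.
      by rewrite expf_neq0 lt0r_neq0.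
  have dn : 0 < d ^+ n by rewrite exprn_gt0.
  have wn : 0 < normc (w - q) ^+ n by rewrite exprn_gt0.
  have -> : normc (F w) * (2 * pi) =
    normc (F w) / normc (w - q) ^+ n * (2 * pi) * normc (w - q) ^+ n.
    by field; rewrite lt0r_neq0.
  apply: le_trans (ler_wpM2r (ltW wn) le1) _.
  rewrite -[32 * M / _ * _]mulrA ler_wpM2l ?mulr_ge0 ?(ltW M0)// ler_pdivrMl// -exprVn -exprMn.
  by rewrite lerXn2r ?nnegrE ?normc_ge0 ?mulr_ge0 ?invr_ge0 ?(ltW d0)// ltW.
apply/eqP; rewrite -normc_eq0; apply/negPn/negP => Fw0.
have Fw : 0 < normc (F w) * (2 * pi).
  by rewrite mulr_gt0 ?mulr_gt0 ?pi_gt0// lt_def Fw0 normc_ge0.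
have : (fun n : nat => 32 * M * (2^-1) ^+ n) @ \oo --> 32 * M * 0.
  apply: cvgM; first exact: cvg_cst.
  by apply: cvg_expr; rewrite ger0_norm ?invr_ge0// invf_lt1// ltr1n.
rewrite mulr0 => /cvgrPdist_lt/(_ _ Fw) [n _ /(_ n (leqnn n))].
rewrite sub0r normrN ger0_norm ?mulr_ge0 ?exprn_ge0 ?invr_ge0// ?(ltW M0)//.
by rewrite exprVn; apply/negP; rewrite -leNgt; exact: bnd.
Qed.

(** The parameters [s] for which [F] vanishes near [s * z] form an open set, relatively closed in
    [[0, 1]] by [local_identity]; the segment is connected. *)
Lemma segment_identity (F : C -> C) z :
  (forall s, 0 <= s <= 1 -> \forall w \near (s%:C%C * z : C), cdiff F w) ->
  (\forall w \near (0 : C), F w = 0) -> F z = 0.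
Proof.
move=> dF F0.
pose E := [set s : R | \forall w \near (s%:C%C * z : C), F w = 0].
have cs (s : R) : ctat (fun s : R => (s%:C%C * z : C)) s.
  apply: ctM; last exact: ct_cst.
  apply: (ct_Complex (g := fun=> 0)); first exact: ct_id.
  by apply/ctatP; exact: cvg_cst.
have oE : open E.
  rewrite openE => s Es; exact: (ctat_near (cs s) (nbhs_interior Es)).
have EE s : 0 <= s <= 1 -> closure E s -> E s.
  move=> s01 clE; have /nbhsCP[r r0 hr] := dF s s01.
  (* The square of half-side [r / 4] about a point within [r / 16] of [s * z] lies in the disc of
     radius [r] about [s * z], and [local_identity] reaches to distance [r / 8], hence over the disc
     of radius [r / 16] about [s * z]. *)
  have r16 : 0 < r / 16 by rewrite divr_gt0.
  have /ctCP/(_ _ r16) := cs s.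
  move=> /clE[s' [Es' /= hs']].
  have d0 : 0 < r / 4 by rewrite divr_gt0.
  have F0' : forall w, normc (w - s'%:C%C * z) < r / 4 / 2 -> F w = 0.
    apply: (local_identity d0) => // w /square_dist hw; apply: hr.
    have := le_normcD (w - s'%:C%C * z) (s'%:C%C * z - s%:C%C * z).
    rewrite addrA subrK; lra.
  apply/nbhsCP; exists (r / 16) => // w hw; apply: F0'.
  have := le_normcD (w - s%:C%C * z) (s%:C%C * z - s'%:C%C * z).
  rewrite addrA subrK [X in _ <= _ + X]normcB; lra.
have : `[0, 1]%classic `&` E = `[0, 1]%classic.
  apply: segment_connected.
  - exists 0; split; first by rewrite /= in_itv /= lexx ler01.
    by rewrite /E /= mul0r.
  - by exists E.
  - exists (closure E); first exact: closed_closure.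
    apply/seteqP; split => s [s01 Es].
      split; first exact: s01.
      exact: (subset_closure Es).
    split; first exact: s01.
    by apply: (EE _ _ Es); move: s01; rewrite /= in_itv.
move=> /seteqP[_ /(_ 1)]; rewrite /= in_itv /= lexx ler01 => /(_ isT)[_].
by rewrite /E /= mul1r; exact: nbhs_singleton.
Qed.

End Identity.

(** * Cauchy-type integrals *)

Section CauchyType.
Variable R : realType.
Local Notation C := (R[i]^o).
Implicit Types (a b c d : R).
Local Notation ii := (Complex 0 1 : C).
Local Notation twopii := (Complex 0 (2 * pi) : C).

Lemma twopii_neq0 : twopii != 0.
Proof.
by rewrite eq_complex /= negb_and mulf_neq0 ?orbT ?pnatr_eq0// gt_eqF// pi_gt0.
Qed.

Lemma near_ccont (T : topologicalType) a b (psi : T * R -> C) (z : T) :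
  (forall s, a <= s <= b -> lcont psi (z, s)) ->
  \forall w \near z, ccont a b (fun s => psi (w, s)).
Proof.
move=> h.
have : \forall w \near z, forall s, a <= s <= b -> lcont psi (w, s).
  by apply: (tube (P := lcont psi)) => s /h; exact: nbhs_interior.
apply: filterS => w hw s /hw /lcontW; apply: ct_comp.
apply: ct_pair; last exact: ct_id.
by apply/ctatP; exact: cvg_cst.
Qed.

Lemma lcont_contour (T : topologicalType) a b c d (psi : T * C -> C) (z : T) :
  a <= b -> c <= d -> (forall w, onrect a b c d w -> lcont psi (z, w)) ->
  lcont (fun x => contour a b c d (fun w => psi (x, w))) z.
Proof.
move=> ab cd h.
have hl y : (y == c) || (y == d) ->
    lcont (fun x => cint a b (fun t => psi (x, Complex t y))) z.
  move=> ycd.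
  apply: (lcont_cint (psi := fun p => psi (p.1, Complex p.2 y))) => // s sab.
  apply: (lcont_comp (g := fun p : T * R => (p.1, Complex p.2 y : C)) (f := psi)).
    apply: lcont_ct => p; apply: ct_pair; first exact: ct_fst.
    by apply: ct_comp (ct_hline y _); exact: ct_snd.
  by apply: h; exact: onrect_h.
have vl x0 : (x0 == a) || (x0 == b) ->
    lcont (fun x => cint c d (fun t => psi (x, Complex x0 t))) z.
  move=> xab.
  apply: (lcont_cint (psi := fun p => psi (p.1, Complex x0 p.2))) => // s sab.
  apply: (lcont_comp (g := fun p : T * R => (p.1, Complex x0 p.2 : C)) (f := psi)).
    apply: lcont_ct => p; apply: ct_pair; first exact: ct_fst.
    by apply: ct_comp (ct_vline x0 _); exact: ct_snd.
  by apply: h; exact: onrect_v.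
apply: lcontD; first by apply: lcontB; apply: hl; rewrite eqxx ?orbT.
apply: lcontM; first exact: lcont_cst.
by apply: lcontB; apply: vl; rewrite eqxx ?orbT.
Qed.

(** From [1 / (x - w) - 1 / (x - z) = (w - z) / ((x - w) * (x - z))] under the Cauchy integral.
    Unlike the pointwise difference quotients, this one is jointly continuous in [w] and the
    parameter, also at [w = z]. *)
Lemma holo_quotient (T : topologicalType) (u : C * T -> C) (z : C) (d : R) (D : set T) :
  0 < d ->
  (forall t w, D t -> square z d w -> lcont u (w, t)) ->
  (forall t w, D t -> square z d w -> cdiff (fun x => u (x, t)) w) ->
  exists Q : C * T -> C,
    (forall t, D t -> lcont Q (z, t)) /\
    (forall t w, D t -> normc (w - z) < d ->
       u (w, t) - u (z, t) = (w - z) * Q (w, t)).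
Proof.
move=> d0 lu du.
pose a := complex.Re z - d; pose b := complex.Re z + d.
pose c := complex.Im z - d; pose e := complex.Im z + d.
have ab : a <= b by rewrite /a /b; lra.
have ce : c <= e by rewrite /c /e; lra.
exists (fun p => twopii^-1 *
  contour a b c e (fun x => u (x, p.2) * ((x - p.1)^-1 * (x - z)^-1))).
have xz x : onrect a b c e x -> x - z != 0.
  move=> /(onrect_dist d0) h; rewrite -normc_gt0; exact: lt_le_trans h.
split=> [t Dt|t w Dt wz].
  apply: lcontM; first exact: lcont_cst.
  apply: (lcont_contour (psi := fun q : (C * T) * C =>
    u (q.2, q.1.2) * ((q.2 - q.1.1)^-1 * (q.2 - z)^-1))) => // x xS.
  apply: lcontM.
    apply: (lcont_comp (g := fun q : (C * T) * C => (q.2, q.1.2)) (f := u)).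
      apply: lcont_ct => q; apply: ct_pair; first exact: ct_snd.
      by apply: (ct_comp (g := fst) (f := snd)); [exact: ct_fst|exact: ct_snd].
    by apply: lu => //; case/andP: xS.
  have l2 : lcont (snd : (C * T) * C -> C) (z, t, x).
    by apply: lcont_ct => q; exact: ct_snd.
  apply: lcontM; apply: lcontV; rewrite ?xz//; apply: lcontB => //.
    apply: lcont_ct => q.
    by apply: (ct_comp (g := fst) (f := fst)); exact: ct_fst.
  exact: lcont_cst.
have [h1 h2] := andP (dist_square wz).
have zz : normc (z - z) < d by rewrite subrr normc0.
have [k1 k2] := andP (dist_square zz).
have E1 := Cauchy_formula h1 h2 (fun x => du t x Dt).
have E2 := Cauchy_formula k1 k2 (fun x => du t x Dt).
have xw x : onrect a b c e x -> x - w != 0.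
  move=> /(onrect_dist d0) h; apply: contraTneq wz => xw.
  by rewrite -leNgt (_ : w = x)//; apply/eqP; rewrite eq_sym -subr_eq0 xw.
have cu x : onrect a b c e x -> ctat (fun x => u (x, t)) x.
  by move=> /andP[xS _]; apply: cdiff_continuous; exact: du.
apply: (mulIf twopii_neq0).
rewrite mulrBl -E1 -E2 -contourB//; first last.
- move=> x xS; apply: ctM; first exact: cu.
  by apply: ct_subV; rewrite -subr_eq0 xz.
- move=> x xS; apply: ctM; first exact: cu.
  by apply: ct_subV; rewrite -subr_eq0 xw.
rewrite -[RHS]mulrA [twopii^-1 * _]mulrC divfK ?twopii_neq0//=.
rewrite -contourZ//.
  apply: contour_ext => // x xS.
  by have := xz x xS; have := xw x xS => n1 n2; field; rewrite n1 n2.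
move=> x xS; apply: ctM; first exact: cu.
apply: ctM; apply: ct_subV; rewrite -subr_eq0; [exact: xw|exact: xz].
Qed.

Lemma open_square (V : C -> Prop) (z : C) : (\forall w \near z, V w) ->
  exists2 d : R, 0 < d & forall w, square z d w -> V w.
Proof.
move=> /nbhsCP[r r0 hr]; exists (r / 4); first by rewrite divr_gt0.
by move=> w /square_dist h; apply: hr; lra.
Qed.

Definition cauchy_type a b (zeta kappa : R -> C) (u : C2 R -> C) (z : C2 R) : C :=
  cint a b (fun t => u (z.1, zeta t) * (kappa t / (zeta t - z.2))).

Lemma ct_zeta (T : topologicalType) (zeta : R -> C) (p : T * R) :
  (forall t, ctat zeta t) -> ctat (fun q : T * R => zeta q.2) p.
Proof. by move=> cz; apply: ct_comp (cz _); exact: ct_snd. Qed.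

Lemma holo_lcont (V : set (C2 R)) (u : C2 R -> C) z : open V ->
  holomorphic_on V u -> V z -> lcont u z.
Proof.
move=> oV hu Vz; have : \forall w \near z, V w by exact: open_nbhs_nbhs.
by apply: filterS => w /hu; exact: differentiable_ctat.
Qed.

Lemma tube_curve (V : set (C2 R)) a b (zeta : R -> C) (z : C) :
  (forall t, ctat zeta t) -> open V ->
  (forall t, a <= t <= b -> V (z, zeta t)) ->
  \forall w \near z, forall t, a <= t <= b -> V (w, zeta t).
Proof.
move=> cz oV Vz.
apply: (tube (P := fun p => V (p.1, zeta p.2))) => t tab.
apply: (ctat_near (f := fun p : C * R => (p.1, zeta p.2)) (P := V)).
  by apply: ct_pair; [exact: ct_fst|exact: ct_zeta].
apply: open_nbhs_nbhs; split => //; exact: Vz.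
Qed.

(** The increment of the integrand is that of [u], factored by [holo_quotient], against the new
    kernel, plus the old value of [u] against the increment of the kernel, factored by algebra.
    Integrating both factors gives the two continuous quotients of [differentiable_car]. *)
Lemma cauchy_type_differentiable (V : set (C2 R)) a b (zeta kappa : R -> C)
    (u : C2 R -> C) (z : C2 R) : a <= b ->
  (forall t, ctat zeta t) -> (forall t, ctat kappa t) ->
  open V -> holomorphic_on V u ->
  (forall t, a <= t <= b -> V (z.1, zeta t)) ->
  (forall t, a <= t <= b -> zeta t != z.2) ->
  differentiable (cauchy_type a b zeta kappa u) z.
Proof.
move=> ab cz ck oV hu Vz zz.
have [d d0 hd] := open_square (tube_curve cz oV Vz).
pose D := [set t | a <= t <= b].
have l2 (f : R -> C) (T : topologicalType) (p : T * R) : (forall t, ctat f t) ->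
    lcont (fun q : T * R => f q.2) p.
  by move=> cf; apply: lcont_ct => q; exact: ct_zeta.
have lu w t : V (w, zeta t) -> lcont (fun q : C * R => u (q.1, zeta q.2)) (w, t).
  move=> Vw; apply: (lcont_comp (g := fun q : C * R => (q.1, zeta q.2)) (f := u)).
    by apply: lcont_ct => q; apply: ct_pair; [exact: ct_fst|exact: ct_zeta].
  exact: (holo_lcont oV hu Vw).
have [Q [lQ hQ]] := @holo_quotient _ (fun q : C * R => u (q.1, zeta q.2)) z.1 d D d0
  (fun t w Dt wS => lu w t (hd w wS t Dt))
  (fun t w Dt wS => differentiable_slice1 (hu _ (hd w wS t Dt))).
have ld t : a <= t <= b ->
    lcont (fun q : C2 R * R => (zeta q.2 - q.1.2)^-1) (z, t).
  move=> tab; apply: lcontV; first by rewrite subr_eq0 zz.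
  apply: lcontB; first exact: l2.
  apply: lcont_ct => q; apply: (ct_comp (g := fst) (f := snd)); first exact: ct_fst.
  exact: ct_snd.
pose f1 (q : C2 R * R) := Q (q.1.1, q.2) * (kappa q.2 * (zeta q.2 - q.1.2)^-1).
pose f2 (q : C2 R * R) := u (z.1, zeta q.2) *
  (kappa q.2 * ((zeta q.2 - q.1.2)^-1 * (zeta q.2 - z.2)^-1)).
have lf1 t : a <= t <= b -> lcont f1 (z, t).
  move=> tab; apply: lcontM; last by apply: lcontM; [exact: l2|exact: ld].
  apply: (lcont_comp (g := fun q : C2 R * R => (q.1.1, q.2)) (f := Q)); last exact: lQ.
  apply: lcont_ct => q; apply: ct_pair; last exact: ct_snd.
  by apply: (ct_comp (g := fst) (f := fst)); exact: ct_fst.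
have lf2 t : a <= t <= b -> lcont f2 (z, t).
  move=> tab; apply: lcontM.
    apply: (lcont_comp (g := fun q : C2 R * R => (z.1, zeta q.2)) (f := u)).
      apply: lcont_ct => q; apply: ct_pair; [exact: ct_cst|exact: ct_zeta].
    by apply: (holo_lcont oV hu); exact: Vz.
  apply: lcontM; first exact: l2.
  apply: lcontM; first exact: ld.
  apply: lcontV; first by rewrite subr_eq0 zz.
  by apply: lcontB; [exact: l2|exact: lcont_cst].
have lA t : a <= t <= b ->
    lcont (fun q : C2 R * R => u (q.1.1, zeta q.2) * (kappa q.2 / (zeta q.2 - q.1.2))) (z, t).
  move=> tab; apply: lcontM.
    apply: (lcont_comp (g := fun q : C2 R * R => (q.1.1, q.2))
      (f := fun q : C * R => u (q.1, zeta q.2))).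
      apply: lcont_ct => q; apply: ct_pair; last exact: ct_snd.
      by apply: (ct_comp (g := fst) (f := fst)); exact: ct_fst.
    by apply: lu; exact: Vz.
  by apply: lcontM; [exact: l2|exact: ld].
apply: (differentiable_car (q1 := fun w => cint a b (fun t => f1 (w, t)))
  (q2 := fun w => cint a b (fun t => f2 (w, t)))).
- by apply/lcontW/lcont_cint.
- by apply/lcontW/lcont_cint.
have n1 : \forall w \near z, normc (w.1 - z.1) < d.
  apply: (ctat_near (f := fst : C2 R -> C) (P := fun x => normc (x - z.1) < d)).
    exact: ct_fst.
  by apply/nbhsCP; exists d.
have n2 : \forall w \near z, forall t, a <= t <= b -> zeta t - w.2 != 0.
  apply: (tube (P := fun q : C2 R * R => zeta q.2 - q.1.2 != 0)) => t tab.
  apply: (@ct_neq0 _ _ (fun q : C2 R * R => zeta q.2 - q.1.2)).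
    by rewrite subr_eq0 zz.
  apply: ctB; first exact: ct_zeta.
  apply: (ct_comp (g := fst) (f := snd)); first exact: ct_fst.
  exact: ct_snd.
have c1 := near_ccont lf1; have c2 := near_ccont lf2; have c3 := near_ccont lA.
near=> w.
have cf1 : ccont a b (fun t => f1 (w, t)) by near: w.
have cf2 : ccont a b (fun t => f2 (w, t)) by near: w.
have cAw : ccont a b (fun t => u (w.1, zeta t) * (kappa t / (zeta t - w.2))).
  by near: w.
have cAz := nbhs_singleton c3.
have wz : normc (w.1 - z.1) < d by near: w.
have wn : forall t, a <= t <= b -> zeta t - w.2 != 0 by near: w.
rewrite /cauchy_type -!cintZ// -cintB// -cintD//; first last.
- by apply: ccontM => //; exact: ccont_cst.
- by apply: ccontM => //; exact: ccont_cst.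
apply: cint_ext => t tab; rewrite /f1 /f2 /=.
rewrite [(w.1 - z.1) * _]mulrA -(hQ t w.1 tab wz) /=.
have zn : zeta t - z.2 != 0 by rewrite subr_eq0 zz.
have := wn t tab => wn'.
by field; rewrite zn wn'.
Unshelve. all: by end_near. Qed.

End CauchyType.

(** * The exponential and the Cauchy formula on annuli *)

Section CExp.
Variable R : realType.
Local Notation C := (R[i]^o).
Implicit Types (a b c d : R) (z w p : C).
Local Notation ii := (Complex 0 1 : C).
Local Notation twopii := (Complex 0 (2 * pi) : C).

Definition cexp w : C :=
  Complex (expR (complex.Re w) * cos (complex.Im w))
          (expR (complex.Re w) * sin (complex.Im w)).

Lemma cexpD v w : cexp (v + w) = cexp v * cexp w.
Proof.
case: v w => a b [c d]; apply/eqP; rewrite eq_complex /cexp /=.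
by rewrite expRD cosD sinD; apply/andP; split; apply/eqP; ring.
Qed.

Lemma normc_cexp w : normc (cexp w) = expR (complex.Re w).
Proof.
rewrite /cexp /= !exprMn -mulrDr cos2Dsin2 mulr1 sqrtr_sqr ger0_norm// expR_ge0.
Qed.

Lemma cexp_neq0 w : cexp w != 0.
Proof. by rewrite -normc_gt0 normc_cexp expR_gt0. Qed.

Lemma cexpB v w : cexp (v - w) = cexp v / cexp w.
Proof.
by apply: (mulIf (cexp_neq0 w)); rewrite -cexpD subrK divfK// cexp_neq0.
Qed.

Lemma is_derive_approx (f : R -> R) (x l e : R) : is_derive x 1 f l -> 0 < e ->
  exists2 r : R, 0 < r & forall h, `|h| < r -> `|f (x + h) - f x - l * h| <= e * `|h|.
Proof.
move=> [df fl] e0; have := df => /derivable_nbhsx.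
rewrite fl => /(_ 0) _.
have : (fun h => h^-1 *: ((f \o shift x) (h *: 1) - f x)) @ 0^' --> l by rewrite -fl.
move=> /cvgrPdist_le/(_ e e0); rewrite near_withinE => /nbhs_ballP[r /= r0 hr].
exists r => // h hr0; have [->|h0] := eqVneq h 0.
  by rewrite addr0 subrr mulr0 subr0 normr0 mulr0.
have := hr h; rewrite -ball_normE /= sub0r normrN => /(_ hr0 h0).
rewrite /GRing.scale /= mulr1 [h + x]addrC => H.
rewrite (_ : _ - _ - _ = - (l - h^-1 * (f (x + h) - f x)) * h); last by field.
by rewrite normrM normrN ler_wpM2r.
Qed.

(** The real arithmetic of [cexp_approx]: [E], [Cs], [Sn] stand for [expR x], [cos y], [sin y], and
    [N] for the modulus of the exponent with parts [x] and [y]. *)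
Lemma trig_bound (e x y N E Cs Sn : R) : 0 < e -> e <= 1 / 8 -> `|x| <= N -> `|y| <= N ->
  N < e -> `|Sn - y| <= e * `|y| -> `|Cs - 1| <= e * `|y| -> `|E - 1 - x| <= e * `|x| ->
  `|E * Cs - 1 - x| + `|E * Sn - y| <= 8 * e * N.
Proof.
move=> e0 e1 xN yN Ne hS hC hE.
have N0 : 0 <= N by exact: le_trans xN.
have hS' : `|Sn - y| <= e * N by apply: le_trans hS _; rewrite ler_pM2l.
have hC' : `|Cs - 1| <= e * N by apply: le_trans hC _; rewrite ler_pM2l.
have hE' : `|E - 1 - x| <= e * N by apply: le_trans hE _; rewrite ler_pM2l.
have E1 : `|E - 1| <= 2 * N.
  have := ler_normD (E - 1 - x) x; rewrite subrK.
  have : e * N <= N by rewrite ler_piMl//; lra.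
  lra.
have E2 : `|E| <= 2.
  have := ler_normD (E - 1) 1; rewrite subrK normr1; lra.
have t1 : `|E * Cs - 1 - x| <= e * N + 2 * (e * N).
  rewrite (_ : _ - _ = (E - 1 - x) + E * (Cs - 1)); last by ring.
  apply: le_trans (ler_normD _ _) _; apply: lerD => //.
  by rewrite normrM; apply: ler_pM.
have t2 : `|E * Sn - y| <= 2 * (e * N) + 2 * N * e.
  rewrite (_ : _ - _ = E * (Sn - y) + (E - 1) * y); last by ring.
  apply: le_trans (ler_normD _ _) _; rewrite !normrM; apply: lerD; apply: ler_pM => //.
  lra.
have eN : 0 <= e * N by rewrite mulr_ge0// ltW.
lra.
Qed.

Lemma cexp_approx (e : R) : 0 < e -> exists2 r : R, 0 < r &
  forall v, normc v < r -> normc (cexp v - 1 - v) <= e * normc v.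
Proof.
move=> e0.
pose e' := Num.min e 1 / 8.
have e'0 : 0 < e' by rewrite divr_gt0// lt_min e0 ltr01.
have [e'1 e'e] : e' <= 1 / 8 /\ e' <= e / 8.
  by split; rewrite ler_pM2r ?invr_gt0// ge_min lexx ?orbT.
have [r1 r10 h1] := is_derive_approx (is_derive_expR 0) e'0.
have [r2 r20 h2] := is_derive_approx (is_derive_cos 0) e'0.
have [r3 r30 h3] := is_derive_approx (is_derive_sin 0) e'0.
exists (Num.min (Num.min r1 r2) (Num.min r3 e')).
  by rewrite !lt_min r10 r20 r30 e'0.
move=> v; rewrite !lt_min => /andP[/andP[v1 v2] /andP[v3 v4]].
have nR := normc_Re v; have nI := normc_Im v.
have {h1} := h1 _ (le_lt_trans nR v1).
have {h2} := h2 _ (le_lt_trans nI v2).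
have {h3} := h3 _ (le_lt_trans nI v3).
rewrite !add0r expR0 cos0 sin0 oppr0 mul0r !subr0 !mul1r ?addr0 => hS hC hE.
have := trig_bound e'0 e'1 nR nI v4 hS hC hE => H.
apply: le_trans (normc_ReIm _) _.
have -> : complex.Re (cexp v - 1 - v) =
    expR (complex.Re v) * cos (complex.Im v) - 1 - complex.Re v.
  by rewrite !ReB.
have -> : complex.Im (cexp v - 1 - v) =
    expR (complex.Re v) * sin (complex.Im v) - complex.Im v.
  by rewrite !ImB /= subr0.
apply: le_trans H _; rewrite ler_wpM2r ?normc_ge0//; lra.
Qed.

(** The value [q p] is kept because it determines the residue in [annulus_formula]. *)
Lemma cexp_quotient p : exists2 q : C -> C, ctat q p &
  q p = cexp p /\ forall w, cexp w - cexp p = (w - p) * q w.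
Proof.
pose E v : C := if v == 0 then 1 else (cexp v - 1) / v.
exists (fun w => cexp p * E (w - p)); last first.
  split=> [|w]; first by rewrite subrr /E eqxx mulr1.
  rewrite /E; case: eqP => [/eqP|/eqP h].
    by rewrite subr_eq0 => /eqP ->; rewrite !subrr mul0r.
  rewrite mulrCA [(w - p) * _]mulrC divfK// mulrBr mulr1 -cexpD.
  by rewrite [p + _]addrC subrK.
apply: ctM; first exact: ct_cst.
apply: (ct_comp (g := fun w => w - p)).
  by apply: ctB; [exact: ct_id|exact: ct_cst].
rewrite subrr; apply/ctCP => e e0.
have e20 : 0 < e / 2 by rewrite divr_gt0.
have [r r0 hr] := cexp_approx e20.
apply/nbhsCP; exists r => // v; rewrite subr0 => vr.
rewrite /E eqxx; case: eqP => [_|/eqP v0]; first by rewrite subrr normc0.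
rewrite (_ : _ - 1 = (cexp v - 1 - v) / v); last by field.
rewrite normcM normcV ltr_pdivrMr ?normc_gt0//.
apply: le_lt_trans (hr v vr) _.
by rewrite ltr_pM2r ?normc_gt0//; lra.
Qed.

Lemma cdiff_cexp p : cdiff cexp p.
Proof. by have [q cq [_ Eq]] := cexp_quotient p; exists q. Qed.

Lemma cexp_periodic x : cexp (Complex x (2 * pi)) = cexp (Complex x 0).
Proof. by rewrite /cexp /= mulr_natl cos2pi sin2pi cos0 sin0. Qed.

(** Moduli settle the real parts. For the imaginary parts, [cos t = 1 - 2 * sin (t / 2) ^+ 2]
    differs from 1 for [0 < t < 2 * pi]. *)
Lemma cexp_inj w p : `|complex.Im w - complex.Im p| < 2 * pi -> cexp w = cexp p -> w = p.
Proof.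
move=> h /eqP; rewrite -subr_eq0 => /eqP E.
have E1 : cexp (w - p) = 1.
  by rewrite cexpB; move/eqP: E; rewrite subr_eq0 => /eqP ->; rewrite divff// cexp_neq0.
have R0 : complex.Re (w - p) = 0.
  have := normc_cexp (w - p); rewrite E1 normc1 => /esym/eqP.
  by rewrite -expR0 => /eqP/expR_inj.
have C1 : cos (complex.Im (w - p)) = 1.
  have := congr1 (@complex.Re R) E1; rewrite /cexp /= R0 expR0 mul1r; exact.
move: h; rewrite -ImB => h.
apply/eqP; rewrite -subr_eq0 eq_complex R0 eqxx /=; apply/eqP.
set y := complex.Im (w - p) in h C1 *.
have key (t : R) : 0 < t -> t < 2 * pi -> cos t != 1.
  move=> t0 tp; have s0 : 0 < sin (t / 2).
    by apply: sin_gt0_pi; rewrite divr_gt0//= ltr_pdivrMr// mulrC.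
  have -> : t = (t / 2) *+ 2 by rewrite -mulr_natr divfK.
  rewrite cos_mulr2n cos2sin2 lt_eqF//.
  have := exprn_gt0 2 s0; lra.
move: h; rewrite ltr_norml => /andP[h1 h2].
have [y0|y0|//] := ltgtP y 0.
  have := key (- y); rewrite oppr_gt0 cosN C1 eqxx ltrNl => /(_ y0 h1).
  by [].
by have := key y y0 h2; rewrite C1 eqxx.
Qed.

(** [acos] gives the argument in the upper half-plane, and [2 * pi - acos] in the lower one. *)
Lemma cexp_log z : z != 0 ->
  exists2 y, 0 <= y <= 2 * pi & z = cexp (Complex (ln (normc z)) y).
Proof.
move=> z0; have n0 : 0 < normc z by rewrite normc_gt0.
have nz : normc z != 0 by rewrite gt_eqF.
have sq : complex.Re z ^+ 2 + complex.Im z ^+ 2 = normc z ^+ 2.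
  by case: (z) => a b /=; rewrite sqr_sqrtr// addr_ge0 ?sqr_ge0.
pose u := complex.Re z / normc z.
have u1 : -1 <= u <= 1.
  rewrite -ler_norml normrM normfV (ger0_norm (ltW n0)) ler_pdivrMr// mul1r.
  exact: normc_Re.
have [/andP[a0 ap] ca] := acos_def u1.
have sa : sin (acos u) = `|complex.Im z| / normc z.
  rewrite sin_acos// -[RHS]ger0_norm ?divr_ge0 ?normc_ge0// -sqrtr_sqr; congr Num.sqrt.
  rewrite /u !exprMn !exprVn real_normK ?num_real//.
  rewrite (_ : complex.Im z ^+ 2 = normc z ^+ 2 - complex.Re z ^+ 2); last by rewrite -sq; ring.
  by field; rewrite nz.
have lnz : expR (ln (normc z)) = normc z by rewrite lnK// posrE.
have [I0|I0] := leP 0 (complex.Im z).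
  exists (acos u); first by rewrite a0 (le_trans ap)// ler_peMl ?pi_ge0// ler1n.
  apply/eqP; rewrite eq_complex /cexp /= lnz ca sa ger0_norm//.
  by rewrite /u; apply/andP; split; apply/eqP; field; rewrite nz.
exists (2 * pi - acos u); first by rewrite lerBlDr lerDl a0 andbT subr_ge0 (le_trans ap)// ler_peMl ?pi_ge0// ler1n.
apply/eqP; rewrite eq_complex /cexp /= lnz.
rewrite [2 * pi - _]addrC mulr_natl cosD2pi sinD2pi cosN sinN ca sa ltr0_norm//.
by rewrite /u; apply/andP; split; apply/eqP; field; rewrite nz.
Qed.

Definition circ (x t : R) : C := cexp (Complex x t).

Lemma ct_circ x t : ctat (circ x) t.
Proof.
apply: (ct_comp (g := fun t => Complex x t : C)); first exact: ct_vline.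
by apply: cdiff_continuous; exact: cdiff_cexp.
Qed.

Lemma normc_circ x t : normc (circ x t) = expR x.
Proof. by rewrite /circ normc_cexp. Qed.

(** On the circle [dw = ii * circ x t dt]; the factor [ii] is dropped, which turns the normalization
    [2 pi i] into [2 pi]. *)
Definition circ_cauchy (x : R) (u : C2 R -> C) (z : C2 R) : C :=
  cauchy_type 0 (2 * pi) (circ x) (circ x) u z.

(** Pulled back by [cexp], the annulus becomes a rectangle whose vertical edges are the two circles.
    The derivative [cexp p] of the denominator at the simple pole cancels the factor [cexp] coming
    from [dw], leaving the residue [u (cexp p)]. The bounds on [complex.Im p] keep the pole off the
    edges and make it unique. *)
Lemma annulus_formula (u : C -> C) x1 x2 p :
  x1 < complex.Re p < x2 -> 0 < complex.Im p < 2 * pi ->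
  (forall w, inrect x1 x2 0 (2 * pi) w -> cdiff u (cexp w)) ->
  cint 0 (2 * pi) (fun t => u (circ x2 t) * (circ x2 t / (circ x2 t - cexp p))) -
  cint 0 (2 * pi) (fun t => u (circ x1 t) * (circ x1 t / (circ x1 t - cexp p))) =
  u (cexp p) * (2 * pi)%:C%C.
Proof.
move=> p1 p2 du.
have [q cq [qp Eq]] := cexp_quotient p.
pose k w := u (cexp w) * (cexp w / (cexp w - cexp p)).
have pR : inrect x1 x2 0 (2 * pi) p.
  by move: p1 p2; rewrite /inrect => /andP[/ltW-> /ltW->] /andP[/ltW-> /ltW->].
have neq w : inrect x1 x2 0 (2 * pi) w -> w != p -> cexp w - cexp p != 0.
  move=> /andP[_ w2]; apply: contra; rewrite subr_eq0 => /eqP/cexp_inj h.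
  apply/eqP/h; rewrite ltr_norml; move: p2 w2 => /andP[h1 h2] /andP[h3 h4]; lra.
have du' w : inrect x1 x2 0 (2 * pi) w -> cdiff (u \o cexp) w.
  by move=> /du duw; apply: cdiff_comp => //; exact: cdiff_cexp.
have := @residue _ _ _ _ _ p k (fun w => u (cexp w) * (cexp w * (q w)^-1)) p1 p2.
rewrite qp divff ?cexp_neq0// mulr1 => H.
have {H} E : contour x1 x2 0 (2 * pi) k = u (cexp p) * twopii.
  apply: H.
  - move=> w wR wp; apply: cdiffM; first exact: du'.
    apply: cdiffM; first exact: cdiff_cexp.
    apply: cdiffV; first exact: neq.
    by apply: cdiffB; [exact: cdiff_cexp|exact: cdiff_cst].
  - apply: ctM; first by apply: cdiff_continuous; exact: du'.
    apply: ctM; first by apply: cdiff_continuous; exact: cdiff_cexp.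
    by apply: ctV => //; rewrite qp cexp_neq0.
  - move=> w wR wp; rewrite /k Eq.
    have qw : q w != 0 by apply: contraNneq (neq w wR wp); rewrite Eq => ->; rewrite mulr0.
    have wp' : w - p != 0 by rewrite subr_eq0.
    by field; rewrite wp' qw.
move: E; rewrite /contour.
(* The two horizontal edges cancel by periodicity of [cexp]. *)
rewrite (@cint_ext _ x1 x2 (fun x => k (Complex x 0)) (fun x => k (Complex x (2 * pi)))).
  rewrite subrr add0r => E; apply: (mulfI (_ : ii != 0)).
    by rewrite eq_complex /= negb_and oner_neq0 orbT.
  rewrite [LHS]E mulrCA; congr (_ * _).
  by apply/eqP; rewrite eq_complex /=; apply/andP; split; apply/eqP; ring.
by move=> x _; rewrite /k cexp_periodic.
Qed.

(** [Goursat] for [u \o cexp], where periodicity again cancels the horizontal edges. *)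
Lemma circle_mean (u : C -> C) x1 x2 : x1 <= x2 ->
  (forall w, inrect x1 x2 0 (2 * pi) w -> cdiff u (cexp w)) ->
  cint 0 (2 * pi) (fun t => u (circ x2 t)) = cint 0 (2 * pi) (fun t => u (circ x1 t)).
Proof.
move=> x12 du.
have pi2 : 0 <= 2 * pi :> R by rewrite mulr_ge0// pi_ge0.
have /= := Goursat x12 pi2 (fun w wR => cdiff_comp (cdiff_cexp w) (du w wR)).
rewrite /contour (@cint_ext _ x1 x2 (fun x => (u \o cexp) (Complex x 0))
  (fun x => (u \o cexp) (Complex x (2 * pi)))).
  rewrite subrr add0r => /eqP; rewrite mulf_eq0 => /orP[|].
    by rewrite eq_complex /= oner_eq0 andbF.
  by rewrite subr_eq0 => /eqP.
by move=> x _; rewrite /= cexp_periodic.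
Qed.

End CExp.

(** * Laurent extension *)

Section Extension.
Variable R : realType.
Local Notation C := (R[i]^o).
Implicit Types (a b x : R) (z : C2 R) (u h : C2 R -> C) (V : set (C2 R)).

(** The operator [H_a]. Circles are indexed by the logarithm of the radius, half of [log |w|^2],
    whence [a / 2] and [a / 2 + pi]. *)
Definition ext a u z : C := ((2 * pi)%:C%C)^-1 *
  (circ_cauchy (a / 2 + pi) u z - circ_cauchy (a / 2) u z).

Definition circles V a (w : C) := forall t, 0 <= t <= 2 * pi ->
  V (w, circ (a / 2) t) /\ V (w, circ (a / 2 + pi) t).

Definition in_annulus a (w : C) := w != 0 /\ a / 2 < ln (normc w) < a / 2 + pi.

Lemma pi2_ge0 : 0 <= 2 * pi :> R. Proof. by rewrite mulr_ge0// pi_ge0. Qed.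

Lemma circ_neq (x t : R) (w : C) : w != 0 -> ln (normc w) != x -> circ x t != w.
Proof. by move=> w0; apply: contra => /eqP <-; rewrite normc_circ expRK. Qed.

Lemma ext_differentiable V a u z : open V -> holomorphic_on V u ->
  circles V a z.1 -> in_annulus a z.2 -> differentiable (ext a u) z.
Proof.
move=> oV hu Vz [z0 /andP[az za]].
have d2 : differentiable (circ_cauchy (a / 2 + pi) u) z.
  apply: (cauchy_type_differentiable _ _ _ oV hu) => [|t|t|t /Vz[]//|t _].
  - exact: pi2_ge0.
  - exact: ct_circ.
  - exact: ct_circ.
  - by rewrite circ_neq// lt_eqF.
have d1 : differentiable (circ_cauchy (a / 2) u) z.
  apply: (cauchy_type_differentiable _ _ _ oV hu) => [|t|t|t /Vz[]//|t _].
  - exact: pi2_ge0.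
  - exact: ct_circ.
  - exact: ct_circ.
  - by rewrite circ_neq// gt_eqF.
have -> : ext a u = ((2 * pi)%:C%C^-1 : R[i]) \*:
    (circ_cauchy (a / 2 + pi) u - circ_cauchy (a / 2) u).
  by apply/funext.
exact (differentiableZ _ (differentiableB d2 d1)).
Qed.

Lemma near_circles V a (w : C) : open V -> circles V a w ->
  \forall w' \near w, circles V a w'.
Proof.
move=> oV cw.
have h1 := tube_curve (ct_circ (a / 2)) oV (fun t tI => (cw t tI).1).
have h2 := tube_curve (ct_circ (a / 2 + pi)) oV (fun t tI => (cw t tI).2).
by apply: filterS2 h1 h2 => w' h1 h2 t tI; split; [exact: h1|exact: h2].
Qed.

Lemma ext_annulus V a u z : open V -> holomorphic_on V u -> in_annulus a z.2 ->
  (forall x t, a / 2 <= x <= a / 2 + pi -> 0 <= t <= 2 * pi -> V (z.1, circ x t)) ->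
  ext a u z = u z.
Proof.
move=> oV hu [z20 zI] Vz.
have du w : inrect (a / 2) (a / 2 + pi) 0 (2 * pi) w ->
    cdiff (fun y : C => u (z.1, y)) (cexp w).
  case: w => x t /andP[/= xI tI].
  exact: (differentiable_slice2 (hu _ (Vz x t xI tI))).
have main (p : C) : a / 2 < complex.Re p < a / 2 + pi -> 0 < complex.Im p < 2 * pi ->
    ext a u (z.1, cexp p) = u (z.1, cexp p).
  move=> p1 p2; have := annulus_formula p1 p2 du.
  rewrite /ext /circ_cauchy /cauchy_type /= => ->.
  rewrite mulrC mulfK// -(rmorph0 (real_complex R)) (inj_eq (@complexI R)).
  by rewrite mulf_neq0 ?pnatr_eq0// gt_eqF// pi_gt0.
have [y /andP[y0 y2] zE] := cexp_log z20.
set x := ln (normc z.2) in zI zE.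
suff main0 : ext a u (z.1, cexp (Complex x 0)) = u (z.1, cexp (Complex x 0)).
  have -> : z = (z.1, z.2) by case: (z).
  rewrite zE; move: y0; rewrite le_eqVlt => /predU1P[<-//|y0].
  move: y2; rewrite le_eqVlt => /predU1P[->|y2]; first by rewrite cexp_periodic.
  by apply: main => //; rewrite /= y0.
(* On the cut of the logarithm, by continuity. *)
apply/eqP; rewrite -subr_eq0; apply/negPn/negP => N0.
pose D (t : R) := ext a u (z.1, cexp (Complex x t)) - u (z.1, cexp (Complex x t)).
have cpair : ctat (fun t => (z.1, cexp (Complex x t)) : C2 R) 0.
  by apply: ct_pair; [exact: ct_cst|exact: ct_circ].
have cD : ctat D 0.
  apply: ctB; apply: (ct_comp cpair); apply: differentiable_ctat.
    apply: (ext_differentiable oV hu).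
      by move=> t tI; split; apply: Vz => //; rewrite lexx lerDl pi_ge0.
    split; first exact: cexp_neq0.
    change (a / 2 < ln (normc (cexp (Complex x 0))) < a / 2 + pi).
    by rewrite normc_cexp expRK.
  apply: hu; apply: (Vz x 0); last by rewrite lexx pi2_ge0.
  by case/andP: zI => /ltW-> /ltW->.
have := @ct_neq0 _ _ D 0 N0 cD => /nbhs_ballP[r /= r0 hr].
pose t := Num.min (r / 2) pi.
have t0 : 0 < t by rewrite lt_min pi_gt0 divr_gt0.
have tpi : t < 2 * pi.
  by rewrite gt_min; apply/orP; right; rewrite ltr_pMl ?pi_gt0// ltr1n.
suff /negP : D t != 0 by apply; rewrite /D subr_eq0; apply/eqP/main => //=; rewrite t0.
apply: hr; rewrite /ball /= sub0r normrN gtr0_norm// gt_min; apply/orP; left; lra.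
Qed.

(** Two uses of the tube lemma, in the angle and in the radius, thicken the closed annulus over 0;
    then [ext_annulus] applies on each nearby line. *)
Lemma ext_near0 V a u (w : C) : open V -> holomorphic_on V u -> in_annulus a w ->
  (forall x t, a / 2 <= x <= a / 2 + pi -> 0 <= t <= 2 * pi -> V (0, circ x t)) ->
  \forall w' \near (0 : C), ext a u (w', w) = u (w', w).
Proof.
move=> oV hu wA V0.
have : \forall w' \near (0 : C), forall x, a / 2 <= x <= a / 2 + pi ->
    forall t, 0 <= t <= 2 * pi -> V (w', circ x t).
  apply: (tube (P := fun p : C * R => forall t, 0 <= t <= 2 * pi -> V (p.1, circ p.2 t))).
  move=> x xI.
  apply: (tube (P := fun q : (C * R) * R => V (q.1.1, circ q.1.2 q.2))) => t tI.
  apply: (ctat_near (f := fun q : (C * R) * R => (q.1.1, circ q.1.2 q.2)) (P := V)).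
    apply: ct_pair.
      by apply: (ct_comp (g := fst) (f := fst)); exact: ct_fst.
    apply: (ct_comp (g := fun q : (C * R) * R => Complex q.1.2 q.2 : C)).
      apply: ct_Complex; last exact: ct_snd.
      by apply: (ct_comp (g := fst) (f := snd)); [exact: ct_fst|exact: ct_snd].
    by apply: cdiff_continuous; exact: cdiff_cexp.
  by apply: open_nbhs_nbhs; split => //; exact: V0.
apply: filterS => w' hw'; apply: (ext_annulus (z := (w', w)) oV hu) => //.
by move=> x t xI; exact: hw'.
Qed.

Lemma cdiff_ext V a u (z1 w : C) : open V -> holomorphic_on V u -> in_annulus a w ->
  circles V a z1 -> \forall z \near z1, cdiff (fun y : C => ext a u (y, w)) z.
Proof.
move=> oV hu wA /(near_circles oV); apply: filterS => z zc.
by apply: (differentiable_slice1 (z := (z, w))); exact: (ext_differentiable oV hu).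
Qed.

Section agree.
Variables (V : set (C2 R)) (u : C2 R -> C) (z1 z2 : C).
Hypotheses (oV : open V) (hu : holomorphic_on V u).
(** The Hartogs figure along the segment from 0 to [z1]: the two circles over each of its points,
    and the full closed annulus over 0. *)
Let star a := [/\ in_annulus a z2,
  forall s, 0 <= s <= 1 -> circles V a (s%:C%C * z1) &
  forall x t, a / 2 <= x <= a / 2 + pi -> 0 <= t <= 2 * pi -> V (0, circ x t)].

Lemma ext_agree a : star a -> (forall s : R, 0 <= s <= 1 -> V (s%:C%C * z1, z2)) ->
  ext a u (z1, z2) = u (z1, z2).
Proof.
move=> [zA zc V0] Vz; apply/eqP; rewrite -subr_eq0; apply/eqP.
apply: (segment_identity (F := fun w => ext a u (w, z2) - u (w, z2))).
  move=> s sI; have h1 := cdiff_ext oV hu zA (zc s sI).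
  have h2 : \forall w \near (s%:C%C * z1 : C), V (w, z2).
    apply: (ctat_near (f := fun w : C => (w, z2)) (P := V)).
      by apply: ct_pair; [exact: ct_id|exact: ct_cst].
    by apply: open_nbhs_nbhs; split => //; exact: Vz.
  apply: filterS2 h1 h2 => w h1 h2; apply: cdiffB => //.
  exact: (differentiable_slice1 (hu h2)).
by apply: filterS (ext_near0 oV hu zA V0) => w ->; rewrite subrr.
Qed.

(** Both extensions equal [u] near [z1 = 0], so they agree along the segment even where [V] does not
    contain [(z1, z2)]. *)
Lemma ext_agree2 a b : star a -> star b -> ext a u (z1, z2) = ext b u (z1, z2).
Proof.
move=> [zA zc V0] [zA' zc' V0']; apply/eqP; rewrite -subr_eq0; apply/eqP.
apply: (segment_identity (F := fun w => ext a u (w, z2) - ext b u (w, z2))).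
  move=> s sI; have h1 := cdiff_ext oV hu zA (zc s sI).
  have h2 := cdiff_ext oV hu zA' (zc' s sI).
  by apply: filterS2 h1 h2 => w h1 h2; exact: cdiffB.
apply: filterS2 (ext_near0 oV hu zA V0) (ext_near0 oV hu zA' V0') => w -> ->.
by rewrite subrr.
Qed.

End agree.
End Extension.

(** * Bounds by area integrals *)

Section CountableBase.
Local Open Scope classical_set_scope.

(** A countable base of measurable sets, the neighbourhoods being passed as [nb]. It makes open
    subsets of a product measurable for the product sigma-algebra, as countable unions of boxes. *)
Definition ctbase d (T : measurableType d) (nb : T -> set (set T)) :=
  exists (I : countType) (B : I -> set T), (forall i, measurable (B i)) /\
    forall p U, nb p U -> exists i, B i p /\ B i `<=` U.

Lemma ctbase_measurable d (T : measurableType d) nb (D U : set T) : ctbase nb ->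
  measurable D -> (forall p, D p -> U p -> nb p U) -> measurable (D `&` U).
Proof.
move=> [I [B [mB hB]]] mD oU.
pose F i := if pselect (B i `<=` U) then B i else set0.
have -> : D `&` U = D `&` \bigcup_(i in setT) F i.
  apply/seteqP; split => p [Dp].
    move=> Up; split => //; have [i [Bp BU]] := hB p U (oU p Dp Up).
    by exists i => //; rewrite /F; case: pselect.
  by move=> [i _]; rewrite /F; case: pselect => //= BU Bip; split => //; exact: BU.
apply: measurableI => //; apply: countable_bigcupT_measurable => [|i].
  exact: countableP.
by rewrite /F; case: pselect => ? /=; [exact: mB|exact: measurable0].
Qed.

Lemma ctbase_measurable_fun (R : realType) d (T : measurableType d) nb (D : set T)
    (f : T -> R) : ctbase nb ->
  (forall p r, D p -> r < f p -> nb p [set q | r < f q]) -> measurable_fun D f.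
Proof.
move=> hB cf mD; apply: (measurability _ (RGenOInfty.measurableE R)) => //.
move=> /= _ [_ [r ->] <-].
apply: (ctbase_measurable hB mD) => p Dp /=; rewrite in_itv /= andbT => rp.
have -> : f @^-1` `]r, +oo[%classic = [set q | r < f q].
  by apply/seteqP; split => q /=; rewrite in_itv /= andbT.
exact: cf.
Qed.

Lemma ctbase_prod d1 d2 (T1 : measurableType d1) (T2 : measurableType d2) nb1 nb2 :
  @ctbase d1 T1 nb1 -> @ctbase d2 T2 nb2 ->
  ctbase (fun p : T1 * T2 => filter_prod (nb1 p.1) (nb2 p.2)).
Proof.
move=> [I1 [B1 [mB1 h1]]] [I2 [B2 [mB2 h2]]].
exists (I1 * I2)%type, (fun i => B1 i.1 `*` B2 i.2); split.
  by move=> i; exact: measurableX.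
move=> p U [[V W] /= [Vp Wp] VWU].
have [i1 [p1 s1]] := h1 _ _ Vp; have [i2 [p2 s2]] := h2 _ _ Wp.
exists (i1, i2); split => //= q [/= /s1 q1 /s2 q2].
exact: VWU.
Qed.

Lemma ctbase_R (R : realType) : ctbase (fun p : measurableTypeR R => @nbhs R R p).
Proof.
exists (rat * nat)%type, (fun i => `]ratr i.1 - i.2.+1%:R^-1, ratr i.1 + i.2.+1%:R^-1[%classic).
split=> [i|p U /nbhs_ballP[r /= r0 pU]]; first exact: measurable_itv.
have [k hk] : exists k : nat, (k.+1%:R^-1 : R) < r / 2.
  have [k _ /(_ k (leqnn k)) h] := near_infty_natSinv_lt (PosNum (divr_gt0 r0 (ltr0n R 2))).
  by exists k.
have k0 : 0 < (k.+1%:R^-1 : R) by rewrite invr_gt0.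
have pk : p - k.+1%:R^-1 < p + k.+1%:R^-1 by move: k0; set t := (_ ^-1); lra.
have [q] := rat_in_itvoo pk.
rewrite in_itv /= => /andP[q1 q2].
exists (q, k) => /=; move: k0 hk q1 q2; set t := (_ ^-1) => k0 hk q1 q2.
split=> [|x /=]; rewrite in_itv /=; first lra.
by move=> /andP[x1 x2]; apply: pU; rewrite /ball /= ltr_norml; lra.
Qed.

End CountableBase.

(** * Cauchy integrals over rectangles with edges selected by averaging *)

Section AreaBound.
Variable R : realType.
Local Notation C := (R[i]^o).
Local Notation mu := (@lebesgue_measure R).
Local Notation twopii := (Complex 0 (2 * pi) : C).

(** If [X] exceeded [e / d] on the whole interval of length [d], its integral would be at least
    [e]. *)
Lemma select_point (X : measurableTypeR R -> \bar R) (l d e : R) : 0 < d ->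
  measurable_fun setT X -> (forall y, 0 <= X y)%E ->
  (\int[mu]_y X y < e%:E)%E -> exists2 y, l <= y <= l + d & (X y <= (e / d)%:E)%E.
Proof.
move=> d0 mX X0 Xe; apply/not_exists2P => H.
have H' y : l <= y <= l + d -> ((e / d)%:E <= X y)%E.
  by move=> yI; case: (H y) => // /negP; rewrite -ltNge => /ltW.
have mI : measurable (`[l, l + d]%classic : set (measurableTypeR R)).
  exact: measurable_itv.
have S1 : (\int[mu]_(y in `[l, (l + d)%R]) X y <= \int[mu]_y X y)%E.
  by apply: ge0_subset_integral.
have S2 : (\int[mu]_(y in `[l, (l + d)%R]) (e / d)%:E = e%:E)%E.
  rewrite integral_cst//.
  have := @lebesgue_measure_itv R `[l, l + d]; rewrite /= lte_fin ltrDl d0 => h.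
  by rewrite [X in (_ * X)%E]h -EFinB -EFinM addrAC subrr add0r divfK ?gt_eqF.
have S3 : (e%:E <= \int[mu]_(y in `[l, (l + d)%R]) X y)%E.
  have [e0|e0] := leP 0 (e / d).
    rewrite -S2; apply: ge0_le_integral => //.
    exact: measurable_funTS.
  have e0' : (e%:E <= 0)%E by move: e0; rewrite lee_fin ltr_pdivrMr// mul0r => /ltW.
  by apply: (le_trans e0'); apply: integral_ge0.
by have := le_lt_trans (le_trans S3 S1) Xe; rewrite ltxx.
Qed.

Lemma contour_le_rint a b c d (g : C -> C) : a <= b -> c <= d -> rectcont a b c d g ->
  normc (contour a b c d g) <=
  2 * (rint a b (fun x => normc (g (Complex x c))) +
       rint a b (fun x => normc (g (Complex x d))) +
       (rint c d (fun y => normc (g (Complex b y))) +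
        rint c d (fun y => normc (g (Complex a y))))).
Proof.
move=> ab cd cg.
have h1 := cint_norm (@ccont_h _ _ _ _ _ _ c cg cd (ltac:(by rewrite eqxx))).
have h2 := cint_norm (@ccont_h _ _ _ _ _ _ d cg cd (ltac:(by rewrite eqxx orbT))).
have h3 := cint_norm (@ccont_v _ _ _ _ _ _ b cg ab (ltac:(by rewrite eqxx orbT))).
have h4 := cint_norm (@ccont_v _ _ _ _ _ _ a cg ab (ltac:(by rewrite eqxx))).
apply: le_trans (le_normcD _ _) _; rewrite normcM normc_ii mul1r.
have k1 := le_normcD (cint a b (fun x => g (Complex x c))) (- cint a b (fun x => g (Complex x d))).
have k2 := le_normcD (cint c d (fun y => g (Complex b y))) (- cint c d (fun y => g (Complex a y))).
rewrite !normcN in k1 k2.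
move: h1 h2 h3 h4 k1 k2.
set n1 := normc _; set n2 := normc _; set n3 := normc _; set n4 := normc _.
set r1 := rint _ _ _; set r2 := rint _ _ _; set r3 := rint _ _ _; set r4 := rint _ _ _.
lra.
Qed.

Lemma rint_sub a b c d (f : R -> R) : a <= c -> c <= d -> d <= b -> rcont a b f ->
  (forall x, a <= x <= b -> 0 <= f x) -> rint c d f <= rint a b f.
Proof.
move=> ac cd db cf f0.
have p x y : a <= x -> y <= b -> 0 <= rint x y f.
  move=> ax yb; apply: Rintegral_ge0 => t; rewrite /= in_itv /= => /andP[xt ty].
  by apply: f0; rewrite (le_trans ax xt) (le_trans ty yb).
rewrite (@rint_split _ a c b)//; last by rewrite ac (le_trans cd).
rewrite (@rint_split _ c d b) ?cd//; last by apply: rcontW cf.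
have := p a c (lexx _) (le_trans cd db); have := p d b (le_trans ac cd) (lexx _); lra.
Qed.

(* The Cauchy kernel is at most [1 / d] on a contour at distance [d] from [z]. *)
Lemma contour_edges_bound z d (e : R) (f : C -> C) (xl xr yb yt : R) : 0 < d ->
  (forall w, square z (2 * d) w -> cdiff f w) ->
  complex.Re z - 2 * d <= xl <= complex.Re z - d ->
  complex.Re z + d <= xr <= complex.Re z + 2 * d ->
  complex.Im z - 2 * d <= yb <= complex.Im z - d ->
  complex.Im z + d <= yt <= complex.Im z + 2 * d ->
  (forall y, y \in [:: yb; yt] ->
    rint (complex.Re z - 2 * d) (complex.Re z + 2 * d)
      (fun x => normc (f (Complex x y))) <= e) ->
  (forall x, x \in [:: xl; xr] ->
    rint (complex.Im z - 2 * d) (complex.Im z + 2 * d)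
      (fun y => normc (f (Complex x y))) <= e) ->
  normc (f z) * (2 * pi) <= 8 * e / d.
Proof.
set z1 := complex.Re z; set z2 := complex.Im z.
move=> d0 df /andP[l1 l2] /andP[r1 r2] /andP[b1 b2] /andP[t1 t2] he ve.
have [lr bt] : xl <= xr /\ yb <= yt by split; lra.
have sub w : inrect xl xr yb yt w -> square z (2 * d) w.
  move=> /andP[/andP[w1 w2] /andP[w3 w4]]; rewrite /square /inrect -/z1 -/z2.
  by rewrite (le_trans l1 w1) (le_trans w2 r2) (le_trans b1 w3) (le_trans w4 t2).
have dist w : onrect xl xr yb yt w -> d <= normc (w - z).
  move=> /andP[_ /or4P[] /eqP E].
  - apply: le_trans (normc_Re _); rewrite ReB E -/z1 ler_normr; lra.
  - apply: le_trans (normc_Re _); rewrite ReB E -/z1 ler_normr; lra.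
  - apply: le_trans (normc_Im _); rewrite ImB E -/z2 ler_normr; lra.
  - apply: le_trans (normc_Im _); rewrite ImB E -/z2 ler_normr; lra.
have := @Cauchy_formula _ xl xr yb yt z f; rewrite -/z1 -/z2.
have zx : xl < z1 < xr by apply/andP; split; lra.
have zy : yb < z2 < yt by apply/andP; split; lra.
move=> /(_ zx zy (fun w wR => df w (sub w wR))) E.
have cf w : square z (2 * d) w -> ctat f w by move=> /df; exact: cdiff_continuous.
have cg : rectcont xl xr yb yt (fun w => f w / (w - z)).
  move=> w wS; apply: ctM; first by apply: cf; apply: sub; case/andP: wS.
  apply: ct_subV; rewrite -subr_eq0 -normc_gt0; exact: lt_le_trans (dist w wS).
have npi : normc twopii = 2 * pi.
  rewrite /= expr0n add0r sqrtr_sqr ger0_norm// mulr_ge0//; exact: pi_ge0.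
rewrite -npi -normcM -E; apply: le_trans (contour_le_rint lr bt cg) _.
have cfN : rectcont xl xr yb yt f.
  by apply: rectcontW => w /sub; exact: cf.
have edge a b a' b' (l : R -> C) : a <= a' -> a' <= b' -> b' <= b ->
    (forall t, ctat l t) ->
    (forall t, a <= t <= b -> square z (2 * d) (l t)) ->
    (forall t, a' <= t <= b' -> onrect xl xr yb yt (l t)) ->
    rint a b (fun t => normc (f (l t))) <= e ->
    rint a' b' (fun t => normc (f (l t) / (l t - z))) <= e / d.
  move=> aa ab bb cl lS lE le.
  have c1 : rcont a b (fun t => normc (f (l t))).
    by apply: ccont_normc => t tI; apply: (ct_comp (f := f) (cl t)); apply: cf; exact: lS.
  have c1' : rcont a' b' (fun t => normc (f (l t))) by apply: rcontW c1.
  have c2 : rcont a' b' (fun t => d^-1 * normc (f (l t))).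
    move=> t tI; apply/ctatP; apply: cvgM; first exact: cvg_cst.
    by apply/ctatP; exact: c1'.
  have c3 : rcont a' b' (fun t => normc (f (l t) / (l t - z))).
    by apply: ccont_normc => t tI; apply: (ct_comp (f := fun w => f w / (w - z)) (cl t)); apply: cg; exact: lE.
  apply: (@le_trans _ _ (rint a' b' (fun t => d^-1 * normc (f (l t))))).
    apply: rint_le => // t tI; rewrite normcM normcV mulrC.
    rewrite ler_wpM2r ?normc_ge0// lef_pV2 ?posrE//; first exact: (dist _ (lE t tI)).
    by apply: lt_le_trans (dist _ (lE t tI)).
  rewrite rintZ// mulrC ler_wpM2r ?invr_ge0 ?(ltW d0)//.
  by apply: le_trans le; apply: rint_sub => // t _; exact: normc_ge0.
have E1 := @edge (z1 - 2 * d) (z1 + 2 * d) xl xr (fun x => Complex x yb) l1 lr r2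
  (ct_hline yb) _ _ (he yb (mem_head _ _)).
have E2 := @edge (z1 - 2 * d) (z1 + 2 * d) xl xr (fun x => Complex x yt) l1 lr r2
  (ct_hline yt) _ _ (he yt (mem_last yb [:: yt])).
have E3 := @edge (z2 - 2 * d) (z2 + 2 * d) yb yt (fun y => Complex xr y) b1 bt t2
  (ct_vline xr) _ _ (ve xr (mem_last xl [:: xr])).
have E4 := @edge (z2 - 2 * d) (z2 + 2 * d) yb yt (fun y => Complex xl y) b1 bt t2
  (ct_vline xl) _ _ (ve xl (mem_head _ _)).
have hS y t : z2 - 2 * d <= y <= z2 + 2 * d -> z1 - 2 * d <= t <= z1 + 2 * d ->
    square z (2 * d) (Complex t y).
  by move=> h1 h2; rewrite /square /inrect /= h2.
rewrite (_ : 8 * e / d = 2 * (e / d + e / d + (e / d + e / d))); last by field; rewrite gt_eqF.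
rewrite ler_pM2l//; apply: lerD; apply: lerD.
- apply: E1 => t tI; last by apply: onrect_h => //; rewrite eqxx.
  apply: hS => //; lra.
- apply: E2 => t tI; last by apply: onrect_h => //; rewrite eqxx orbT.
  apply: hS => //; lra.
- apply: E3 => t tI; last by apply: onrect_v => //; rewrite eqxx orbT.
  apply: hS => //; lra.
- apply: E4 => t tI; last by apply: onrect_v => //; rewrite eqxx.
  apply: hS => //; lra.
Qed.

End AreaBound.

Section PointwiseBound.
Variable R : realType.
Local Notation C := (R[i]^o).
Local Notation mu := (@lebesgue_measure R).
Local Notation mu2 := (@lebesgue_measure2 R).
Local Notation mR := (measurableTypeR R).

Lemma rint_EFin a b (f : R -> R) : rcont a b f ->
  ((rint a b f)%:E = \int[mu]_(x in `[a, b]) (f x)%:E)%E.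
Proof.
move=> cf; rewrite /rint /Rintegral fineK//.
by apply: integrable_fin_num => //; exact: rcont_integrable.
Qed.

Lemma rint_le_integral a b (f : R -> R) (h : mR -> \bar R) (e : R) : rcont a b f ->
  measurable_fun setT h -> (forall x, 0 <= h x)%E -> (forall x, a <= x <= b -> 0 <= f x) ->
  (forall x, a <= x <= b -> ((f x)%:E <= h x)%E) ->
  (\int[mu]_x h x <= e%:E)%E -> rint a b f <= e.
Proof.
move=> cf mh h0 f0 fh he; rewrite -lee_fin rint_EFin//.
have mI : measurable (`[a, b]%classic : set mR) by exact: measurable_itv.
apply: le_trans he.
have S1 : (\int[mu]_(y in `[a, b]) h y <= \int[mu]_y h y)%E.
  by apply: ge0_subset_integral.
apply: le_trans S1.
have /integrableP[mf _] := rcont_integrable cf.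
by apply: ge0_le_integral => //; exact: measurable_funTS.
Qed.

(* The four edges of the contour are chosen independently, each along a line
   where the integral of [h] does not exceed its average. *)
Lemma area_bound (f : C -> C) z d (e : R) (h : mR * mR -> \bar R) : 0 < d ->
  (forall w, square z (2 * d) w -> cdiff f w) ->
  measurable_fun setT h -> (forall p, 0 <= h p)%E ->
  (forall x y, square z (2 * d) (Complex x y) ->
     ((normc (f (Complex x y)))%:E <= h (x, y))%E) ->
  (\int[mu2]_p h p < e%:E)%E ->
  normc (f z) * (2 * pi) <= 8 * e / d ^+ 2.
Proof.
move=> d0 df mh h0 fh he.
have heF : (\int[mu]_x \int[mu]_y h (x, y) < e%:E)%E.
  by have := fubini_tonelli1 (m1 := mu) (m2 := mu) h mh h0 => <-.
have heG : (\int[mu]_y \int[mu]_x h (x, y) < e%:E)%E.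
  by have := fubini_tonelli2 (m1 := mu) (m2 := mu) h mh h0 => <-.
have mF := measurable_fun_fubini_tonelli_F (m2 := mu) h mh h0.
have mG := measurable_fun_fubini_tonelli_G (m1 := mu) h mh h0.
have F0 (x : mR) : (0 <= \int[mu]_y h (x, y))%E by apply: integral_ge0.
have G0 (y : mR) : (0 <= \int[mu]_x h (x, y))%E by apply: integral_ge0.
set z1 := complex.Re z; set z2 := complex.Im z.
have [xl xlI xlb] := select_point (z1 - 2 * d) d0 mF F0 heF.
have [xr xrI xrb] := select_point (z1 + d) d0 mF F0 heF.
have [yb ybI ybb] := select_point (z2 - 2 * d) d0 mG G0 heG.
have [yt ytI ytb] := select_point (z2 + d) d0 mG G0 heG.
rewrite (_ : 8 * e / d ^+ 2 = 8 * (e / d) / d); last by field; rewrite gt_eqF.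
have sq x y : z1 - 2 * d <= x <= z1 + 2 * d -> z2 - 2 * d <= y <= z2 + 2 * d ->
    square z (2 * d) (Complex x y).
  by move=> xI yI; rewrite /square /inrect /= xI yI.
have cf w : square z (2 * d) w -> ctat f w by move=> /df; exact: cdiff_continuous.
apply: (@contour_edges_bound _ z d (e / d) f xl xr yb yt) => //; rewrite -/z1 -/z2.
- lra.
- lra.
- lra.
- lra.
- move=> y; rewrite !inE => yE.
  have yI : z2 - 2 * d <= y <= z2 + 2 * d by case/orP: yE => /eqP ->; lra.
  apply: (rint_le_integral (h := fun x => h (x, y))) => //.
  + apply: ccont_normc => x xI; apply: (ct_comp (f := f) (ct_hline y x)).
    by apply: cf; exact: sq.
  + exact: measurableT_comp.
  + by move=> x _; exact: normc_ge0.
  + by move=> x xI; apply: fh; exact: sq.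
  + by case/orP: yE => /eqP ->.
- move=> x; rewrite !inE => xE.
  have xI : z1 - 2 * d <= x <= z1 + 2 * d by case/orP: xE => /eqP ->; lra.
  apply: (rint_le_integral (h := fun y => h (x, y))) => //.
  + apply: ccont_normc => y yI; apply: (ct_comp (f := f) (ct_vline x y)).
    by apply: cf; exact: sq.
  + exact: measurableT_comp.
  + by move=> y _; exact: normc_ge0.
  + by move=> y yI; apply: fh; exact: sq.
  + by case/orP: xE => /eqP ->.
Qed.

(** [area_bound] in the second variable bounds [F (_, z.2)] by [K] times the fibre integral [G] of
    [H]; this majorant then serves as the [h] of [area_bound] in the first variable. *)
Lemma area_bound2 (F : C2 R -> C) (z : C2 R) d (e : R)
    (H : (mR * mR) * (mR * mR) -> \bar R) : 0 < d ->
  (forall w1 w2, square z.1 (2 * d) w1 -> square z.2 (2 * d) w2 ->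
     cdiff (fun x => F (x, w2)) w1 /\ cdiff (fun x => F (w1, x)) w2) ->
  measurable_fun setT H -> (forall p, 0 <= H p)%E ->
  (forall p, square z.1 (2 * d) (toC2 p).1 -> square z.2 (2 * d) (toC2 p).2 ->
     ((normc (F (toC2 p)))%:E <= H p)%E) ->
  (\int[lebesgue_measure4 R]_p H p < e%:E)%E ->
  normc (F z) * (2 * pi) ^+ 2 <= 64 * e / d ^+ 4.
Proof.
move=> d0 dF mH H0 FH He.
have pi0 : 0 < 2 * pi :> R by rewrite mulr_gt0// pi_gt0.
have HeF : (\int[mu2]_x \int[mu2]_y H (x, y) < e%:E)%E.
  by have := fubini_tonelli1 (m1 := mu2) (m2 := mu2) H mH H0 => <-.
have mF := measurable_fun_fubini_tonelli_F (m2 := mu2) H mH H0.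
pose G (x : mR * mR) := (\int[mu2]_y H (x, y))%E.
have G0 x : (0 <= G x)%E by apply: integral_ge0.
pose K := 8 / d ^+ 2 / (2 * pi).
have K0 : 0 < K by rewrite !divr_gt0// exprn_gt0.
have sz q : square q (2 * d) q by rewrite /square /inrect; apply/andP; split; lra.
have step (x y : mR) : square z.1 (2 * d) (Complex x y) ->
    ((normc (F (Complex x y, z.2)))%:E <= K%:E * G (x, y))%E.
  move=> xyS.
  have key (g : R) : (G (x, y) < g%:E)%E -> normc (F (Complex x y, z.2)) <= K * g.
    move=> Gg; have -> : K * g = 8 * g / d ^+ 2 / (2 * pi) by rewrite /K; ring.
    rewrite ler_pdivlMr//.
    apply: (@area_bound (fun w => F (Complex x y, w)) z.2 d g (fun p => H ((x, y), p))) => //.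
    - by move=> w wS; have [] := dF _ _ xyS wS.
    - exact: measurableT_comp.
    - by move=> s t stS; apply: (FH ((x, y), (s, t))).
  (* The strict inequality required by [key] is reached by enlarging a finite fibre integral
     slightly; an infinite one makes the majorant trivial. *)
  case E : (G (x, y)) => [g||].
  - rewrite -EFinM lee_fin; apply/ler_addgt0Pl => t t0.
    have /key : (G (x, y) < (g + t / K)%:E)%E by rewrite E lte_fin ltrDl divr_gt0.
    by rewrite mulrDr mulrC [K * (t / K)]mulrC divfK ?gt_eqF// addrC mulrC.
  - by rewrite gt0_muley ?lte_fin// leey.
  - by have := G0 (x, y); rewrite E.
have : normc (F (z.1, z.2)) * (2 * pi) <= 8 * (K * e) / d ^+ 2.
  apply: (@area_bound (fun w => F (w, z.2)) z.1 d (K * e) (fun p => K%:E * G p)%E) => //.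
  - by move=> w wS; have [] := dF _ _ wS (sz z.2).
  - exact: measurable_funeM.
  - by move=> p; rewrite mule_ge0// lee_fin ltW.
  rewrite ge0_integralZl_EFin//; last exact: ltW.
  have K0' : (0 < K%:E)%E by rewrite lte_fin.
  rewrite EFinM; apply: (_ : (_ < _)%E = true).
  by have := lte_pmul2l (isT : K%:E \is a fin_num) K0' (\int[mu2]_x G x)%E e%:E => ->.
have -> : (z.1, z.2) = z by case: (z).
move=> /(ler_wpM2r (ltW pi0)); rewrite -[normc _ * _ * _]mulrA -[2 * pi * (2 * pi)]expr2 => /le_trans; apply.
rewrite le_eqVlt; apply/orP; left; apply/eqP; rewrite /K.
by move: (2 * pi) pi0 => P P0; field; rewrite (gt_eqF d0) (gt_eqF P0).
Qed.

End PointwiseBound.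

(** * Values of holomorphic functions bounded by the L^2 norm *)

Section L2Bound.
Variable R : realType.
Local Notation C := (R[i]^o).
Local Notation mR := (measurableTypeR R).
Local Notation mu4 := (@lebesgue_measure4 R).
Implicit Types (Omega : set (C2 R)) (F : C2 R -> C).

Lemma ct_toC2 (p : (R * R) * (R * R)) : ctat (@toC2 R) p.
Proof.
have h (U : topologicalType) (f : U -> R * R) (q : U) : ctat f q ->
    ctat (fun x => Complex (f x).1 (f x).2 : C) q.
  move=> cf; apply: ct_Complex; apply: (ct_comp cf); [exact: ct_fst|exact: ct_snd].
by apply: ct_pair; apply: h; [exact: ct_fst|exact: ct_snd].
Qed.

Definition nbhs4 (p : (mR * mR) * (mR * mR)) : set (set ((mR * mR) * (mR * mR))) :=
  filter_prod (filter_prod (@nbhs R R p.1.1) (@nbhs R R p.1.2))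
    (filter_prod (@nbhs R R p.2.1) (@nbhs R R p.2.2)).

Lemma ctbase4 : ctbase nbhs4.
Proof.
have h := ctbase_R R.
exact: (ctbase_prod (ctbase_prod h h) (ctbase_prod h h)).
Qed.

Lemma measurable_toC2_preimage Omega : open Omega ->
  measurable (@toC2 R @^-1` Omega : set ((mR * mR) * (mR * mR))).
Proof.
move=> oO; rewrite -[X in measurable X]setTI.
apply: (ctbase_measurable ctbase4) => // p _ /= Op.
apply: (ctat_near (ct_toC2 p) (P := Omega)).
exact: open_nbhs_nbhs.
Qed.

Lemma measurable_holo Omega F : open Omega -> holomorphic_on Omega F ->
  measurable_fun (@toC2 R @^-1` Omega : set ((mR * mR) * (mR * mR)))
    (fun p => normc (F (toC2 p))).
Proof.
move=> oO hF; apply: (ctbase_measurable_fun ctbase4) => p r Op rp.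
have c : ctat (fun p => normc (F (toC2 p))) p.
  apply: (ct_comp (f := fun z => normc (F z)) (ct_toC2 p)).
  apply: (ct_comp (g := F) (f := @normc R)); last exact: ct_normc.
  exact: (differentiable_ctat (hF _ Op)).
apply: (ctat_near c (P := fun x => r < x)).
exact: lt_nbhsr.
Qed.

Lemma L2norm_sqr Omega F :
  (\int[mu4]_p ((((fun p => normc (F (toC2 p))) \_ (@toC2 R @^-1` Omega)) p) ^+ 2)%:E
   = L2norm Omega F `^ 2)%E.
Proof.
rewrite /L2norm poweR_Lnorm//; apply: eq_integral => p _ /=.
by rewrite powR_mulrn// real_normK// num_real.
Qed.

(** The area bound is applied to the holomorphic function [F ^+ 2], whose L^1 norm is the squared
    L^2 norm of [F], so no Cauchy-Schwarz inequality intervenes. The factor [(2 * pi) ^+ 2 >= 1] is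
    discarded. *)
Lemma L2_bound Omega F z d e : open Omega -> holomorphic_on Omega F -> 0 < d -> 0 < e ->
  (forall w1 w2, square z.1 (2 * d) w1 -> square z.2 (2 * d) w2 -> Omega (w1, w2)) ->
  (L2norm Omega F < e%:E)%E -> normc (F z) <= 8 * e / d ^+ 2.
Proof.
move=> oO hF d0 e0 sO Fe.
pose g := (fun p => normc (F (toC2 p))) \_ (@toC2 R @^-1` Omega).
have mg : measurable_fun setT (g : ((mR * mR) * (mR * mR)) -> R).
  apply/(measurable_restrictT _ _).1; first exact: measurable_toC2_preimage.
  exact: measurable_holo.
have := @area_bound2 _ (fun w => F w ^+ 2) z d (e ^+ 2) (fun p => (g p ^+ 2)%:E) d0.
have E : (\int[mu4]_p (g p ^+ 2)%:E < (e ^+ 2)%:E)%E.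
  rewrite L2norm_sqr.
  have : (0 <= L2norm Omega F)%E by exact: Lnorm_ge0.
  move: Fe; case: (L2norm Omega F) => [l||//]; last by rewrite ltNge leey.
  rewrite lte_fin lee_fin => le l0.
  by rewrite poweR_EFin lte_fin powR_mulrn// ltrXn2r.
move=> /(_ _ _ _ _ E) H.
have {H} : normc (F z ^+ 2) * (2 * pi) ^+ 2 <= 64 * e ^+ 2 / d ^+ 4.
  apply: H.
  - move=> w1 w2 h1 h2; have df := hF _ (sO _ _ h1 h2).
    split; apply: cdiffX; [exact: (differentiable_slice1 df)|exact: (differentiable_slice2 df)].
  - by apply/measurable_EFinP; apply: measurable_funX.
  - by move=> p; rewrite lee_fin sqr_ge0.
  - move=> p h1 h2; rewrite lee_fin /g patchE ifT ?normcX//.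
    by rewrite inE /=; have := sO _ _ h1 h2; case: (toC2 p).
rewrite normcX => H.
have P1 : 1 <= 2 * pi :> R by have := pi_ge2 R; lra.
have {}H : normc (F z) ^+ 2 <= (8 * e / d ^+ 2) ^+ 2.
  have -> : (8 * e / d ^+ 2) ^+ 2 = 64 * e ^+ 2 / d ^+ 4 by field; rewrite gt_eqF.
  by apply: le_trans H; rewrite ler_peMr ?exprn_ege1// sqr_ge0.
by rewrite -(@ler_sqr R)// nnegrE ?normc_ge0// divr_ge0 ?sqr_ge0// mulr_ge0// ltW.
Qed.

End L2Bound.

(** * Continuity of the extension operator for the L^2 norm *)

Section ExtBound.
Variable R : realType.
Local Notation C := (R[i]^o).
Implicit Types (Omega : set (C2 R)) (f g : C2 R -> C) (z : C2 R).

Lemma nbhsC2P z (P : C2 R -> Prop) : (\forall p \near z, P p) ->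
  exists2 r : R, 0 < r & forall w1 w2 : C,
    normc (w1 - z.1) < r -> normc (w2 - z.2) < r -> P (w1, w2).
Proof.
move=> [[A B] /= [/nbhsCP[r1 r10 h1] /nbhsCP[r2 r20 h2]] AB].
exists (Num.min r1 r2); first by rewrite lt_min r10.
move=> w1 w2; rewrite !lt_min => /andP[k1 _] /andP[_ k2].
by apply: AB; split; [exact: h1|exact: h2].
Qed.

Lemma holomorphicB Omega f g : holomorphic_on Omega f -> holomorphic_on Omega g ->
  holomorphic_on Omega (f \- g).
Proof. by move=> hf hg z Oz; exact: (differentiableB (hf z Oz) (hg z Oz)). Qed.

(** The tube lemma on translates of the curve: by compactness one size of bidisc-like squares fits
    at all its points. *)
Lemma curve_square Omega (zeta : R -> C) (z1 : C) a b : open Omega ->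
  (forall t, ctat zeta t) -> (forall t, a <= t <= b -> Omega (z1, zeta t)) ->
  exists2 d : R, 0 < d & forall t, a <= t <= b -> forall w1 w2,
    square z1 (2 * d) w1 -> square (zeta t) (2 * d) w2 -> Omega (w1, w2).
Proof.
move=> oO cz Oz.
have : \forall v \near ((z1, 0) : C2 R), forall t, a <= t <= b -> Omega (v.1, zeta t + v.2).
  apply: (tube (P := fun q : C2 R * R => Omega (q.1.1, zeta q.2 + q.1.2))) => t tI.
  apply: (ctat_near (f := fun q : C2 R * R => (q.1.1, zeta q.2 + q.1.2)) (P := Omega)).
    apply: ct_pair.
      by apply: (ct_comp (g := fst) (f := fst)); exact: ct_fst.
    apply: ctD; first exact: ct_zeta.
    by apply: (ct_comp (g := fst) (f := snd)); [exact: ct_fst|exact: ct_snd].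
  by apply: open_nbhs_nbhs; split => //=; rewrite addr0; exact: Oz.
(* A point of [square q (2 * d)] is within [4 * d] of [q], here [r / 2 < r]. *)
move=> /nbhsC2P[r r0 hr]; exists (r / 8); first by rewrite divr_gt0.
move=> t tI w1 w2 /square_dist h1 /square_dist h2.
have := hr w1 (w2 - zeta t); rewrite subr0 => /(_ _ _ t tI).
rewrite /= [zeta t + _]addrC subrK; apply; lra.
Qed.

Lemma point_bound Omega z : open Omega -> Omega z -> exists2 K : R, 0 < K &
  forall f e, holomorphic_on Omega f -> 0 < e -> (L2norm Omega f < e%:E)%E ->
    normc (f z) <= K * e.
Proof.
move=> oO Oz.
(* A point is a constant curve over the degenerate interval [[0, 0]]. *)
have [||d d0 hd] := @curve_square Omega (fun=> z.2) z.1 0 0 oO.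
- by move=> t; exact: ct_cst.
- by move=> t _; case: (z) Oz.
exists (8 / d ^+ 2); first by rewrite divr_gt0// exprn_gt0.
move=> f e hf e0 fe; rewrite mulrAC.
apply: (L2_bound oO hf d0 e0) => // w1 w2.
have h0 : 0 <= (0 : R) <= 0 by rewrite lexx.
exact: (hd 0 h0).
Qed.

Lemma circ_cauchy_bound Omega x z : open Omega -> z.2 != 0 -> ln (normc z.2) != x ->
  (forall t, 0 <= t <= 2 * pi -> Omega (z.1, circ x t)) -> exists2 K : R, 0 < K &
  forall f g e, holomorphic_on Omega f -> holomorphic_on Omega g -> 0 < e ->
    (L2norm Omega (f \- g)%R < e%:E)%E ->
    normc (circ_cauchy x f z - circ_cauchy x g z) <= K * e.
Proof.
move=> oO z20 zx Oc.
have [d d0 hd] := curve_square oO (ct_circ x) Oc.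
pose k t := circ x t / (circ x t - z.2).
have ck : ccont 0 (2 * pi) k.
  move=> t _; apply: ctM; first exact: ct_circ.
  apply: ctV; first by rewrite subr_eq0 circ_neq.
  by apply: ctB; [exact: ct_circ|exact: ct_cst].
have [M M0 kM] := ccont_bounded ck.
have cu f : holomorphic_on Omega f -> ccont 0 (2 * pi) (fun t => f (z.1, circ x t) * k t).
  move=> hf t tI; apply: ctM; last exact: ck.
  apply: (ct_comp (g := fun t => (z.1, circ x t)) (f := f)).
    by apply: ct_pair; [exact: ct_cst|exact: ct_circ].
  by apply: differentiable_ctat; apply: hf; exact: Oc.
have pi0 : 0 < 2 * pi :> R by rewrite mulr_gt0// pi_gt0.
exists (2 * (8 / d ^+ 2 * M) * (2 * pi)).
  by rewrite !mulr_gt0 ?invr_gt0 ?exprn_gt0 ?pi_gt0//.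
move=> f g e hf hg e0 fge.
rewrite /circ_cauchy /cauchy_type -cintB; [|exact: cu|exact: cu].
rewrite (_ : _ * e = 2 * ((8 * e / d ^+ 2) * M) * (2 * pi - 0)); last by rewrite subr0; ring.
apply: cint_bound; first exact: ltW.
  by apply: ccontB; exact: cu.
move=> t tI; rewrite -/(k t) -mulrBl normcM; apply: ler_pM; rewrite ?normc_ge0//.
  have hfg := holomorphicB hf hg.
  have := @L2_bound _ _ _ (z.1, circ x t) d e oO hfg d0 e0; apply => // w1 w2.
  exact: hd.
exact: kM.
Qed.

(** [K] is chosen before [f], [g] and [e]; this uniformity lets identities between extensions pass
    to L^2 limits. *)
Lemma ext_bound Omega a z : open Omega -> circles Omega a z.1 -> in_annulus a z.2 ->
  exists2 K : R, 0 < K &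
  forall f g e, holomorphic_on Omega f -> holomorphic_on Omega g -> 0 < e ->
    (L2norm Omega (f \- g)%R < e%:E)%E -> normc (ext a f z - ext a g z) <= K * e.
Proof.
move=> oO Oc [z20 /andP[az za]].
have [||K1 K10 h1] := @circ_cauchy_bound Omega (a / 2) z oO z20.
- by rewrite gt_eqF.
- by move=> t /Oc[].
have [||K2 K20 h2] := @circ_cauchy_bound Omega (a / 2 + pi) z oO z20.
- by rewrite lt_eqF.
- by move=> t /Oc[].
pose N := normc ((2 * pi)%:C%C^-1 : C).
have N0 : 0 <= N by exact: normc_ge0.
exists (N * (K2 + K1) + 1); first by rewrite ltr_wpDl// mulr_ge0// addr_ge0 ?ltW.
move=> f g e hf hg e0 fge; rewrite /ext -mulrBr normcM -/N.
have := h1 f g e hf hg e0 fge; have := h2 f g e hf hg e0 fge.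
move: (circ_cauchy (a / 2 + pi) f z) (circ_cauchy (a / 2 + pi) g z).
move: (circ_cauchy (a / 2) f z) (circ_cauchy (a / 2) g z).
move=> f1 g1 f2 g2 k2 k1.
rewrite (_ : f2 - f1 - (g2 - g1) = (f2 - g2) - (f1 - g1)); last by ring.
have k3 := le_normcD (f2 - g2) (- (f1 - g1)); rewrite normcN in k3.
apply: le_trans (ler_wpM2l N0 (le_trans k3 (lerD k2 k1))) _.
by rewrite mulrDl mul1r -mulrDl mulrA lerDl ltW.
Qed.

End ExtBound.

(** * Geometry of the worm domains *)

Section Geometry.
Variable R : realType.
Local Notation C := (R[i]^o).
Implicit Types (Omega U : set (C2 R)) (z : C2 R) (mu a : R).

Lemma logsqE (w : C) : w != 0 -> logsq w = 2 * ln (normc w).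
Proof. by rewrite -normc_gt0 => w0; rewrite /logsq lnXn// mulr_natl. Qed.

Lemma logsq_circ (x t : R) : logsq (circ x t) = 2 * x.
Proof. by rewrite logsqE ?normc_circ ?expRK// cexp_neq0. Qed.

Lemma normc_expi (t : R) : normc (expi t) = 1.
Proof. by rewrite /expi /= cos2Dsin2 sqrtr1. Qed.

Lemma expiD2pi (t : R) : expi (t + 2 * pi) = expi t.
Proof. by rewrite /expi mulr_natl cosD2pi sinD2pi. Qed.

Lemma ct_expi (t : R) : ctat (fun t : R => expi t : C) t.
Proof.
apply: ct_Complex; apply/ctatP; [exact: continuous_cos|exact: continuous_sin].
Qed.

Lemma ctR_cst (T : topologicalType) (c : R) p : ctat ((fun=> c) : T -> R) p.
Proof. by apply/ctatP; exact: cvg_cst. Qed.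

Lemma ctRM (T : topologicalType) (f g : T -> R) p :
  ctat f p -> ctat g p -> ctat (fun x => f x * g x) p.
Proof.
by move=> /ctatP cf /ctatP cg; apply/ctatP; exact: (@cvgM R T (nbhs p) _ f g _ _ cf cg).
Qed.

Lemma ctRV (T : topologicalType) (f : T -> R) p : f p != 0 ->
  ctat f p -> ctat (fun x => (f x)^-1) p.
Proof.
by move=> f0 /ctatP cf; apply/ctatP; exact: (@cvgV R T (nbhs p) _ f _ f0 cf).
Qed.

Lemma ctRN (T : topologicalType) (f : T -> R) p :
  ctat f p -> ctat (fun x => - f x) p.
Proof.
by move=> /ctatP cf; apply/ctatP; exact: (@cvgN R R T (nbhs p) _ f _ cf).
Qed.

Lemma ctRX2 (T : topologicalType) (f : T -> R) p :
  ctat f p -> ctat (fun x => f x ^+ 2) p.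
Proof. by move=> cf; exact: ctRM. Qed.

Lemma ctRD (T : topologicalType) (f g : T -> R) p :
  ctat f p -> ctat g p -> ctat (fun x => f x + g x) p.
Proof.
by move=> /ctatP cf /ctatP cg; apply/ctatP; exact: (@cvgD R R T (nbhs p) _ f g _ _ cf cg).
Qed.

Lemma ct_logsq (w : C) : w != 0 -> ctat (fun w : C => logsq w) w.
Proof.
move=> w0; have n0 : 0 < normc w ^+ 2 by rewrite exprn_gt0// normc_gt0.
apply: (ct_comp (g := fun w : C => normc w ^+ 2) (f := @ln R)).
  exact: (ctRX2 (ct_normc w)).
by apply/ctatP; exact: continuous_ln.
Qed.

Definition slice_dist z : R := normc (z.1 - expi (logsq z.2)).

Lemma ct_logsq2 z : z.2 != 0 -> ctat (fun z => logsq z.2) z.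
Proof.
by move=> z0; apply: (ct_comp (g := snd) (f := fun w : C => logsq w));
  [exact: ct_snd|exact: ct_logsq].
Qed.

Lemma ct_slice_dist z : z.2 != 0 -> ctat slice_dist z.
Proof.
move=> z0; apply: (ct_comp (g := fun z => z.1 - expi (logsq z.2)) (f := @normc R)).
  apply: ctB; first exact: ct_fst.
  apply: (ct_comp (g := fun z => logsq z.2) (f := fun t => expi t : C)).
    exact: ct_logsq2.
  exact: ct_expi.
exact: ct_normc.
Qed.

Lemma near_neq0 z : z.2 != 0 -> \forall w \near z, w.2 != 0.
Proof. by move=> z0; apply: (@ct_neq0 _ _ snd) => //; exact: ct_snd. Qed.

Lemma near_lt (T : topologicalType) (f : T -> R) p (c : R) : ctat f p -> f p < c ->
  \forall q \near p, f q < c.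
Proof. by move=> cf fc; apply: (ctat_near cf (P := fun x => x < c)); exact: lt_nbhsl. Qed.

Lemma near_gt (T : topologicalType) (f : T -> R) p (c : R) : ctat f p -> c < f p ->
  \forall q \near p, c < f q.
Proof. by move=> cf fc; apply: (ctat_near cf (P := fun x => c < x)); exact: lt_nbhsr. Qed.

Lemma near_logsq z (b c : R) : z.2 != 0 -> b < logsq z.2 < c ->
  \forall w \near z, b < logsq w.2 < c.
Proof.
move=> z0 /andP[bz zc]; have h := ct_logsq2 z0.
by apply: filterS2 (near_gt h bz) (near_lt h zc) => w -> ->.
Qed.

Lemma sqr_lt1 (x : R) : 0 <= x -> (x ^+ 2 < 1) = (x < 1).
Proof. by move=> x0; rewrite expr_lt1. Qed.

(* The properties shared by the two kinds of domains. *)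
Definition wormlike mu Omega := [/\ open Omega,
  forall z, z.2 != 0 -> `|logsq z.2| < mu -> slice_dist z < 1 -> Omega z &
  exists B : R, forall z, Omega z -> [/\ z.2 != 0, `|logsq z.2| <= B & slice_dist z < 1]].

Lemma truncated_wormlike mu : wormlike mu (@truncated_worm R mu).
Proof.
split.
- rewrite openE => z [z0 z1 zmu].
  rewrite ltr_norml in zmu; rewrite sqr_lt1 ?normc_ge0// in z1.
  apply: filterS3 (near_neq0 z0) (near_lt (ct_slice_dist z0) z1) (near_logsq z0 zmu).
  by move=> w w0 w1 wmu; split; rewrite ?ltr_norml// sqr_lt1// normc_ge0.
- by move=> z z0 zmu z1; split => //; rewrite sqr_lt1// normc_ge0.
- exists mu => z [z0 z1 zmu]; split => //; first exact: ltW.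
  by move: z1; rewrite sqr_lt1// normc_ge0.
Qed.

Lemma smooth_on_continuous (D : set R) (phi : R -> R) : smooth_on D phi ->
  exists2 g : R -> R, (forall t, ctat g t) & forall t, D t -> phi t = g t.
Proof.
move=> [g [dg pg]]; exists g; last by move=> t Dt; apply: pg; exact/mem_set.
move=> t; apply/ctatP; have := dg 0%N t; rewrite /= => d.
exact/differentiable_continuous/derivable1_diffP.
Qed.

(** For openness, the closed condition [|logsq z.2| <= A] is in fact strict, because [phi] takes the
    value 1 at both ends and the slices there are empty; inside, [phi] is traded for a function
    continuous on the whole line. *)
Lemma worm_wormlike mu A (phi : R -> R) : worm_profile mu A phi ->
  wormlike mu (worm A phi).
Proof.
move=> [muA phi01 /smooth_on_continuous[g cg pg] _ [ev p0 pA _]].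
have pI t : `|t| <= A -> 0 <= phi t <= 1.
  by rewrite ler_norml => tA; apply: phi01; rewrite in_itv.
split.
- rewrite openE => z [z0 zA z1].
  have tA : - A < logsq z.2 < A.
    rewrite -ltr_norml lt_neqAle zA andbT; apply: contraTneq z1 => E.
    have -> : phi (logsq z.2) = 1.
      have A0 : 0 <= A by exact: le_trans (normr_ge0 _) zA.
      have [t0|t0] := leP 0 (logsq z.2).
        by rewrite -[logsq z.2]ger0_norm// E pA.
      have -> : logsq z.2 = - A by rewrite -E ltr0_norm// opprK.
      rewrite ev//.
      by rewrite in_itv /= lexx andbT ge0_cp.
    by rewrite subrr -leNgt sqr_ge0.
  have c : ctat (fun w => slice_dist w ^+ 2 + g (logsq w.2)) z.
    apply: ctRD; first exact: (ctRX2 (ct_slice_dist z0)).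
    exact: (ct_comp (ct_logsq2 z0) (cg (logsq z.2))).
  have z1' : slice_dist z ^+ 2 + g (logsq z.2) < 1.
    rewrite -pg; last by rewrite /= in_itv /= -ler_norml.
    by rewrite -ltrBrDr.
  apply: filterS3 (near_neq0 z0) (near_lt c z1') (near_logsq z0 tA).
  move=> w w0 w1 /andP[wA Aw].
  have wI : - A <= logsq w.2 <= A by rewrite !ltW.
  split => //; first by rewrite ler_norml.
  by rewrite pg /= ?in_itv//= ltrBrDr.
- move=> z z0 zmu z1; split => //; first exact: le_trans (ltW zmu) (ltW muA).
  rewrite p0 ?subr0 ?sqr_lt1 ?normc_ge0//.
  by rewrite in_itv /= -ler_norml ltW.
- exists A => z [z0 zA z1]; split => //.
  rewrite -sqr_lt1 ?normc_ge0//; apply: lt_le_trans z1 _.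
  by rewrite gerBl; have /andP[] := pI _ zA.
Qed.

Section wormlike.
Variables (mu : R) (Omega : set (C2 R)).
Hypothesis W : wormlike mu Omega.

Lemma wormlike_closure z : z.2 != 0 -> `|logsq z.2| < mu -> slice_dist z <= 1 ->
  closure Omega z.
Proof.
case: W => _ inn _ z0 zmu z1 B /nbhsC2P[r r0 hr].
pose s := Num.min (r / 2) 2^-1.
have s0 : 0 < s by rewrite lt_min divr_gt0//= invr_gt0.
(* Moving [z.1] by the fraction [s] of the way to the centre [e] of its disc enters Omega and
   displaces it by at most [s < r]. *)
have [sr s1] : s <= r / 2 /\ s <= 2^-1 by rewrite /s !ge_min !lexx orbT.
have s1' : 0 <= 1 - s by lra.
pose e : C := expi (logsq z.2); pose w := e + (1 - s)%:C%C * (z.1 - e).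
exists (w, z.2); split.
  apply: inn => //; rewrite /slice_dist /= -/e /w addrAC subrr add0r normcM normc_real.
  rewrite ger0_norm//; apply: le_lt_trans (ler_wpM2l s1' z1) _; lra.
apply: hr; last by rewrite subrr normc0.
rewrite (_ : w - z.1 = - (s%:C%C * (z.1 - e))); last by rewrite /w rmorphB rmorph1; ring.
rewrite normcN normcM normc_real gtr0_norm//.
by apply: le_lt_trans (ler_wpM2l (ltW s0) z1) _; lra.
Qed.

(** Convexity: since [normc e = 1], the closed disc contains 0 along with [w]. *)
Lemma slice_scale (w e : C) (s : R) : normc e = 1 -> normc (w - e) <= 1 -> 0 <= s <= 1 ->
  normc (s%:C%C * w - e) <= 1.
Proof.
move=> e1 we /andP[s0 s1].
rewrite (_ : _ - e = s%:C%C * (w - e) - (1 - s)%:C%C * e); last by rewrite rmorphB rmorph1; ring.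
apply: le_trans (le_normcD _ _) _; rewrite normcN !normcM !normc_real e1 mulr1.
rewrite !ger0_norm ?subr_ge0//; have := ler_wpM2l s0 we; lra.
Qed.

Lemma disc_annulusP a z : disc_annulus a z ->
  [/\ in_annulus a z.2, z.2 != 0 & normc (z.1 - expi a) < 1].
Proof.
move=> [z0 /andP[az za] z1]; split => //; split => //.
move: az za; rewrite logsqE// => az za; apply/andP; split; lra.
Qed.

Hypotheses (a : R) (ha : - mu < a < mu - 2 * pi).

Lemma annulus_lt_mu (t : R) : a <= t <= a + 2 * pi -> `|t| < mu.
Proof. by move: ha => /andP[h1 h2] /andP[h3 h4]; rewrite ltr_norml; lra. Qed.

Lemma logsq_circle_lo t : logsq (circ (a / 2) t) = a.
Proof. by rewrite logsq_circ mulrC divfK. Qed.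

Lemma logsq_circle_hi t : logsq (circ (a / 2 + pi) t) = a + 2 * pi.
Proof. by rewrite logsq_circ mulrDr mulrC divfK. Qed.

Lemma circles_in z : disc_annulus a z -> circles Omega a z.1.
Proof.
case: W => _ inn _ [_ _ z1] t _.
have h1 : `|a| < mu by apply: annulus_lt_mu; rewrite lexx lerDl pi2_ge0.
have h2 : `|a + 2 * pi| < mu by apply: annulus_lt_mu; rewrite lexx lerDl pi2_ge0.
split; apply: inn; rewrite ?cexp_neq0//= /slice_dist /=.
- by rewrite logsq_circle_lo.
- by rewrite logsq_circle_lo.
- by rewrite logsq_circle_hi.
- by rewrite logsq_circle_hi expiD2pi.
Qed.

Lemma circles_closure U z (s : R) : closure Omega `<=` U -> disc_annulus a z ->
  0 <= s <= 1 -> circles U a (s%:C%C * z.1).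
Proof.
move=> OU [_ _ z1] sI t _.
have h1 : `|a| < mu by apply: annulus_lt_mu; rewrite lexx lerDl pi2_ge0.
have h2 : `|a + 2 * pi| < mu by apply: annulus_lt_mu; rewrite lexx lerDl pi2_ge0.
have h3 := slice_scale (normc_expi a) (ltW z1) sI.
split; apply: OU; apply: wormlike_closure; rewrite ?cexp_neq0//= /slice_dist /=.
- by rewrite logsq_circle_lo.
- by rewrite logsq_circle_lo.
- by rewrite logsq_circle_hi.
- by rewrite logsq_circle_hi expiD2pi.
Qed.

(** At [z.1 = 0] the slice distance is exactly 1, whatever the radius: 0 is a boundary point of
    every slice. *)
Lemma annulus_closure U (x t : R) : closure Omega `<=` U ->
  a / 2 <= x <= a / 2 + pi -> U (0, circ x t).
Proof.
move=> OU /andP[x1 x2]; apply: OU; apply: wormlike_closure; rewrite ?cexp_neq0//=.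
  by rewrite logsq_circ; apply: annulus_lt_mu; apply/andP; split; lra.
by rewrite /slice_dist sub0r normcN normc_expi.
Qed.

End wormlike.
End Geometry.

(** * A square root of [z.1] *)

Section Branch.
Variable R : realType.
Local Notation C := (R[i]^o).
Implicit Types (Omega : set (C2 R)) (z : C2 R) (w : C) (t : R).

(* Meaningful only for [0 < complex.Re w]. *)
Definition csqrt w : C :=
  let s := Num.sqrt ((normc w + complex.Re w) / 2) in Complex s (complex.Im w / (2 * s)).

Lemma csqrt_gt0 w : 0 < complex.Re w -> 0 < complex.Re (csqrt w).
Proof. by move=> w0; rewrite /= sqrtr_gt0 divr_gt0// ltr_wpDl// normc_ge0. Qed.

Lemma sqr_csqrt w : 0 < complex.Re w -> csqrt w ^+ 2 = w.
Proof.
move=> w0; have s0 := csqrt_gt0 w0; rewrite /= in s0.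
rewrite /csqrt; set s := Num.sqrt _ in s0 *.
have s2 : s ^+ 2 = (normc w + complex.Re w) / 2.
  by rewrite sqr_sqrtr// divr_ge0// addr_ge0 ?normc_ge0// ltW.
have n2 : normc w ^+ 2 = complex.Re w ^+ 2 + complex.Im w ^+ 2.
  by case: (w) => a b /=; rewrite sqr_sqrtr// addr_ge0 ?sqr_ge0.
have sn : normc w = 2 * s ^+ 2 - complex.Re w by rewrite s2; field.
have sne : s != 0 by rewrite gt_eqF.
have I2 : complex.Im w ^+ 2 = (2 * s ^+ 2 - complex.Re w) ^+ 2 - complex.Re w ^+ 2.
  by rewrite -sn n2; ring.
apply/eqP; rewrite eq_complex; apply/andP; split; apply/eqP => /=.
  rewrite (_ : _ / _ * _ = complex.Im w ^+ 2 / (4 * s ^+ 2)); last by field.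
  by rewrite I2; field.
by field.
Qed.

Lemma ct_csqrt w : 0 < complex.Re w -> ctat csqrt w.
Proof.
move=> w0; have s0 := csqrt_gt0 w0; rewrite /= in s0.
have cs : ctat (fun w : C => Num.sqrt ((normc w + complex.Re w) / 2)) w.
  apply: (ct_comp (g := fun w : C => (normc w + complex.Re w) / 2)); last first.
    by apply/ctatP; exact: sqrt_continuous.
  apply: ctRM; last exact: ctR_cst.
  exact: (ctRD (ct_normc w) (ct_Re w)).
apply: (ct_Complex cs); apply: ctRM; first exact: ct_Im.
apply: ctRV; first by rewrite gt_eqF// mulr_gt0.
by apply: ctRM => //; exact: ctR_cst.
Qed.

Lemma expiD (s t : R) : (expi (s + t) : C) = expi s * expi t.
Proof.
apply/eqP; rewrite eq_complex /expi /= cosD sinD.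
by apply/andP; split; apply/eqP; ring.
Qed.

Lemma expi0 : expi 0 = 1 :> C.
Proof. by rewrite /expi cos0 sin0. Qed.

Lemma expiNK t : expi t * expi (- t) = 1 :> C.
Proof. by rewrite -expiD subrr expi0. Qed.

(** Both are square roots of [expi t], and positive real parts exclude opposite signs. *)
Lemma csqrt_expi t : 0 < cos t -> 0 < cos (t / 2) -> csqrt (expi t) = expi (t / 2).
Proof.
move=> c0 c1; have s0 := @csqrt_gt0 (expi t) c0.
have : (csqrt (expi t) - expi (t / 2)) * (csqrt (expi t) + expi (t / 2)) = 0.
  rewrite -subr_sqr sqr_csqrt// expr2 -expiD.
  by rewrite -splitr subrr.
move=> /eqP; rewrite mulf_eq0 subr_eq0 => /orP[/eqP//|].
rewrite addr_eq0 => /eqP E; exfalso.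
by move: s0; rewrite E /= ltNge ltW// oppr_lt0.
Qed.

Definition branch z : C :=
  expi (logsq z.2 / 2) * csqrt (z.1 * expi (- logsq z.2)).

(** The rotation takes the slice to the unit disc about 1, inside the right half-plane where [csqrt]
    is continuous. *)
Lemma slice_Re z : slice_dist z < 1 -> 0 < complex.Re (z.1 * expi (- logsq z.2) : C).
Proof.
move=> z1; set v : C := _ * _.
have : normc (v - 1) < 1.
  rewrite -(expiNK (logsq z.2)) /v -mulrBl normcM normc_expi mulr1; exact: z1.
move=> /(le_lt_trans (normc_Re _)); rewrite ReB /= ltr_norml => /andP[+ _].
lra.
Qed.

Lemma branch_sqr z : slice_dist z < 1 -> branch z ^+ 2 = z.1.
Proof.
move=> /slice_Re h; rewrite /branch exprMn sqr_csqrt// expr2 -expiD -splitr.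
by rewrite mulrC -mulrA [expi (- _) * _]mulrC expiNK mulr1.
Qed.

Lemma branch_ct z : z.2 != 0 -> slice_dist z < 1 -> ctat branch z.
Proof.
move=> z0 z1; have cl := ct_logsq2 z0.
have ch : ctat (fun z => logsq z.2 / 2) z by apply: ctRM => //; exact: ctR_cst.
have cN := ctRN cl.
apply: ctM; first exact: (ct_comp (f := fun t => expi t : C) ch (ct_expi _)).
apply: (ct_comp (g := fun z => z.1 * expi (- logsq z.2) : C) (f := csqrt)).
  apply: ctM; first exact: ct_fst.
  exact: (ct_comp (f := fun t => expi t : C) cN (ct_expi _)).
by apply: ct_csqrt; exact: slice_Re.
Qed.

(** A continuous square root is holomorphic: by the difference of two squares,
    [(branch y + branch z)^-1] is the quotient in the first variable. The quotient in the second is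
    0, as the square [z.1] does not involve [z.2]. *)
Lemma branch_holo mu Omega : wormlike mu Omega -> holomorphic_on Omega branch.
Proof.
move=> [oO _ [B out]] z Oz; have [z0 _ z1] := out z Oz.
have cf := branch_ct z0 z1.
have f0 : branch z + branch z != 0.
  rewrite -mulr2n mulrn_eq0 /=; apply/eqP => f0.
  have := slice_Re z1; rewrite -(branch_sqr z1) f0 expr0n mul0r /=.
  by rewrite ltxx.
have cs : ctat (fun y => branch y + branch z) z by apply: ctD => //; exact: ct_cst.
apply: (@differentiable_car R branch (fun y => (branch y + branch z)^-1) (fun=> 0) z).
- exact: ctV.
- exact: ct_cst.
have : \forall w \near z, Omega w by exact: open_nbhs_nbhs.
apply: filterS2 (@ct_neq0 _ _ (fun y => branch y + branch z) z f0 cs) => w fw Ow.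
have [_ _ w1] := out w Ow.
by rewrite mulr0 addr0 -(branch_sqr z1) -(branch_sqr w1) subr_sqr mulfK.
Qed.

(** Omega lies in a box of finite measure, on which [K] majorizes the squared modulus. *)
Lemma L2norm_bounded Omega (f : C2 R -> C) (M K : R) : open Omega ->
  holomorphic_on Omega f ->
  (forall z, Omega z -> normc z.1 <= M /\ normc z.2 <= M) ->
  (forall z, Omega z -> normc (f z) ^+ 2 <= K) ->
  (L2norm Omega f < +oo)%E.
Proof.
move=> oO hf bO bf.
have [->|/set0P[z0 Oz0]] := eqVneq Omega set0.
  rewrite /L2norm (_ : _ \o _ = cst 0%E) ?Lnorm0 ?ltry//.
  by apply/funext => p /=; rewrite preimage_set0 patch_set0.
have M0 : 0 <= M by have [h _] := bO z0 Oz0; exact: le_trans (normc_ge0 _) h.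
have K0 : 0 <= K by exact: le_trans (sqr_ge0 _) (bf z0 Oz0).
pose I : set (measurableTypeR R) := `[- M, M]%classic.
pose box := (I `*` I) `*` (I `*` I).
have mI : measurable I by exact: measurable_itv.
have mbox : measurable box by do !apply: measurableX.
pose g := (fun p => normc (f (toC2 p))) \_ (@toC2 R @^-1` Omega).
have mg : measurable_fun setT (g : ((measurableTypeR R * measurableTypeR R) *
    (measurableTypeR R * measurableTypeR R)) -> R).
  apply/(measurable_restrictT _ _).1; first exact: measurable_toC2_preimage.
  exact: measurable_holo.
have fin : (\int[lebesgue_measure4 R]_p (g p ^+ 2)%:E < +oo)%E.
  apply: (@le_lt_trans _ _ (\int[lebesgue_measure4 R]_(p in box) K%:E)%E).
    rewrite [leRHS]integral_mkcond; apply: ge0_le_integral => //.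
    - by move=> p _; rewrite lee_fin sqr_ge0.
    - by apply/measurable_EFinP; apply: measurable_funX.
    - apply/(measurable_restrictT _ _).1 => //.
    - move=> p _; rewrite /g !patchE; case: ifPn => [|_]; last first.
        by rewrite expr0n /=; case: ifPn => _; rewrite lee_fin.
      rewrite inE /= => Op; rewrite ifT; first by rewrite lee_fin; exact: bf.
      have [h1 h2] := bO _ Op.
      rewrite inE /box /I /=; case: p Op h1 h2 => [[a b] [c d]] /= _ h1 h2.
      have k1 := le_trans (normc_Re (Complex a b : C)) h1.
      have k2 := le_trans (normc_Im (Complex a b : C)) h1.
      have k3 := le_trans (normc_Re (Complex c d : C)) h2.
      have k4 := le_trans (normc_Im (Complex c d : C)) h2.
      by rewrite !in_itv /= -!ler_norml.
  rewrite integral_cst//.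
  have fI : (lebesgue_measure I < +oo)%E.
    have := @lebesgue_measure_itv R `[- M, M] => h; rewrite [X in (X < _)%E]h.
    by case: ifPn => _; rewrite ?ltry// -EFinB ltry.
  have fII : (@lebesgue_measure2 R (I `*` I) < +oo)%E.
    rewrite /lebesgue_measure2 product_measure1E// lte_mul_pinfty// ge0_fin_numE//.
  rewrite lte_mul_pinfty// ?lee_fin//.
  have mII : measurable (I `*` I) by exact: measurableX.
  have h := @product_measure1E _ _ _ _ R (@lebesgue_measure2 R) (@lebesgue_measure2 R) _ _ mII mII.
  by rewrite [X in (X < _)%E]h lte_mul_pinfty// ge0_fin_numE.
move: fin; rewrite L2norm_sqr.
have : (0 <= L2norm Omega f)%E by exact: Lnorm_ge0.
by case: (L2norm Omega f) => [l||]//; rewrite ?ltry// poweRyr.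
Qed.

Lemma branch_bergman mu Omega : wormlike mu Omega -> bergman Omega branch.
Proof.
move=> W; split; first exact: branch_holo W.
have hf := branch_holo W; case: (W) => oO _ [B out].
have n1 z : Omega z -> normc z.1 <= 2.
  move=> /out[_ _ z1].
  have := le_normcD (z.1 - expi (logsq z.2)) (expi (logsq z.2)).
  rewrite subrK normc_expi; rewrite /slice_dist in z1; lra.
(* On Omega [normc (branch z) ^+ 2 = normc z.1 <= 2], and [2 * ln (normc z.2) <= B] with [0 <= B]
   gives [normc z.2 <= expR B]. *)
apply: (@L2norm_bounded _ _ (Num.max 2 (expR B)) 2) => // z Oz.
  split; first by rewrite le_max n1.
  have [z0 zB _] := out z Oz; rewrite le_max; apply/orP; right.
  have n0 : 0 < normc z.2 by rewrite normc_gt0.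
  rewrite -[leLHS]lnK ?posrE// ler_expR.
  move: zB; rewrite logsqE// ler_norml => /andP[_ h].
  have [l0|l0] := leP (ln (normc z.2)) 0; last lra.
  apply: (le_trans l0).
  by have [_ zB _] := out z Oz; exact: le_trans (normr_ge0 _) zB.
by have [_ _ z1] := out z Oz; rewrite -normcX branch_sqr// n1.
Qed.

End Branch.

(** * Extension of the Bergman closure *)

Lemma differentiable_near (K : numFieldType) (V W : normedModType K) (f g : V -> W)
  (x : V) : (\forall y \near x, f y = g y) -> differentiable f x -> differentiable g x.
Proof.
move=> fg /diff_locallyP[cd E]; apply: (differentiable_linear_approx cd) => e e0.
have /eqaddoP/(_ e e0) h := E.
have fgx := nbhs_singleton fg.
move: fg; rewrite (near_shift 0 x) /= => fg.
apply: filterS2 h fg => v /=; rewrite subr0 => h <-.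
by rewrite -fgx; move: h; rewrite /= opprD addrA.
Qed.

Section Main.
Variable R : realType.
Local Notation C := (R[i]^o).
Implicit Types (z : C2 R) (a b t : R).

Lemma disc_annulus_open a : open (@disc_annulus R a).
Proof.
rewrite openE => z [z0 za z1].
have c : ctat (fun w : C2 R => normc (w.1 - expi a)) z.
  apply: (ct_comp (g := fun w : C2 R => w.1 - expi a) (f := @normc R)); last exact: ct_normc.
  by apply: ctB; [exact: ct_fst|exact: ct_cst].
apply: filterS3 (near_neq0 z0) (near_logsq z0 za) (near_lt c z1).
by move=> w w0 wa w1; split.
Qed.

(** [- pi] is the midpoint of the parameter interval, so [b s] is interior for [0 < s < 1], and the
    conditions on [z] are open in the parameter. *)
Lemma disc_annulus_inner mu a z : 2 * pi <= mu -> - mu <= a <= mu - 2 * pi ->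
  disc_annulus a z -> exists2 b, - mu < b < mu - 2 * pi & disc_annulus b z.
Proof.
move=> hmu /andP[a1 a2] [z0 /andP[az za] z1].
have p0 := pi_gt0 R.
pose b s : R := a + s * (- pi - a).
have cb : ctat b 0.
  by apply: ctRD; [exact: ctR_cst|apply: ctRM; [exact: ct_id|exact: ctR_cst]].
have b0 : b 0 = a by rewrite /b mul0r addr0.
have cn : ctat (fun s => normc (z.1 - expi (b s) : C)) 0.
  apply: (ct_comp (g := fun s => z.1 - expi (b s) : C) (f := @normc R)); last exact: ct_normc.
  apply: ctB; first exact: ct_cst.
  exact: (ct_comp (f := fun t => expi t : C) cb (ct_expi _)).
have n1 : \forall s \near (0 : R), b s < logsq z.2 by apply: near_lt => //; rewrite b0.
have n2 : \forall s \near (0 : R), logsq z.2 - 2 * pi < b s.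
  by apply: near_gt => //; rewrite b0 ltrBlDr.
have n3 : \forall s \near (0 : R), normc (z.1 - expi (b s) : C) < 1.
  by apply: near_lt => //; rewrite b0.
have /nbhs_ballP[r /= r0 hr] : \forall s \near (0 : R),
    [/\ b s < logsq z.2, logsq z.2 - 2 * pi < b s & normc (z.1 - expi (b s) : C) < 1].
  by apply: filterS3 n1 n2 n3.
pose s := Num.min (r / 2) 2^-1.
have s0 : 0 < s by rewrite lt_min divr_gt0//= invr_gt0.
have [sr s1] : s <= r / 2 /\ s <= 2^-1 by rewrite /s !ge_min !lexx orbT.
have [|k1 k2 k3] := hr s; first by rewrite /ball /= sub0r normrN gtr0_norm//; lra.
exists (b s); first by rewrite /b; apply/andP; split; nra.
by split => //; rewrite k1 -ltrBlDr.
Qed.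

(** Only interior parameters: at an end value one of the two circles has [|logsq| = mu] and need not
    lie in Omega. *)
Definition hull mu (Omega : set (C2 R)) : set (C2 R) :=
  Omega `|` \bigcup_(a in [set a : R | - mu < a < mu - 2 * pi]) disc_annulus a.

Lemma eps_eq (x y : C) (K : R) : (forall e, 0 < e -> normc (x - y) <= K * e) -> x = y.
Proof.
move=> h; apply/eqP; rewrite -subr_eq0 -normc_eq0 eq_le normc_ge0 andbT.
apply/ler_addgt0Pl => e e0; rewrite addr0.
have K1 : 0 < `|K| + 1 by rewrite ltr_wpDl.
have := h (e / (`|K| + 1)) (divr_gt0 e0 K1) => /le_trans; apply.
rewrite mulrA ler_pdivrMr// mulrC ler_pM2l//.
by apply: le_trans (ler_norm _) _; rewrite lerDl.
Qed.

Section wormlike.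
Variables (mu : R) (Omega : set (C2 R)).
Hypotheses (W : wormlike mu Omega).
Implicit Types (f h : C2 R -> C).

Lemma holomorphic_near_closureP h : holomorphic_near_closure Omega h ->
  exists U, [/\ open U, closure Omega `<=` U, holomorphic_on U h & holomorphic_on Omega h].
Proof.
move=> [U [oU cU hU]]; exists U; split => // z Oz.
by apply: hU; apply: cU; exact: subset_closure.
Qed.

Lemma ext_closure_eq f a z : bergman_closure Omega f -> - mu < a < mu - 2 * pi ->
  disc_annulus a z -> Omega z -> ext a f z = f z.
Proof.
move=> [[hf _] af] ha za Oz; have [oO _ _] := W.
have [zA z0 z1] := disc_annulusP za.
have [K1 _ h1] := ext_bound oO (circles_in W ha za) zA.
have [K2 _ h2] := point_bound oO Oz.
apply: (@eps_eq _ _ (K1 + K2)) => e e0; have [h hh fh] := af e e0.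
have [U [oU cU hU hO]] := holomorphic_near_closureP hh.
have E : ext a h z = h z.
  have -> : z = (z.1, z.2) by case: (z).
  apply: (ext_agree oU hU); first split => //.
  - by move=> s sI; exact: (circles_closure W ha cU za sI).
  - by move=> x t xI _; exact: (annulus_closure W ha t cU xI).
  (* The segment from 0 to [z.1] starts outside Omega, but it stays in the closure and hence in
     [U]. *)
  move=> s sI; apply: cU; apply: (wormlike_closure W) => //=.
    apply: (annulus_lt_mu ha); case: za => _ /andP[/ltW-> /ltW->] _ //.
  have [_ _ [B out]] := W; have [_ _ k] := out z Oz.
  exact: (slice_scale (normc_expi _) (ltW k) sI).
have k1 := h1 f h e hf hO e0 fh.
have k2 := h2 _ e (holomorphicB hf hO) e0 fh.
rewrite E in k1; rewrite /= in k2.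
move: (ext a f z) (f z) (h z) k1 k2 => x y w k1 k2.
rewrite (_ : x - y = (x - w) + (- (y - w))); last by ring.
by apply: le_trans (le_normcD _ _) _; rewrite normcN mulrDl; exact: lerD.
Qed.

Lemma ext_consistent f a b z : bergman_closure Omega f ->
  - mu < a < mu - 2 * pi -> - mu < b < mu - 2 * pi ->
  disc_annulus a z -> disc_annulus b z -> ext a f z = ext b f z.
Proof.
move=> [[hf _] af] ha hb za zb; have [oO _ _] := W.
have [zA z0 z1] := disc_annulusP za; have [zB _ _] := disc_annulusP zb.
have [K1 _ h1] := ext_bound oO (circles_in W ha za) zA.
have [K2 _ h2] := ext_bound oO (circles_in W hb zb) zB.
apply: (@eps_eq _ _ (K1 + K2)) => e e0; have [h hh fh] := af e e0.
have [U [oU cU hU hO]] := holomorphic_near_closureP hh.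
have E : ext a h z = ext b h z.
  have -> : z = (z.1, z.2) by case: (z).
  apply: (ext_agree2 oU hU); split => //.
  - by move=> s sI; exact: (circles_closure W ha cU za sI).
  - by move=> x t xI _; exact: (annulus_closure W ha t cU xI).
  - by move=> s sI; exact: (circles_closure W hb cU zb sI).
  - by move=> x t xI _; exact: (annulus_closure W hb t cU xI).
have k1 := h1 f h e hf hO e0 fh; have k2 := h2 f h e hf hO e0 fh.
rewrite E in k1.
move: (ext a f z) (ext b f z) (ext b h z) k1 k2 => x y w k1 k2.
rewrite (_ : x - y = (x - w) + (- (y - w))); last by ring.
by apply: le_trans (le_normcD _ _) _; rewrite normcN mulrDl; exact: lerD.
Qed.

Lemma hull_open : open (hull mu Omega).
Proof.
have [oO _ _] := W; apply: openU => //.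
by apply: bigcup_open => a _; exact: disc_annulus_open.
Qed.

Lemma hull_annuli : 2 * pi <= mu ->
  \bigcup_(a in [set a : R | - mu <= a <= mu - 2 * pi]) disc_annulus a `<=` hull mu Omega.
Proof.
move=> hmu z [a /= ha za]; right.
by have [b hb zb] := disc_annulus_inner hmu ha za; exists b.
Qed.

Lemma bergman_closure_extends f : bergman_closure Omega f ->
  exists2 g : C2 R -> C, holomorphic_on (hull mu Omega) g & {in Omega, g =1 f}.
Proof.
move=> bf; have [oO _ _] := W; have [[hf _] _] := bf.
(* Some admissible parameter, with default 0 where there is none; [ext_consistent] makes the choice
   immaterial. *)
pose A z := xget 0 [set a : R | - mu < a < mu - 2 * pi /\ disc_annulus a z].
pose g z := if pselect (Omega z) then f z else ext (A z) f z.
have gO z : Omega z -> g z = f z by rewrite /g; case: pselect.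
have gA a z : - mu < a < mu - 2 * pi -> disc_annulus a z -> g z = ext a f z.
  move=> ha za; rewrite /g; case: pselect => [Oz|_] /=.
    by rewrite (ext_closure_eq bf ha za Oz).
  have [hA zA] : [set a : R | - mu < a < mu - 2 * pi /\ disc_annulus a z] (A z).
    by rewrite /A; case: xgetP => [b -> //|/(_ a)[]].
  exact: (ext_consistent bf hA ha zA za).
exists g; last by move=> z /set_mem /gO.
move=> z [Oz|[a /= ha za]].
  have : \forall w \near z, Omega w by exact: open_nbhs_nbhs.
  move=> nO; apply: (differentiable_near _ (hf z Oz)).
  by apply: filterS nO => w /gO ->.
have nA : \forall w \near z, disc_annulus a w.
  by apply: open_nbhs_nbhs; split => //; exact: disc_annulus_open.
have [zA _ _] := disc_annulusP za.
apply: (differentiable_near _ (ext_differentiable oO hf (circles_in W ha za) zA)).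
by apply: filterS nA => w wA; rewrite (gA a w ha wA).
Qed.

Lemma branch_not_closure : 2 * pi <= mu -> ~ bergman_closure Omega (@branch R).
Proof.
move=> hmu /bergman_closure_extends[g hg gf]; have [_ inn _] := W.
have p0 := pi_gt0 R.
(* [normc (1 - expi t) < 1] puts the circles [logsq = t] and [logsq = 2 * pi - t] over [z.1 = 1] in
   Omega; [t < pi / 2] allows [csqrt_expi] on both. *)
have [t t0 [tp t1]] : exists2 t : R, 0 < t & t < pi / 2 /\ normc (1 - expi t : C) < 1.
  have c : ctat (fun t => normc (1 - expi t : C)) 0.
    apply: (ct_comp (g := fun t => 1 - expi t : C) (f := @normc R)); last exact: ct_normc.
    by apply: ctB; [exact: ct_cst|exact: ct_expi].
  have /nbhs_ballP[r /= r0 hr] : \forall t \near (0 : R), normc (1 - expi t : C) < 1.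
    by apply: near_lt => //; rewrite expi0 subrr normc0.
  exists (Num.min (r / 2) (pi / 4)); first by rewrite lt_min !divr_gt0.
  split; first by rewrite gt_min; apply/orP; right; lra.
  apply: hr; rewrite /ball /= sub0r normrN gtr0_norm ?lt_min ?divr_gt0//.
  by rewrite gt_min; apply/orP; left; lra.
pose x1 := t / 2; pose x2 := pi - t / 2.
have x12 : x1 <= x2 by rewrite /x1 /x2; lra.
have du w : inrect x1 x2 0 (2 * pi) w -> cdiff (fun y : C => g (1, y)) (cexp w).
  case: w => x y /andP[/= /andP[k1 k2] _].
  apply: (differentiable_slice2 (z := (1, circ x y))); apply: hg.
  (* The parameter 0 is admissible exactly because [2 * pi <= mu]; for [mu = 2 * pi] it is an end
     value, which [hull_annuli] covers. *)
  apply: (hull_annuli hmu); exists 0 => /=; first by lra.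
  split; first exact: cexp_neq0.
    by rewrite logsq_circ; move: k1 k2; rewrite /x1 /x2; lra.
  change (normc (1 - expi 0 : C) < 1); by rewrite expi0 subrr normc0.
have ct : 0 < cos t by apply: cos_gt0_pihalf; lra.
have ct2 : 0 < cos (t / 2) by apply: cos_gt0_pihalf; lra.
have v1 y : g (1, circ x1 y) = 1.
  have lx : logsq (circ x1 y) = t by rewrite logsq_circ /x1; lra.
  rewrite gf; last first.
    apply/mem_set/inn; rewrite ?cexp_neq0//= /slice_dist ?lx//.
    by rewrite gtr0_norm//; lra.
  rewrite /branch lx mul1r csqrt_expi ?cosN//; last by rewrite mulNr cosN.
  by rewrite mulNr expiNK.
have v2 y : g (1, circ x2 y) = - 1.
  have lx : logsq (circ x2 y) = 2 * pi - t by rewrite logsq_circ /x2; lra.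
  have e2 : expi (- (2 * pi - t)) = expi t :> C.
    by rewrite opprB -expiD2pi subrK.
  have nt : normc (1 - expi (2 * pi - t) : C) < 1.
    move: t1; rewrite [2 * pi - t]addrC expiD2pi /expi /= cosN sinN.
    by rewrite !sub0r !sqrrN.
  rewrite gf; last first.
    apply/mem_set/inn; rewrite ?cexp_neq0//= /slice_dist ?lx//.
    by rewrite gtr0_norm//; lra.
  rewrite /branch lx mul1r e2 csqrt_expi//.
  rewrite -expiD (_ : _ + _ = pi); last by lra.
  by apply/eqP; rewrite eq_complex /expi /= cospi sinpi oppr0 !eqxx.
have := circle_mean x12 du.
rewrite (@cint_ext _ _ _ _ (fun=> - 1)); last by move=> y _; exact: v2.
rewrite (@cint_ext _ _ _ (fun y => g (1, circ x1 y)) (fun=> 1)); last by move=> y _; exact: v1.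
rewrite !cint_cst ?pi2_ge0// => /mulIf.
rewrite subr0 -(rmorph0 (real_complex R)) (inj_eq (@complexI R)) gt_eqF ?mulr_gt0//.
move=> /(_ isT)/(congr1 (@complex.Re R)) /=; lra.
Qed.

End wormlike.
End Main.

Theorem proposition1p1 (R : realType) (mu : R) (Omega : set (C2 R))
    (hmu : 2 * pi <= mu)
    (hOmega : (exists (A : R) (phi : R -> R),
                 worm_profile mu A phi /\ Omega = worm A phi)
              \/ Omega = truncated_worm mu) :
  (exists Omegahat : set (C2 R),
     [/\ open Omegahat,
         Omega `<=` Omegahat,
         \bigcup_(a in [set a : R | - mu <= a <= mu - 2 * pi]) disc_annulus a
           `<=` Omegahat &
         forall f : C2 R -> R[i]^o, bergman_closure Omega f ->
           exists2 g : C2 R -> R[i]^o,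
             holomorphic_on Omegahat g & {in Omega, g =1 f}])
  /\ bergman_closure Omega `<` bergman Omega.
Proof.
have W : wormlike mu Omega.
  by case: hOmega => [[A [phi [hphi ->]]]|->];
    [exact: worm_wormlike|exact: truncated_wormlike].
split.
  exists (hull mu Omega); split; [exact: hull_open|by move=> z; left| | ].
  - exact: hull_annuli.
  - exact: bergman_closure_extends.
split=> [f []//|h].
exact: (branch_not_closure W hmu (h _ (branch_bergman W))).
Qed.
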